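(* Let $E$ be a real Banach space, $x_0\in E$, and let $\{A(t)\}_{t\in I}$ be a family of linear operators in $E$ such that: (P1) the domain $D(A(t))=D$ of $A(t)$, $t\in I$, is dense in $E$ and independent of $t$; (P2) for $t\in I$ the resolvent $R(\lambda:A(t))$ of $A(t)$ exists for all $\lambda$ with $\mathrm{Re}\,\lambda\leqslant0$ and there is a constant $M$ such that $\|R(\lambda:A(t))\|_{\mathcal{L}}\leqslant\frac{M}{|\lambda|+1}$ for $\mathrm{Re}\,\lambda\leqslant0$, $t\in I$; (P3) there exist constants $L$ and $0<\alpha\leqslant1$ such that $\|(A(t)-A(s))A(\tau)^{-1}\|_{\mathcal{L}}\leqslant L|t-s|^\alpha$ for $s,t,\tau\in I$. Moreover, assume that: (i) the domain $D(A(t))=E$ for all $t\in I$ (and so is independent of $t$); (ii) the map $I\ni t\mapsto A(t)^{-1}x\in E$ is continuous for every $x\in E$; (iii) the unique evolution system $U(t,s)$ generated by the family $\{A(t)\}_{t\in I}$ is continuous with respect to the second variable in the uniform operator topology, i.e. $U(t,\cdot)\colon[0,t]\to\mathcal{L}(E)$ is continuous for every $t\in I$. Let $F\colon I\times E\multimap E$ be a set-valued map such that: (F1) for every $(t,x)\in I\times E$ the set $F(t,x)$ is nonempty, closed and convex; (F2) for every $x\in E$ the map $F(\cdot,x)$ has a strongly measurable selection; (F3) for a.a. $t\in I$ the map $F(t,\cdot)$ is upper hemicontinuous; (F4) there is $c\in L^1(I,\mathbb{R})$ such that $\sup\{|y|\colon y\in F(t,x)\}\leqslant c(t)(1+|x|)$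 for a.a. $t\in I$ and all $x\in E$; (F5) there is $\eta\in L^1(I,\mathbb{R})$ such that for all bounded subsets $\Omega\subset E$ and for a.a. $t\in I$, $\chi(F(t,\Omega))\leqslant\eta(t)\chi(\Omega)$. Then the set $S_F(x_0)\subset C(I,E)$ of all mild solutions of the initial value problem $$\dot{x}(t)+A(t)x(t)\in F(t,x(t))\ \text{ on }I,\qquad x(0)=x_0,$$ is an $R_\delta$-set.
   Context: $I=[0,T]$. $E$ has norm $|\cdot|$; $\mathcal{L}(E)$ is the space of bounded linear endomorphisms with operator norm $\|\cdot\|_{\mathcal{L}}$; $E^*$ is the dual. $C(I,E)$ carries the maximum norm; $L^1(I,E)$ is the space of Bochner integrable maps. $R(\lambda:A(t))=(\lambda-A(t))^{-1}$ (for complex $\lambda$ the resolvent is understood in the complexification of $E$). Evolution system: under (P1)-(P3) there is a unique family $U(t,s)\in\mathcal{L}(E)$, $0\leqslant s\leqslant t\leqslant T$, the evolution system generated by $\{A(t)\}_{t\in I}$ (Pazy, ''Semigroups of Linear Operators and Applications to PDE'', Ch. 5, Th. 6.1), such that: $U(s,s)=id$, $U(t,r)U(r,s)=U(t,s)$ for $s\leqslant r\leqslant t$, and $(t,s)\mapsto U(t,s)$ is strongly continuous; $\|U(t,s)\|_{\mathcal{L}}\leqslant C$; for $0\leqslant s<t\leqslant T$, $U(t,s)$ maps $E$ into $D$ and $t\mapsto U(t,s)$ is strongly differentiable, with $\frac{\partial}{\partial t}U(t,s)\in\mathcal{L}(E)$ strongly continuous on $0\leqslant s<t\leqslant T$,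 $\frac{\partial}{\partial t}U(t,s)+A(t)U(t,s)=0$, $\left\|\frac{\partial}{\partial t}U(t,s)\right\|_{\mathcal{L}}=\|A(t)U(t,s)\|_{\mathcal{L}}\leqslant\frac{C}{t-s}$, $\|A(t)U(t,s)A(s)^{-1}\|_{\mathcal{L}}\leqslant C$ for $0\leqslant s\leqslant t\leqslant T$; and for every $v\in D$, $t\in(0,T]$, $s\mapsto U(t,s)v$ is differentiable on $[0,t]$ with $\frac{\partial}{\partial s}U(t,s)v=U(t,s)A(s)v$. A mild solution is a function $x\in C(I,E)$ such that $x(t)=U(t,0)x_0+\int_0^tU(t,s)w(s)\,ds$ for all $t\in I$, for some $w\in L^1(I,E)$ with $w(t)\in F(t,x(t))$ for a.a. $t\in I$. A set-valued map $G\colon E\multimap E$ (nonempty values) is upper hemicontinuous if for each $e^*\in E^*$ the function $x\mapsto\sup_{y\in G(x)}\langle e^*,y\rangle\in\mathbb{R}\cup\{+\infty\}$ is upper semicontinuous. $\chi$ is the Hausdorff measure of noncompactness: $\chi(\Omega)=\inf\{\varepsilon>0\colon\Omega\text{ admits a finite covering by balls of radius }\varepsilon\}$; $F(t,\Omega)=\bigcup_{x\in\Omega}F(t,x)$. A nonempty compact (metric) space $X$ is an $R_\delta$-set if there is a decreasing sequence $(X_n)_{n\geqslant1}$ of contractible compacta containing $X$ as a closed subspace such that $X=\bigcap_{n\geqslant1}X_n$. *)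

(* Defs.v *)
From HB Require Import structures.
From mathcomp Require Import all_boot all_order all_algebra.
From mathcomp Require Import all_classical all_reals all_analysis.
From mathcomp Require Import complex.

Set Implicit Arguments.
Unset Strict Implicit.
Unset Printing Implicit Defensive.

Import Order.TTheory GRing.Theory Num.Theory.
Import numFieldNormedType.Exports.

Local Open Scope classical_set_scope.
Local Open Scope ring_scope.

Section operators.
Context {R : realType}.

(* Valued in \bar R, so that a bound [opnorm f <= C%:E] also asserts that the
   linear map f is bounded. *)
Definition opnorm_wrt (V : Type) (N : V -> R) (f : V -> V) : \bar R :=
  ereal_sup [set (N (f x))%:E | x in [set x | N x <= 1]].

Definition opnorm (E : normedModType R) (f : E -> E) : \bar R :=
  opnorm_wrt (fun x : E => `|x|) f.

(* A linear operator in E, i.e. defined on a linear subspace of E; the values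
   of [opfun] outside [dom] are irrelevant. *)
Record linop (E : normedModType R) := Linop {
  dom : set E ;
  opfun :> E -> E ;
  dom0 : dom 0 ;
  dom_linear : forall (a : R) x y, dom x -> dom y -> dom (a *: x + y) ;
  opfun_linear : forall (a : R) x y, dom x -> dom y ->
    opfun (a *: x + y) = a *: opfun x + opfun y }.

(* Meaningful when A is a bijection from its domain onto E. *)
Definition opinv (E : normedModType R) (A : linop E) (y : E) : E :=
  xget 0 [set x | dom A x /\ A x = y].

(* The complexification of E: the pair (x, y) stands for x + i y.  The norm is
   the Taylor norm  sup_theta |cos theta x + sin theta y|,  which is
   homogeneous over the complex numbers and extends the norm of E; all the
   usual norms on the complexification are equivalent to it. *)
Definition cplx_norm (E : normedModType R) (z : E * E) : R :=
  sup [set `|cos theta *: z.1 + sin theta *: z.2| | theta in [set: R]].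

(* (lambda - A)(x + i y), with A extended to the complexification by
   A (x + i y) = A x + i A y. *)
Definition shift_op (E : normedModType R) (A : linop E) (lambda : R[i])
    (z : E * E) : E * E :=
  (complex.Re lambda *: z.1 - complex.Im lambda *: z.2 - A z.1,
   complex.Im lambda *: z.1 + complex.Re lambda *: z.2 - A z.2).

Definition is_resolvent (E : normedModType R) (A : linop E) (lambda : R[i])
    (Q : E * E -> E * E) : Prop :=
  [/\ forall z, dom A (Q z).1 /\ dom A (Q z).2,
      forall z, shift_op A lambda (Q z) = z,
      forall z, dom A z.1 -> dom A z.2 -> Q (shift_op A lambda z) = z
    & (opnorm_wrt (@cplx_norm E) Q < +oo)%E].

End operators.

Section evolution_systems.
Context {R : realType} {E : normedModType R}.

(* f has derivative v at t along D: the derivative is one-sided when t is an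
   endpoint of the interval D. *)
Definition is_derive_in (D : set R) (f : R -> E) (t : R) (v : E) : Prop :=
  (r - t)^-1 *: (f r - f t) @[r --> within D t^'] --> v.

(* Values of U (t, s) are relevant for 0 <= s <= t <= T only. *)
Definition evolution_system (T : R) (D : set E) (A : R -> linop E)
    (U : R -> R -> {linear E -> E}) : Prop :=
  exists (C : R) (dU : R -> R -> {linear E -> E}),
    (forall (s : R) x, s \in `[0, T] -> U s s x = x) /\
    (forall (s r t : R) x, 0 <= s -> s <= r -> r <= t -> t <= T ->
       U t r (U r s x) = U t s x) /\
    (forall x, {within [set p : R * R | 0 <= p.2 <= p.1 /\ p.1 <= T],
                continuous (fun p => U p.1 p.2 x)}) /\
    (forall s t : R, 0 <= s -> s <= t -> t <= T ->
       (opnorm (U t s) <= C%:E)%E) /\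
    (forall s t : R, 0 <= s -> s < t -> t <= T ->
       [/\ forall x, D (U t s x),
           forall x, is_derive_in `]s, T] (fun r => U r s x) t (dU t s x),
           forall x, dU t s x + A t (U t s x) = 0,
           opnorm (dU t s) = opnorm (fun x => A t (U t s x))
         & (opnorm (dU t s) <= (C / (t - s))%:E)%E]) /\
    (forall x, {within [set p : R * R | 0 <= p.2 < p.1 /\ p.1 <= T],
                continuous (fun p => dU p.1 p.2 x)}) /\
    (forall s t : R, 0 <= s -> s <= t -> t <= T ->
       (opnorm (fun x => A t (U t s (opinv (A s) x))) <= C%:E)%E) /\
    (forall v (t s : R), D v -> 0 < t -> t <= T -> s \in `[0, t] ->
       is_derive_in `[0, t] (fun r => U t r v) s (U t s (A s v))).

End evolution_systems.

Section bochner.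
Context {R : realType} {E : normedModType R}.
Notation mu := (@lebesgue_measure R).

Definition simple_function (s : R -> E) : Prop :=
  finite_set (range s) /\ forall v, measurable (s @^-1` [set v]).

(* D is assumed to have finite measure. *)
Definition simple_integral (D : set R) (s : R -> E) : E :=
  \sum_(v \in range s) fine (mu (D `&` s @^-1` [set v])) *: v.

Definition strongly_measurable (D : set R) (f : R -> E) : Prop :=
  exists2 s : nat -> R -> E, (forall n, simple_function (s n)) &
    {ae mu, forall t, D t -> s n t @[n --> \oo] --> f t}.

(* v is the Bochner integral of f on D (a set of finite measure).  The
   integrand |s n - f| may fail to be Borel; it is Lebesgue measurable, and the
   integral of the library, a supremum over the simple functions below the
   integrand, is then the Lebesgue integral. *)
Definition is_bochner_integral (D : set R) (f : R -> E) (v : E) : Prop :=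
  strongly_measurable D f /\
  exists s : nat -> R -> E,
    [/\ forall n, simple_function (s n),
        (\int[mu]_(t in D) `|s n t - f t|%:E)%E @[n --> \oo] --> 0%E
      & simple_integral D (s n) @[n --> \oo] --> v].

Definition bochner_integrable (D : set R) (f : R -> E) : Prop :=
  exists v, is_bochner_integral D f v.

End bochner.

Section multimaps.
Context {R : realType} {E : normedModType R}.

Definition upper_semicontinuous (X : topologicalType) (f : X -> \bar R) : Prop :=
  forall x (a : R), (f x < a%:E)%E -> \forall y \near x, (f y < a%:E)%E.

Definition upper_hemicontinuous (G : E -> set E) : Prop :=
  forall e : {linear E -> R^o}, continuous e ->
    upper_semicontinuous (fun x => ereal_sup [set (e y : R)%:E | y in G x]).

(* Hausdorff measure of noncompactness. *)
Definition hausdorff_mnc (Omega : set E) : \bar R :=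
  ereal_inf [set e%:E | e in [set e : R | 0 < e /\
    exists s : seq E, Omega `<=` \bigcup_(c in [set` s]) ball c e]].

End multimaps.

(* C([0, T], E) with the topology of uniform convergence, that is, of the
   maximum norm. *)
Definition cont_space (R : realType) (T : R) (E : normedModType R) : Type :=
  continuousType `[0, T]%classic E.

HB.instance Definition _ (R : realType) (T : R) (E : normedModType R) :=
  PseudoMetric.copy (cont_space T E)
    (initial_topology (fun x : continuousType `[0, T]%classic E =>
       (x : arrow_uniform_type `[0, T]%classic E))).

Section mild_solutions.
Context {R : realType} {E : normedModType R}.

Definition mild_solutions (T : R) (U : R -> R -> {linear E -> E})
    (F : R -> E -> set E) (x0 : E) : set (cont_space T E) :=
  [set x : cont_space T E | exists w : R -> E,
    [/\ bochner_integrable `[0, T] w,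
        {ae (@lebesgue_measure R), forall (t : R) (It : t \in `[0, T]%classic),
           F t (x (exist _ t It)) (w t)}
      & forall (t : R) (It : t \in `[0, T]%classic), exists2 v,
          is_bochner_integral `[0, t] (fun s => U t s (w s)) v &
          x (exist _ t It) = U t 0 x0 + v]].

End mild_solutions.

Section Rdelta.

Definition homeomorphic_sets (X Y : topologicalType) (A : set X) (B : set Y)
    : Prop :=
  exists (f : X -> Y) (g : Y -> X),
    [/\ {within A, continuous f}, {within B, continuous g},
        (forall x, A x -> B (f x) /\ g (f x) = x)
      & (forall y, B y -> A (g y) /\ f (g y) = y)].

Definition contractible (R : realType) (Y : topologicalType) (K : set Y)
    : Prop :=
  exists2 y0, K y0 & exists h : R * Y -> Y,
    [/\ {within `[0, 1] `*` K, continuous h},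
        forall t y, t \in `[0, 1] -> K y -> K (h (t, y)),
        forall y, K y -> h (0, y) = y
      & forall y, K y -> h (1, y) = y0].

(* The compacta of the sequence live in some metric space Y (e.g. in the first
   of them), which need not be related to the ambient space of S. *)
Definition Rdelta (R : realType) (Z : topologicalType) (S : set Z) : Prop :=
  [/\ S !=set0, compact S
    & exists (Y : metricType R) (K : nat -> set Y),
        [/\ forall n, K n.+1 `<=` K n,
            forall n, compact (K n) /\ contractible R (K n)
          & homeomorphic_sets S (\bigcap_n K n)]].

End Rdelta.

(* Main.v *)
(* Since A(t) is everywhere defined, the evolution system is Lipschitz in time.
   In a weighted norm making the Volterra operators contractive, the solutions
   lie in a least closed family K of paths which is stable under
   w |-> U(t,0) x0 + int_0^t U(t,s) w(s) ds for the controls w with values in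
   the closed convex hulls of F(s, K(s)); the growth condition and condition
   (F5), through the behaviour of nets under integration, make K compact.  The
   compacta K_n consist of the limits of the paths of K whose controls take
   values in the closed hull of the F(s, y(s)) with y in K, |y(s) - x(s)| <=
   1/(n+1).  Their intersection is the solution set, because controls with
   totally bounded values have convex combinations converging almost
   everywhere, and F(s, .) is upper hemicontinuous.  They are contractible:
   keep a path up to the time tau, then continue it with selections of F along
   a finite net of K which are mixed by a partition of unity depending only on
   the past, and let tau run from T to 0. *)

Require Import Defs.
From HB Require Import structures.
From mathcomp Require Import all_boot all_order all_algebra.
From mathcomp Require Import all_classical all_reals all_analysis.
From mathcomp Require Import complex.
From mathcomp Require Import measurable_realfun ring lra.

Set Implicit Arguments.
Unset Strict Implicit.
Unset Printing Implicit Defensive.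

Import Order.TTheory GRing.Theory Num.Theory.
Import numFieldNormedType.Exports.

Local Open Scope classical_set_scope.
Local Open Scope ring_scope.

(** * Hahn-Banach separation *)

Section hahn_banach.
Context {R : realType}.

(** Three obstacles shape the proof. In (F5) the exceptional null set may depend on Omega, so the
    condition cannot be applied to the section K(s) at each time s separately; equicontinuity
    encloses the sections in countably many sets, one for each small time cell, which makes the
    condition usable for almost all s at once. Next, E is neither reflexive nor separable: weak
    compactness in L^1 is replaced by total boundedness of the values of the controls, which turns
    convergence along countably many functionals into convergence in norm; this convergence holds
    for averages that nearly minimise a quadratic integral. Finally, the homotopy must act on
    uniform limits of approximate solutions, which come without a control; it is therefore a formula
    in the path alone, and the control of the result is computed only for the paths [Phi w], which
    are dense in K. Compactness of K rests on a self-improving estimate: the measure of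
    noncompactness of its sections is at most half of any bound for it. Passing to sequences and
    approximating their values by a common finite set cost a factor 2 each, which the weight
    absorbs. *)

Definition sublinear (V : lmodType R) (p : V -> R) :=
  (forall x y, p (x + y) <= p x + p y) /\
  (forall (t : R) x, 0 < t -> p (t *: x) <= t * p x).

Section sublinear_theory.
Context {V : lmodType R} (p : V -> R) (ps : sublinear p).

Lemma sublinear0 : p 0 = 0.
Proof.
case: ps => pD pZ; apply/eqP; rewrite eq_le; apply/andP; split.
  have := pZ 2^-1 0 ltac:(lra); rewrite scaler0; lra.
by have := pD 0 0; rewrite addr0; lra.
Qed.

Lemma sublinearZ (t : R) x : 0 <= t -> p (t *: x) = t * p x.
Proof.
case: ps => pD pZ; rewrite le_eqVlt => /predU1P[<-|t0].
  by rewrite scale0r mul0r sublinear0.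
apply/eqP; rewrite eq_le pZ//=.
have := pZ t^-1 (t *: x); rewrite invr_gt0 => /(_ t0).
by rewrite scalerA mulVf ?gt_eqF// scale1r -ler_pdivrMl ?invr_gt0// invrK.
Qed.

Lemma sublinear_geN x : - p (- x) <= p x.
Proof. by case: ps => pD _; have := pD x (- x); rewrite subrr sublinear0; lra. Qed.

End sublinear_theory.

(* A minimal sublinear functional is odd, hence linear: it coincides with
   x |-> inf_(t >= 0) (q (x + t v) - t q v), whose value at - v is at most
   - q v. *)
Lemma shear_sublinear (V : lmodType R) (q : V -> R) (v : V) : sublinear q ->
  exists q', [/\ sublinear q', forall x, q' x <= q x & q' (- v) <= - q v].
Proof.
move=> qs; have [qD qZ] := qs.
pose S (x : V) := [set q (x + t *: v) - t * q v | t in [set t : R | 0 <= t]].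
have Slb (x : V) : has_lbound (S x).
  exists (- q (- x)) => _ [t /= t0 <-].
  have := qD (- x) (x + t *: v); rewrite addKr (sublinearZ qs)//; lra.
have S0 x : S x !=set0 by exists (q (x + 0 *: v) - 0 * q v), 0 => //=.
have le_inf x (t : R) : 0 <= t -> inf (S x) <= q (x + t *: v) - t * q v.
  by move=> t0; apply: ge_inf => //; exists t.
exists (fun x => inf (S x)); split.
- split=> [x y|s x s0].
    apply/ler_addgt0Pr => e e0; have e2 : 0 < e / 2 by rewrite divr_gt0.
    have [_ [t /= t0 <-] tx] := inf_adherent e2 (conj (S0 x) (Slb x)).
    have [_ [u /= u0 <-] uy] := inf_adherent e2 (conj (S0 y) (Slb y)).
    have := le_inf (x + y) (t + u) (addr_ge0 t0 u0).
    rewrite scalerDl addrACA => h; have := qD (x + t *: v) (y + u *: v).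
    move: tx uy h; rewrite /= mulrDl; lra.
  rewrite mulrC -ler_pdivrMr//; apply: lb_le_inf => // _ [t /= t0 <-].
  rewrite ler_pdivrMr//.
  have := le_inf (s *: x) (s * t) (mulr_ge0 (ltW s0) t0).
  rewrite -scalerA -scalerDr (sublinearZ qs _ (ltW s0)); lra.
- by move=> x; have := le_inf x 0 (lexx _); rewrite scale0r addr0 mul0r subr0.
- have := le_inf (- v) 1 ler01.
  by rewrite scale1r addNr (sublinear0 qs) mul1r sub0r.
Qed.

(** Zorn's lemma for the reversed pointwise order: the pointwise infimum of a chain is sublinear,
    and it is real-valued because every sublinear q below p satisfies q x >= - p (- x). *)
Lemma minimal_sublinear (V : lmodType R) (p : V -> R) : sublinear p ->
  exists q, [/\ sublinear q, forall x, q x <= p x &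
    forall q', sublinear q' -> (forall x, q' x <= q x) -> q' = q].
Proof.
move=> ps; pose T := {q : V -> R | sublinear q /\ forall x, q x <= p x}.
pose le (q r : T) := `[< forall x, sval r x <= sval q x >].
have [||||q qmax] := @Zorn T le.
- by move=> q; apply/asboolP.
- move=> q r s /asboolP qr /asboolP rs; apply/asboolP => x.
  exact: le_trans (rs x) (qr x).
- move=> [q hq] [r hr] /asboolP/= qr /asboolP/= rq.
  have e : q = r by apply/funext => x; apply: le_anti; rewrite qr rq.
  by subst r; congr exist; exact: Prop_irrelevance.
- move=> A Atot; have [[q0 Aq0]|/set0P/negP/negPn/eqP ->] := pselect (A !=set0);
    last by exists (exist _ p (conj ps (fun x => lexx (p x)))).
  pose S x := [set sval q x | q in A].
  have Slb x : has_lbound (S x).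
    exists (- p (- x)) => _ [q Aq <-].
    have [qs qp] := svalP q.
    by apply: le_trans (sublinear_geN qs x); rewrite lerN2.
  have S0 x : S x !=set0 by exists (sval q0 x), q0.
  have inf_le x q : A q -> inf (S x) <= sval q x.
    by move=> Aq; apply: ge_inf => //; exists q.
  have infs : sublinear (fun x => inf (S x)).
    split=> [x y|t x t0].
      apply/ler_addgt0Pr => e e0; have e2 : 0 < e / 2 by rewrite divr_gt0.
      have [_ [q /= Aq <-] qx] := inf_adherent e2 (conj (S0 x) (Slb x)).
      have [_ [r /= Ar <-] ry] := inf_adherent e2 (conj (S0 y) (Slb y)).
      (* The smaller of two members of the chain serves both points. *)
      have [s [As sq sr]] : exists s, [/\ A s, forall x, sval s x <= sval q x &
          forall x, sval s x <= sval r x].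
        by have [/asboolP h|/asboolP h] := Atot q r Aq Ar; [exists r|exists q].
      have [[sD _] _] := svalP s.
      have := inf_le (x + y) s As; have := sD x y; have := sq x; have := sr y.
      move: qx ry; lra.
    rewrite mulrC -ler_pdivrMr//; apply: lb_le_inf => // _ [q Aq <-].
    rewrite ler_pdivrMr// mulrC; have [[_ qZ] _] := svalP q.
    exact: le_trans (inf_le _ q Aq) (qZ _ _ t0).
  have infp x : inf (S x) <= p x.
    by have [_ /(_ x)] := svalP q0; exact: le_trans (inf_le x q0 Aq0).
  pose I := fun x => inf (S x).
  have hI : sublinear I /\ forall x, I x <= p x by [].
  exists (exist _ I hI) => q Aq; apply/asboolP => x /=.
  exact: inf_le.
have [qs qp] := svalP q; exists (sval q); split=> // r rs rq.
have rp x : r x <= p x by exact: le_trans (rq x) (qp x).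
have hr : sublinear r /\ forall x, r x <= p x by [].
have /(congr1 sval) : exist _ r hr = q by apply: qmax; apply/asboolP.
by [].
Qed.

Theorem hahn_banach (V : lmodType R) (p : V -> R) : sublinear p ->
  exists f : {linear V -> R^o}, forall x, f x <= p x.
Proof.
move=> /minimal_sublinear[q [qs qp qmin]].
have qN x : q (- x) = - q x.
  have [r [rs rq rx]] := shear_sublinear x qs.
  by have := sublinear_geN qs (- x); rewrite opprK -(qmin _ rs rq); move: rx; rewrite -(qmin _ rs rq); lra.
have qlin : linear (q : V -> R^o).
  move=> a x y; have [qD _] := qs.
  have qA u w : q (u + w) = q u + q w.
    apply/eqP; rewrite eq_le qD/=.
    by have := qD (- u) (- w); rewrite -opprD !qN; lra.
  rewrite qA; congr (_ + _); have [a0|a0] := leP 0 a.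
    exact: (sublinearZ qs).
  have na0 : 0 <= - a by rewrite oppr_ge0 ltW.
  rewrite -[a]opprK scaleNr qN (sublinearZ qs _ na0).
  by rewrite [(- - a) *: _]scaleNr.
pose f := GRing.isLinear.Build R V R^o *:%R q qlin.
by exists (HB.pack_for {linear V -> R^o} (q : V -> R^o) f).
Qed.

(* Apply Hahn-Banach to p x = inf { |x + l z| - l r | l >= 0, z in v - B }. *)
Lemma convex_separation (E : normedModType R) (B : set E) (v : E) (r : R) :
  (forall (t : R) x y, 0 <= t <= 1 -> B x -> B y -> B (t *: x + (1 - t) *: y)) ->
  B !=set0 -> 0 <= r -> (forall b, B b -> r <= `|v - b|) ->
  exists f : {linear E -> R^o}, (forall x, `|f x : R| <= `|x|) /\
    forall b, B b -> (f b : R) + r <= f v.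
Proof.
move=> cB [b0 Bb0] r0 rB.
pose S (x : E) := [set `|x + l.1 *: (v - l.2)| - l.1 * r |
  l in [set l : R * E | 0 <= l.1 /\ B l.2]].
have Slb x : has_lbound (S x).
  exists (- `|x|) => _ [[l b] /= [l0 Bb] <-].
  have := ler_normB (x + l *: (v - b)) x; rewrite addrC addKr normrZ ger0_norm//.
  have := ler_wpM2l l0 (rB b Bb); lra.
have S0 x : S x !=set0 by exists (`|x + 0 *: (v - b0)| - 0 * r), (0, b0).
have inf_le x (l : R) b : 0 <= l -> B b -> inf (S x) <= `|x + l *: (v - b)| - l * r.
  by move=> l0 Bb; apply: ge_inf => //; exists (l, b).
have infs : sublinear (fun x => inf (S x)).
  split=> [x y|t x t0].
    apply/ler_addgt0Pr => e e0; have e2 : 0 < e / 2 by rewrite divr_gt0.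
    have [_ [[l b] /= [l0 Bb] <-] lx] := inf_adherent e2 (conj (S0 x) (Slb x)).
    have [_ [[m c] /= [m0 Bc] <-] my] := inf_adherent e2 (conj (S0 y) (Slb y)).
    (* Convexity of B is what makes p subadditive: two directions v - b and v - c with weights l and
       m merge into a single v - a with weight l + m. *)
    have [a Ba aE] : exists2 a, B a &
        l *: (v - b) + m *: (v - c) = (l + m) *: (v - a).
      have [lm0|lm0] := eqVneq (l + m) 0.
        have [-> ->] : l = 0 /\ m = 0 by move: l0 m0 lm0; lra.
        by exists b0 => //; rewrite addr0 !scale0r addr0.
      have lmp : 0 < l + m by rewrite lt_neqAle eq_sym lm0 addr_ge0.
      exists ((l / (l + m)) *: b + (1 - l / (l + m)) *: c).
        by apply: cB => //; rewrite divr_ge0 ?(ltW lmp)//= ler_pdivrMr// mul1r lerDl.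
      have lE : (l + m) * (l / (l + m)) = l by rewrite mulrC divfK.
      have mE : (l + m) * (1 - l / (l + m)) = m.
        by rewrite mulrBr mulr1 lE addrC addKr.
      by rewrite !scalerBr scalerDr !scalerA lE mE addrACA -scalerDl -opprD.
    have := inf_le (x + y) _ _ (addr_ge0 l0 m0) Ba; rewrite -aE addrACA.
    have := ler_normD (x + l *: (v - b)) (y + m *: (v - c)).
    by move: lx my; lra.
  rewrite mulrC -ler_pdivrMr//; apply: lb_le_inf => // _ [[l b] /= [l0 Bb] <-].
  rewrite ler_pdivrMr//.
  have := inf_le (t *: x) (t * l) b (mulr_ge0 (ltW t0) l0) Bb.
  by rewrite -scalerA -scalerDr normrZ gtr0_norm//; lra.
have [f fp] := hahn_banach infs; exists f.
have fle x : (f x : R) <= `|x|.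
  apply: le_trans (fp x) _; have := inf_le x 0 b0 (lexx _) Bb0.
  by rewrite scale0r addr0 mul0r subr0.
split=> [x|b Bb].
  by rewrite ler_norml fle andbT lerNl -raddfN -normrN fle.
(* With l = 1 the norm vanishes: p (b - v) <= - r. *)
have := fp (b - v); have := inf_le (b - v) 1 b ler01 Bb.
rewrite scale1r mul1r -(opprB v b) addNr normr0 sub0r raddfN/= raddfB/=; lra.
Qed.

Lemma norming_functional (E : normedModType R) (v : E) :
  exists f : {linear E -> R^o}, (forall x, `|f x : R| <= `|x|) /\
    (f v : R) = `|v|.
Proof.
have [|||f [fle fv]] :=
    @convex_separation E [set 0] v `|v| _ _ (normr_ge0 v).
- by move=> t x y _ -> ->; rewrite /= !scaler0 addr0.
- by exists 0.
- by move=> b ->; rewrite subr0.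
exists f; split=> //; apply/eqP; rewrite eq_le (le_trans (ler_norm _) (fle _))/=.
by have := fv 0 erefl; rewrite linear0 add0r.
Qed.

End hahn_banach.

(** * Finite nets and closed convex hulls *)

Section total_boundedness.
Context {R : realType}.

(** An ultrafilter containing a finite union of balls contains one of the balls, hence is Cauchy.
    Completeness is a hypothesis on filters so that the lemma serves both for E and for functions
    with the uniform structure. *)
Lemma totally_bounded_compact (X : pseudoMetricType R) (A : set X) :
  (forall F : set_system X, ProperFilter F -> cauchy F -> exists l : X, F --> l) ->
  closed A ->
  (forall e : R, 0 < e -> exists s : seq X, A `<=` \bigcup_(c in [set` s]) ball c e) ->
  compact A.
Proof.
move=> cX cA tbA; rewrite compact_ultra => F UF FA.
have Fball (e : R) : 0 < e -> exists c, F (ball c e).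
  move=> /tbA[s As]; have {As} : F (\bigcup_(c in [set` s]) ball c e).
    exact: filterS FA.
  elim: s => [|c s IH] Fs.
    by exfalso; apply: (filter_not_empty F); apply: filterS Fs => x [].
  have [Fc|Fc] := in_ultra_setVsetC (ball c e) UF; first by exists c.
  apply: IH; apply: filterS (filterI Fs Fc) => x [[d /=]].
  rewrite inE => /predU1P[->//|ds] dx _; by exists d.
have /cX[l Fl] : cauchy F by apply: cauchy_exP => e /Fball.
exists l; split => //; rewrite (closure_id A).1//.
by move=> B /Fl FB; exact: (filter_ex (filterI FA FB)).
Qed.

Section nets.
Context {E : normedModType R}.
Implicit Types (A B C : set E) (r e : R).

Definition cvx A := forall (t : R) x y, 0 <= t <= 1 -> A x -> A y ->
  A (t *: x + (1 - t) *: y).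

Lemma convex_set_cvx A : convex_set A -> cvx A.
Proof.
move=> cA t x y t01 Ax Ay.
have /set_mem := cA x y (Itv01 (andP t01).1 (andP t01).2) (mem_set Ax) (mem_set Ay).
by [].
Qed.

Lemma cvx_mid A x y : cvx A -> A x -> A y -> A (2^-1 *: (x + y)).
Proof.
move=> cA Ax Ay; rewrite scalerDr.
have {2}-> : 2^-1 = 1 - 2^-1 :> R by lra.
by apply: cA => //; lra.
Qed.

Definition clco A : set E :=
  [set x | forall C, closed C -> cvx C -> A `<=` C -> C x].

Lemma sub_clco A : A `<=` clco A.
Proof. by move=> x Ax C _ _; exact. Qed.

Lemma clco_min A C : closed C -> cvx C -> A `<=` C -> clco A `<=` C.
Proof. by move=> clC cC AC x; apply. Qed.

Lemma closed_clco A : closed (clco A).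
Proof.
rewrite (_ : clco A = \bigcap_(C in [set C | [/\ closed C, cvx C & A `<=` C]]) C).
  by apply: closed_bigI => C [].
apply/seteqP; split => [x Ax C []|x Ax C clC cC AC]; first exact: Ax.
by apply: Ax; split.
Qed.

Lemma cvx_clco A : cvx (clco A).
Proof.
move=> t x y t01 Ax Ay C clC cC AC.
by apply: (cC _ _ _ t01); [exact: (Ax C)|exact: (Ay C)].
Qed.

Lemma clcoS A B : A `<=` B -> clco A `<=` clco B.
Proof. by move=> AB x Ax C clC cC BC; apply: Ax => // y /AB/BC. Qed.

(** Membership is asked only of the points with positive coefficient, as suits a partition of
    unity. *)
Lemma cvx_sum A n (c : 'I_n -> R) (v : 'I_n -> E) : cvx A ->
  (forall i, 0 <= c i) -> \sum_i c i = 1 -> (forall i, 0 < c i -> A (v i)) ->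
  A (\sum_i c i *: v i).
Proof.
move=> cA; elim: n c v => [|n IH] c v c0 c1 Av.
  by move/eqP: c1; rewrite big_ord0 eq_sym oner_eq0.
rewrite big_ord_recl; set c' := fun i => c (lift ord0 i).
have s0 : 0 <= \sum_i c' i by apply: sumr_ge0 => i _; exact: c0.
have cE : c ord0 = 1 - \sum_i c' i.
  by rewrite -c1 big_ord_recl addrK.
have [s00|s_neq0] := eqVneq (\sum_i c' i) 0.
  rewrite big1 ?addr0.
    by rewrite cE s00 subr0 scale1r; apply: Av; rewrite cE s00 subr0.
  move=> i _; rewrite (_ : c _ = 0) ?scale0r//; apply/eqP.
  by rewrite -/(c' i) (psumr_eq0P _ s00)// => j _; exact: c0.
have sp : 0 < \sum_i c' i by rewrite lt_neqAle eq_sym s_neq0.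
have Aw : A (\sum_i (c' i / \sum_i c' i) *: v (lift ord0 i)).
  apply: IH => [i||i ci].
  - by rewrite divr_ge0// c0.
  - by rewrite -mulr_suml divff.
  - by apply: Av; move: ci; rewrite pmulr_lgt0 ?invr_gt0.
have -> : \sum_i c (lift ord0 i) *: v (lift ord0 i) =
    (1 - c ord0) *: \sum_i (c' i / \sum_i c' i) *: v (lift ord0 i).
  rewrite cE subKr scaler_sumr; apply: eq_bigr => i _.
  by rewrite scalerA mulrC divfK.
have [c00|c00] := eqVneq (c ord0) 0.
  by rewrite c00 scale0r add0r subr0 scale1r.
apply: cA => //; first by rewrite c0/= cE gerBl.
by apply: Av; rewrite lt_neqAle eq_sym c00 c0.
Qed.

Lemma closed_ge_functional (f : {linear E -> R^o}) (a : R) : continuous f ->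
  closed [set x | (f x : R) <= a] /\ cvx [set x | (f x : R) <= a].
Proof.
move=> cf; split.
  apply: (@preimage_closed E R f [set y | y <= a]); last exact: closed_le.
  by move=> x _; exact: cf.
move=> t x y /andP[t0 t1] /= fx fy; rewrite linearD !linearZ/=.
have := ler_wpM2l t0 fx; have t1' : 0 <= 1 - t by lra.
have := ler_wpM2l t1' fy; rewrite /GRing.scale/=; lra.
Qed.

Lemma closed_norm_le (a : R) (v : E) :
  closed [set x | `|x - v| <= a] /\ cvx [set x | `|x - v| <= a].
Proof.
split.
  rewrite (_ : [set _ | _] = (fun x => `|x - v|) @^-1` [set y | y <= a])//.
  have c : continuous (fun x : E => `|x - v|).
    by move=> x; apply: cvg_norm; apply: cvgB; [exact: cvg_id|exact: cvg_cst].
  by apply: preimage_closed; [exact: in1W|exact: closed_le].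
move=> t x y /andP[t0 t1] /= xa ya.
have -> : t *: x + (1 - t) *: y - v = t *: (x - v) + (1 - t) *: (y - v).
  by rewrite !scalerBr addrACA -opprD -scalerDl addrCA subrr addr0 scale1r.
have t1' : 0 <= 1 - t by lra.
apply: le_trans (ler_normD _ _) _; rewrite !normrZ !ger0_norm//.
have := ler_wpM2l t0 xa; have := ler_wpM2l t1' ya; lra.
Qed.

(** [fnet e A] for all e > r says that the Hausdorff measure of noncompactness of A is at most r,
    without extended reals. The centres need not lie in A. *)
Definition fnet r A := exists s : seq E, forall x, A x -> exists2 c, c \in s & `|x - c| < r.

Lemma fnetS r A B : A `<=` B -> fnet r B -> fnet r A.
Proof. by move=> AB [s sP]; exists s => x /AB/sP. Qed.

Lemma fnet_shift r e A B : (forall x, A x -> exists2 y, B y & `|x - y| <= e) ->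
  fnet r B -> fnet (r + e) A.
Proof.
move=> AB [s sP]; exists s => x /AB[y /sP[c cs yc] xy]; exists c => //.
by have := ler_normD (x - y) (y - c); rewrite addrA subrK; lra.
Qed.

Lemma fnet_le r e A : r <= e -> fnet r A -> fnet e A.
Proof.
by move=> re [s sP]; exists s => x /sP[c cs xc]; exists c => //; exact: lt_le_trans re.
Qed.

Lemma fnetU r A B : fnet r A -> fnet r B -> fnet r (A `|` B).
Proof.
move=> [s sP] [u uP]; exists (s ++ u) => x [/sP|/uP] [c cs xc]; exists c => //.
  by rewrite mem_cat cs.
by rewrite mem_cat cs orbT.
Qed.

Lemma fnet1 r x : 0 < r -> fnet r [set x].
Proof. by move=> r0; exists [:: x] => _ ->; exists x; rewrite ?inE// subrr normr0. Qed.

Lemma fnet_image r (k : R) A (L : {linear E -> E}) : 0 < k ->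
  (forall x, `|L x| <= k * `|x|) -> fnet r A -> fnet (k * r) [set L x | x in A].
Proof.
move=> k0 LC [s sP]; exists [seq L x | x <- s] => _ [x /sP[c cs xc] <-].
exists (L c); first exact: map_f.
by rewrite -linearB (le_lt_trans (LC _))// ltr_pM2l.
Qed.

(** The coefficients are rounded down to multiples of 1 / (p + 1), which moves the sum by at most V
    / (p + 1) < e, where V is the sum of the norms of the vectors. *)
Lemma fnet_box m (v : 'I_m -> E) (b e : R) : 0 < e ->
  fnet e [set x | exists2 c : 'I_m -> R, forall i, 0 <= c i <= b & x = \sum_i c i *: v i].
Proof.
move=> e0; pose V := \sum_i `|v i|.
have V0 : 0 <= V by apply: sumr_ge0.
have [p Vp] : exists p : nat, V < p.+1%:R * e.
  exists (Num.truncn (V / e)); rewrite -ltr_pdivrMr//.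
  by have /andP[] := truncn_itv (divr_ge0 V0 (ltW e0)).
pose P := Num.truncn (p.+1%:R * b).
exists [seq \sum_i ((f i : nat)%:R / p.+1%:R) *: v i | f : {ffun 'I_m -> 'I_P.+1}].
move=> _ [c cb ->].
have k0 i : 0 <= p.+1%:R * c i by rewrite mulr_ge0//; case/andP: (cb i).
pose f := [ffun i : 'I_m => inord (Num.truncn (p.+1%:R * c i)) : 'I_P.+1].
exists (\sum_i ((f i : nat)%:R / p.+1%:R) *: v i); first by apply/mapP; exists f; rewrite ?mem_enum.
rewrite -sumrB; apply: le_lt_trans (ler_norm_sum _ _ _) _.
apply: (@le_lt_trans _ _ (V / p.+1%:R)); last by rewrite ltr_pdivrMr// mulrC.
rewrite /V mulr_suml; apply: ler_sum => i _.
rewrite -scalerBl normrZ mulrC ler_wpM2l//.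
rewrite ffunE inordK; last first.
  by rewrite ltnS; apply: le_truncn; rewrite ler_wpM2l//; case/andP: (cb i).
have /andP[h1 h2] := truncn_itv (k0 i).
rewrite -(@ler_pM2l _ p.+1%:R)// -[X in X * `|_|]gtr0_norm// -normrM mulrBr.
rewrite [X in _ - X]mulrC divfK// divff// ger0_norm ?subr_ge0// lerBlDl.
by rewrite (le_trans (ltW h2))// -natr1.
Qed.

(** The closed convex hull does not increase the measure of noncompactness: the hull H of the
    centres is the image of a bounded box, hence has finite nets, and the points at distance at most
    r from H form a closed convex set containing A. *)
Lemma fnet_clco r e A : 0 < e -> fnet r A -> fnet (r + e) (clco A).
Proof.
move=> e0 [s sP]; pose v i := nth 0 s (i : 'I_(size s)).
pose H : set E := [set x | exists c : 'I_(size s) -> R,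
  [/\ forall i, 0 <= c i, \sum_i c i = 1 & x = \sum_i c i *: v i]].
have cH : cvx H.
  move=> t _ _ /andP[t0 t1] [c [c0 c1 ->]] [d [d0 d1 ->]].
  exists (fun i => t * c i + (1 - t) * d i); split.
  - by move=> i; rewrite addr_ge0// mulr_ge0// subr_ge0.
  - by rewrite big_split/= -!mulr_sumr c1 d1; lra.
  - rewrite !scaler_sumr -big_split/=; apply: eq_bigr => i _.
    by rewrite !scalerA -scalerDl.
(* The condition for all d > 0 expresses a distance at most r that need not be attained. *)
pose C : set E := [set x | forall d : R, 0 < d -> exists2 h, H h & `|x - h| <= r + d].
have clC : closed C.
  move=> x Cx d d0; have d2 : 0 < d / 2 by rewrite divr_gt0.
  have [y [Cy xy]] := Cx _ (nbhsx_ballx x _ d2).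
  have [h Hh yh] := Cy _ d2; exists h => //.
  move: xy; rewrite -ball_normE/= => xy.
  by have := ler_normD (x - y) (y - h); rewrite addrA subrK; lra.
have cC : cvx C.
  move=> t x y /andP[t0 t1] Cx Cy d d0.
  have [h Hh xh] := Cx _ d0; have [k Hk yk] := Cy _ d0.
  exists (t *: h + (1 - t) *: k); first by apply: cH => //; rewrite t0.
  rewrite opprD addrACA -!scalerBr (le_trans (ler_normD _ _))//.
  have t1' : 0 <= 1 - t by lra.
  rewrite !normrZ !ger0_norm//.
  by have := ler_wpM2l t0 xh; have := ler_wpM2l t1' yk; lra.
have AC : A `<=` C.
  move=> x /sP[c cs xc] d d0; exists c; last by lra.
  have cs' : (index c s < size s)%N by rewrite index_mem.
  exists (fun i => (i == Ordinal cs')%:R); split => //.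
    by rewrite (bigD1 (Ordinal cs'))//= eqxx big1 ?addr0 => [//|i /negPf ->].
  rewrite (bigD1 (Ordinal cs'))//= eqxx scale1r big1 ?addr0 => [|i /negPf ->].
    by rewrite /v nth_index.
  by rewrite scale0r.
have e2 : 0 < e / 2 by rewrite divr_gt0.
have Hnet : fnet (e / 4) H.
  apply: fnetS (fnet_box v 1 _) => [_ [c [c0 c1 ->]]|]; last by rewrite divr_gt0.
  exists c => // i; rewrite c0/= -c1 (bigD1 i)//= lerDl sumr_ge0//.
apply: fnet_le (_ : e / 4 + (r + e / 2) <= _) _; first by lra.
apply: fnet_shift Hnet => x Ax; have [h Hh xh] := clco_min clC cC AC Ax (e / 2) e2.
by exists h.
Qed.

(* A set all of whose sequences have finite nets of radius r cannot contain an
   infinite 2r-separated sequence. *)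
Lemma fnet_seq r A :
  (forall x : nat -> E, (forall n, A (x n)) -> fnet r [set x n | n in [set: nat]]) ->
  fnet (r + r) A.
Proof.
move=> seqA; apply: contrapT => nA.
have [x0 Ax0] : A !=set0.
  by apply/set0P/negP => /eqP A0; apply: nA; exists [::]; rewrite A0 => x.
have next (s : seq E) : exists x, A x /\ forall c, c \in s -> r + r <= `|x - c|.
  apply: contrapT => ns; apply: nA; exists s => x Ax.
  apply: contrapT => nx; apply: ns; exists x; split => // c cs.
  by rewrite leNgt; apply/negP => xc; apply: nx; exists c.
pose nx s := sval (cid (next s)).
have nxA s : A (nx s) by exact: (svalP (cid (next s))).1.
have nxr s c : c \in s -> r + r <= `|nx s - c|.
  exact: (svalP (cid (next s))).2.
pose l := fix l n := if n is n'.+1 then nx (l n') :: l n' else [::].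
pose x n := nx (l n).
have xl n m : (n < m)%N -> x n \in l m.
  elim: m => // m IH; rewrite ltnS leq_eqVlt => /predU1P[->|/IH h] /=.
    by rewrite inE eqxx.
  by rewrite inE h orbT.
have xsep n m : (n < m)%N -> r + r <= `|x m - x n|.
  by move=> /xl h; exact: nxr.
have [s sP] := seqA x (fun n => nxA _).
have [f fP] : exists f : nat -> 'I_(size s), forall n, `|x n - nth 0 s (f n)| < r.
  have h n : exists i : 'I_(size s), `|x n - nth 0 s i| < r.
    have [c cs xc] := sP (x n) (ex_intro2 _ _ n I erefl).
    have cs' : (index c s < size s)%N by rewrite index_mem.
    by exists (Ordinal cs'); rewrite /= nth_index.
  by exists (fun n => sval (cid (h n))) => n; exact: svalP (cid (h n)).
have [i [j [ij fij]]] : exists i j : 'I_(size s).+1, (i < j)%N /\ f i = f j.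
  apply: contrapT => nij.
  have /leq_card : injective (fun i : 'I_(size s).+1 => f i).
    move=> i j fij; apply/val_inj/eqP; apply: contrapT => /negP.
    by rewrite neq_ltn => /orP[ij|ji]; apply: nij; [exists i, j|exists j, i].
  by rewrite !card_ord ltnn.
have := xsep _ _ ij; apply/negP; rewrite -ltNge.
have := ler_normD (x j - nth 0 s (f j)) (nth 0 s (f j) - x i).
rewrite addrA subrK; have := fP j; have := fP i; rewrite fij distrC; lra.
Qed.

End nets.

Lemma fnet_compact (E : completeNormedModType R) (A : set E) : closed A ->
  (forall e, 0 < e -> fnet e A) -> compact A.
Proof.
move=> cA netA; apply: totally_bounded_compact => // [F FF Fc|e /netA[s sP]].
  by exists (lim F); exact: cauchy_cvg.
by exists s => x /sP[c cs xc]; exists c; rewrite // -ball_normE/= distrC.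
Qed.

End total_boundedness.

(** * Strongly measurable functions *)

Section measurability.
Context {R : realType} {E : normedModType R}.
Notation mu := (@lebesgue_measure R).
Implicit Types (f g : R -> E) (d : nat -> E).

(* Equivalently, f is everywhere the pointwise limit of simple functions. *)
Definition bmeas f :=
  (exists d, forall t (e : R), 0 < e -> exists j, `|f t - d j| < e) /\
  (forall v, measurable_fun setT (fun t => `|f t - v|)).

Lemma measurable_preimage_cst (T : Type) (v : T) (A : set T) :
  measurable ((fun _ : R => v) @^-1` A).
Proof. by rewrite (preimage_cst v A); case: ifP. Qed.

Lemma simple_preimage f (A : set E) : simple_function f -> measurable (f @^-1` A).
Proof.
move=> [frange fm].
have -> : f @^-1` A = \bigcup_(v in range f `&` A) f @^-1` [set v].
  apply/seteqP; split => [t ft|t [v [_ Av] /= ftv]]; last by rewrite /= ftv.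
  by exists (f t) => //; split => //; exists t.
by apply: fin_bigcup_measurable => [|v _]; [exact: finite_setIl|exact: fm].
Qed.

Lemma simple_measurable_comp disp (T : measurableType disp) (h : E -> T) f :
  simple_function f -> measurable_fun setT (h \o f).
Proof.
by move=> sf _ B mB; rewrite setTI comp_preimage; exact: simple_preimage.
Qed.


Lemma bmeas_glue (s : R -> E) (G : E -> R -> E) : simple_function s ->
  (forall u, bmeas (G u)) -> bmeas (fun t => G (s t) t).
Proof.
move=> ss mG; have [/finite_seqP[r rE] sm] := ss.
have hd u := (cid (mG u).1); split.
  exists (fun n => if unpickle n is Some (i, j) then sval (hd (nth 0 r i)) j else 0).
  move=> t e e0; have [j jP] := svalP (hd (s t)) t e e0.
  have str : s t \in r by have : [set` r] (s t) by rewrite -rE; exists t.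
  by exists (pickle (index (s t) r, j)); rewrite pickleK nth_index.
move=> v _ B mB; rewrite setTI.
have -> : (fun t => `|G (s t) t - v|) @^-1` B =
    \bigcup_(u in range s) (s @^-1` [set u] `&` (fun t => `|G u t - v|) @^-1` B).
  by apply/seteqP; split => [t Bt|t [u _ [/= <- ]]]//; exists (s t) => //; exists t.
apply: fin_bigcup_measurable => [|u _]; first by case: ss.
apply: measurableI; first exact: sm.
by have := (mG u).2 v measurableT B mB; rewrite setTI.
Qed.

Lemma bmeas_cst (v : E) : bmeas (fun=> v).
Proof.
split; first by exists (fun=> v) => t e e0; exists 0%N; rewrite subrr normr0.
by move=> w; exact: measurable_cst.
Qed.

Lemma simple_bmeas f : simple_function f -> bmeas f.
Proof. by move=> sf; apply: (@bmeas_glue f (fun u _ => u)) => // u; exact: bmeas_cst. Qed.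

Lemma bmeas_cvg (h : nat -> R -> E) f : (forall n, bmeas (h n)) ->
  (forall t, h n t @[n --> \oo] --> f t) -> bmeas f.
Proof.
move=> mh hf; have hd n := cid (mh n).1; split.
  exists (fun n => if unpickle n is Some (i, j) then sval (hd i) j else 0).
  move=> t e e0; have e2 : 0 < e / 2 by rewrite divr_gt0.
  have /cvgrPdist_lt/(_ _ e2)[n _ /(_ n (leqnn n))/= hn] := hf t.
  have [j jP] := svalP (hd n) t _ e2.
  exists (pickle (n, j)); rewrite pickleK.
  by have := ler_normD (f t - h n t) (h n t - sval (hd n) j); rewrite addrA subrK; lra.
move=> v; apply: (@measurable_fun_cvg _ _ _ _ (fun n t => `|h n t - v|)).
  by move=> n; exact: (mh n).2.
by move=> t _; apply: cvg_norm; apply: cvgB; [exact: hf|exact: cvg_cst].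
Qed.

(** The point closest to f t among d 0, ..., d n, the earliest one in case of a tie; as a function
    of t it is simple, and its error decreases with n. *)
Fixpoint nearest d f n t :=
  if n is n'.+1 then
    if `|f t - d n| < `|f t - nearest d f n' t| then d n else nearest d f n' t
  else d 0%N.

Lemma nearest_in d f n t : exists2 j, (j <= n)%N & nearest d f n t = d j.
Proof.
elim: n => [|n [j jn IH]] /=; first by exists 0%N.
by case: ifP => _; [exists n.+1|exists j => //; exact: leqW].
Qed.

Lemma nearest_le d f n t j : (j <= n)%N -> `|f t - nearest d f n t| <= `|f t - d j|.
Proof.
elim: n => [|n IH] /=; first by rewrite leqn0 => /eqP ->.
rewrite leq_eqVlt => /predU1P[->|]; first by case: ifP => [//|/negbT]; rewrite -leNgt.
rewrite ltnS => /IH h; case: ifP => // lt.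
exact: le_trans (ltW lt) h.
Qed.

Lemma nearest_simple d f n : (forall v, measurable_fun setT (fun t => `|f t - v|)) ->
  simple_function (nearest d f n) /\
  measurable_fun setT (fun t => `|f t - nearest d f n t|).
Proof.
move=> mf; elim: n => [|n [sn mn]].
  split; last exact: mf; split; last by move=> v; exact: measurable_preimage_cst.
  by apply: (sub_finite_set (B := [set d 0%N])) => [_ [t _ <-]//|]; exact: finite_set1.
pose A := [set t | `|f t - d n.+1| < `|f t - nearest d f n t|].
have mA : measurable A.
  have mtrue : measurable [set true] by [].
  have := measurable_fun_ltr (mf (d n.+1)) mn measurableT mtrue.
  by rewrite setTI; congr measurable; apply/seteqP; split.
split; last first.
  rewrite [X in measurable_fun _ X](_ : _ =
     (fun t => if `|f t - d n.+1| < `|f t - nearest d f n t| then `|f t - d n.+1|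
               else `|f t - nearest d f n t|)).
    by apply: measurable_fun_ifT => //; exact: measurable_fun_ltr.
  by apply/funext => t /=; case: ifP.
split.
  apply: (sub_finite_set (B := range (nearest d f n) `|` [set d n.+1])).
    by move=> _ [t _ <-] /=; case: ifP => _; [right|left; exists t].
  by rewrite finite_setU; split; [case: sn|exact: finite_set1].
move=> v; rewrite [X in measurable X](_ : _ =
   (A `&` (fun=> d n.+1) @^-1` [set v]) `|` (~` A `&` nearest d f n @^-1` [set v])).
  apply: measurableU; apply: measurableI => //; last 1 first.
  - exact: simple_preimage.
  - exact: measurable_preimage_cst.
  - exact: measurableC.
apply/seteqP; split => t /=.
  by case: ifPn => h; [left|right; split => //; exact/negP].
by move=> [[At <-]|[At <-]]; [rewrite /A/= in At; rewrite At|case: ifP].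
Qed.

Lemma nearest_cvg d f t : (forall e : R, 0 < e -> exists j, `|f t - d j| < e) ->
  nearest d f n t @[n --> \oo] --> f t.
Proof.
move=> fd; apply/cvgrPdist_lt => e /fd[j jP]; exists j => // n /= jn.
exact: le_lt_trans (nearest_le _ _ _ jn) jP.
Qed.

Lemma bmeas_approx f : bmeas f -> exists s : nat -> R -> E,
  [/\ forall n, simple_function (s n), forall t, s n t @[n --> \oo] --> f t,
      forall n, measurable_fun setT (fun t => `|s n t - f t|) &
      forall n t, `|s n t - f t| <= `|f t|].
Proof.
(* Putting 0 at the head of the list bounds the error by the norm of f t, which later serves for
   dominated convergence. *)
move=> [[d fd] mf]; pose d' j := if j is j'.+1 then d j' else 0.
exists (nearest d' f); split.
- by move=> n; exact: (nearest_simple d' n mf).1.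
- by move=> t; apply: nearest_cvg => e /(fd t)[j jP]; exists j.+1.
- move=> n; under eq_fun do rewrite distrC.
  exact: (nearest_simple d' n mf).2.
- by move=> n t; have := @nearest_le d' f n t 0 isT; rewrite /= subr0 distrC.
Qed.

Lemma bmeas_norm f : bmeas f -> measurable_fun setT (fun t => `|f t|).
Proof. by move=> [_ /(_ 0)]; under eq_fun do rewrite subr0. Qed.

Lemma bmeas_functional (h : E -> R) f : continuous h -> bmeas f ->
  measurable_fun setT (h \o f).
Proof.
move=> ch /bmeas_approx[s [ss sf _ _]].
apply: (@measurable_fun_cvg _ _ _ _ (fun n => h \o s n)) => [n|t _].
  exact: simple_measurable_comp.
by apply: continuous_cvg; [exact: ch|exact: sf].
Qed.

(** Superposition with a Caratheodory function: for simple f the kernel is glued from finitely many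
    sections, and continuity in the second variable passes to the limit. Sums, scalar multiples and
    evolution operators are instances. *)
Lemma bmeas_kernel (k : R -> E -> E) f : (forall u, bmeas (k ^~ u)) ->
  (forall t, continuous (k t)) -> bmeas f -> bmeas (fun t => k t (f t)).
Proof.
move=> mk ck /bmeas_approx[s [ss sf _ _]].
apply: (@bmeas_cvg (fun n t => k t (s n t))) => [n|t].
  exact: (@bmeas_glue (s n) (fun u t => k t u)).
by apply: continuous_cvg; [exact: ck|exact: sf].
Qed.

Lemma bmeasD f g : bmeas f -> bmeas g -> bmeas (fun t => f t + g t).
Proof.
move=> mf mg; apply: (@bmeas_kernel (fun t u => f t + u) g) => // [u|t u]; last first.
  by apply: cvgD; [exact: cvg_cst|exact: cvg_id].
have [[d fd] mf'] := mf; split.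
  exists (fun j => d j + u) => t e e0; have [j jP] := fd t e e0.
  by exists j; rewrite opprD addrACA subrr addr0.
move=> v; under eq_fun do rewrite -addrA -opprB; exact: mf'.
Qed.

Lemma bmeas_scale (a : R -> R) f : measurable_fun setT a -> bmeas f ->
  bmeas (fun t => a t *: f t).
Proof.
move=> ma mf; apply: (@bmeas_kernel (fun t u => a t *: u) f) => // [u|t u]; last first.
  by apply: cvgZ; [exact: cvg_cst|exact: cvg_id].
split; last first.
  move=> v; apply: (@measurableT_comp _ _ _ _ _ _ (fun x : R => `|x *: u - v|)) => //.
  apply: continuous_measurable_fun => x; apply: cvg_norm; apply: cvgB; last exact: cvg_cst.
  by apply: cvgZr_tmp; exact: cvg_id.
exists (fun n => if unpickle n is Some q then ratr q *: u else 0) => t e e0.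
have [u0|u0] := eqVneq u 0.
  by exists (pickle (0 : rat)); rewrite pickleK u0 !scaler0 subr0 normr0.
have d0 : 0 < e / `|u| by rewrite divr_gt0// normr_gt0.
have [q] : exists q : rat, ratr q \in `](a t - e / `|u|), (a t + e / `|u|)[%R.
  by apply: rat_in_itvoo; lra.
rewrite in_itv/= => /andP[q1 q2]; exists (pickle q); rewrite pickleK -scalerBl normrZ.
by rewrite -ltr_pdivlMr ?normr_gt0// ltr_norml; lra.
Qed.

Lemma bmeasN f : bmeas f -> bmeas (fun t => - f t).
Proof.
move=> mf; under eq_fun do rewrite -scaleN1r.
by apply: bmeas_scale => //; exact: measurable_cst.
Qed.

Lemma bmeasB f g : bmeas f -> bmeas g -> bmeas (fun t => f t - g t).
Proof. by move=> mf /bmeasN; exact: bmeasD. Qed.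

Lemma bmeas_patch (A : set R) f : measurable A -> bmeas f ->
  bmeas (fun t => if t \in A then f t else 0).
Proof.
move=> mA mf; rewrite (_ : (fun _ => _) = (fun t => \1_A t *: f t)).
  by apply: bmeas_scale => //; exact: measurable_indic.
apply/funext => t; rewrite indicE; case: (t \in A); by rewrite ?scale1r ?scale0r.
Qed.

Lemma bmeas_sum n (h : 'I_n -> R -> E) : (forall i, bmeas (h i)) ->
  bmeas (fun t => \sum_i h i t).
Proof.
elim: n h => [|n IH] h mh.
  by under eq_fun do rewrite big_ord0; exact: bmeas_cst.
under eq_fun do rewrite big_ord_recl; apply: bmeasD => //.
exact: (IH (fun i => h (lift ord0 i))).
Qed.

Lemma bmeas_continuous_itv (a b : R) f : {within `[a, b], continuous f} ->
  bmeas (fun t => if t \in `[a, b]%classic then f t else 0).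
Proof.
move=> cf; split; last first.
  move=> v; rewrite (_ : (fun _ => _) =
    (fun t => if t \in `[a, b]%classic then `|f t - v| else `|v|)); last first.
    by apply/funext => t; case: ifP; rewrite ?sub0r ?normrN.
  have mfv : measurable_fun `[a, b]%classic (fun t => `|f t - v|).
    apply: subspace_continuous_measurable_fun => // t.
    by apply: cvg_norm; apply: cvgB; [exact: cf|exact: cvg_cst].
  move=> _ B mB; rewrite setTI.
  rewrite [X in measurable X](_ : _ = (`[a, b]%classic `&` (fun t => `|f t - v|) @^-1` B)
    `|` (~` `[a, b]%classic `&` (fun=> `|v|) @^-1` B)).
    apply: measurableU; first exact: mfv.
    by apply: measurableI; [exact: measurableC|exact: measurable_preimage_cst].
  apply/seteqP; split => t /=.
    case: ifPn => [/set_mem|]; first by left.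
    by rewrite notin_setE; right.
  move=> [[tab Bt]|[tab Bt]]; first by rewrite mem_set.
  by rewrite memNset.
(* The values at the subdivision points of [a, b] are dense among the values on [a, b]; the code
   [None] stands for the value 0 outside. *)
pose p (ij : nat * nat) := a + (b - a) * (ij.1%:R / ij.2.+1%:R).
exists (fun n => if unpickle n is Some (Some ij) then f (p ij) else 0) => t e e0.
case: ifPn => [/set_mem tab|_]; last first.
  by exists (pickle (None : option (nat * nat))); rewrite pickleK subr0 normr0.
have [ba|ab] := leP b a.
  exists (pickle (Some (0, 0)%N)); rewrite pickleK /p/= mul0r mulr0 addr0.
  have -> : t = a by move: tab; rewrite /= in_itv/=; lra.
  by rewrite subrr normr0.
have [r r0 rP] : exists2 r : R, 0 < r & forall t', `|t - t'| < r ->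
    t' \in `[a, b] -> `|f t - f t'| < e.
  have := cf t; rewrite /prop_for/= /continuous_at => /cvgrPdist_lt/(_ e e0).
  rewrite {1}/nbhs/= /nbhs_subspace/=; case: ifPn => [|/negP]; last by rewrite mem_set.
  by move=> _; rewrite /within/= => -[r r0 rP]; exists r.
have ba0 : 0 < b - a by lra.
pose n := Num.truncn ((b - a) / r).
have rn : (b - a) / n.+1%:R < r.
  rewrite ltr_pdivrMr// mulrC -ltr_pdivrMr//.
  by have /andP[] := truncn_itv (divr_ge0 (ltW ba0) (ltW r0)).
have u0 : 0 <= (t - a) / (b - a) * n.+1%:R.
  rewrite mulr_ge0// divr_ge0 ?(ltW ba0)// subr_ge0.
  by move: tab; rewrite /= in_itv/= => /andP[].
pose i := Num.truncn ((t - a) / (b - a) * n.+1%:R).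
have /andP[i1 i2] := truncn_itv u0.
have {}i1 : p (i, n) <= t.
  move: i1; rewrite -ler_pdivrMr// ler_pdivlMr// /p/= => i1.
  by rewrite mulrC -lerBrDl.
have {}i2 : t < p (i, n) + (b - a) / n.+1%:R.
  move: i2; rewrite -ltr_pdivlMr// ltr_pdivrMr// -natr1 mulrDl mul1r mulrDl => i2.
  rewrite /p/= [(b - a) * _]mulrC [(b - a) / _]mulrC; move: i2; rewrite -/i.
  by move: (i%:R / n.+1%:R * (b - a)) (n.+1%:R^-1 * (b - a)) => x y; lra.
have pa : a <= p (i, n) by rewrite /p lerDl mulr_ge0 ?(ltW ba0)// divr_ge0.
exists (pickle (Some (i, n))); rewrite pickleK; apply: rP.
  by rewrite ger0_norm ?subr_ge0// (lt_trans _ rn)// ltrBlDl.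
by move: tab; rewrite /= !in_itv/= pa/= => /andP[_ tb]; apply: le_trans tb.
Qed.

(** Replacing f by 0 outside D and on the null set where the simple functions fail to converge turns
    almost everywhere convergence into convergence everywhere. *)
Lemma strongly_measurable_bmeas (D : set R) f : measurable D ->
  strongly_measurable D f ->
  exists g, bmeas g /\ {ae mu, forall t, D t -> f t = g t}.
Proof.
move=> mD [s ss [N [mN N0 sN]]].
pose A := D `&` ~` N.
have mA : measurable A by apply: measurableI => //; exact: measurableC.
exists (fun t => if t \in A then f t else 0); split; last first.
  exists N; split => // t /= h; apply: contrapT => Nt; apply: h => Dt.
  by rewrite mem_set.
apply: (@bmeas_cvg (fun n t => if t \in A then s n t else 0)) => [n|t].
  by apply: bmeas_patch => //; exact: simple_bmeas.
case: ifPn => [/set_mem[Dt Nt]|_]; last exact: cvg_cst.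
by apply: contrapT => h; apply: Nt; apply: sN => /(_ Dt).
Qed.

End measurability.

(** * Integrals of vector-valued functions *)

Section almost_everywhere.
Context {R : realType}.
Notation mu := (@lebesgue_measure R).
Implicit Types P Q : R -> Prop.

Lemma ae_imp P Q : {ae mu, forall t, P t} -> (forall t, P t -> Q t) ->
  {ae mu, forall t, Q t}.
Proof.
move=> [N [mN N0 PN]] PQ; exists N; split => // t /= nQ; apply: PN => /= Pt.
by apply: nQ; exact: PQ.
Qed.

Lemma ae_and P Q : {ae mu, forall t, P t} -> {ae mu, forall t, Q t} ->
  {ae mu, forall t, P t /\ Q t}.
Proof.
move=> hP hQ; have : mu.-negligible (~` [set t | P t] `|` ~` [set t | Q t]).
  exact: negligibleU.
by apply: negligibleS => t /= h; apply: contrapT => /not_orP[/contrapT ? /contrapT ?]; exact: h.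
Qed.

Lemma ae_forall (P : nat -> R -> Prop) : (forall n, {ae mu, forall t, P n t}) ->
  {ae mu, forall t, forall n, P n t}.
Proof.
move=> hP; have : mu.-negligible (\bigcup_n ~` [set t | P n t]).
  by apply: negligible_bigcup => n; exact: hP.
apply: negligibleS => t /= h; apply: contrapT => nP; apply: h => n.
by apply: contrapT => nPn; apply: nP; exists n.
Qed.

Lemma ae_forall_ord p (P : 'I_p -> R -> Prop) :
  (forall i, {ae mu, forall t, P i t}) -> {ae mu, forall t, forall i, P i t}.
Proof.
move=> hP; have h : {ae mu, forall t, forall n (i : 'I_p), i = n :> nat -> P i t}.
  apply: (ae_forall (P := fun n t => forall i : 'I_p, i = n :> nat -> P i t)) => n.
  have [pn|pn] := leqP p n.
    by exists set0; split => // t; apply => i ni; move: (ltn_ord i); rewrite ni ltnNge pn.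
  apply: (ae_imp (hP (Ordinal pn))) => t hs i ni.
  by rewrite (_ : i = Ordinal pn)//; exact: val_inj.
by apply: (ae_imp h) => t h' i; exact: (h' i).
Qed.

Lemma ae_all P : (forall t, P t) -> {ae mu, forall t, P t}.
Proof. by move=> hP; exists set0; split => // t; apply; exact: hP. Qed.

End almost_everywhere.

Section real_integrals.
Context {R : realType} (D : set R)
  (mD : measurable (D : set (measurableTypeR R))).
Notation mu := (@lebesgue_measure R).
Implicit Types f g : R -> R.

Local Notation intg g := (mu.-integrable D (EFin \o g)).

Lemma intg_le f g : measurable_fun D f -> (forall t, D t -> `|f t| <= g t) ->
  intg g -> intg f.
Proof.
move=> mf fg ig; apply: le_integrable ig => //; first exact/measurable_EFinP.
by move=> t /fg h; rewrite /= lee_fin (le_trans h)// ler_norm.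
Qed.

Lemma intg_measurable g : intg g -> measurable_fun D g.
Proof. by move=> /measurable_int/measurable_EFinP. Qed.

Lemma intgD f g : intg f -> intg g -> intg (fun t => f t + g t).
Proof. by move=> i_f ig; have := integrableD mD i_f ig. Qed.

Lemma intgB f g : intg f -> intg g -> intg (fun t => f t - g t).
Proof. by move=> i_f ig; have := integrableB mD i_f ig. Qed.

Lemma intgZ (a : R) g : intg g -> intg (fun t => a * g t).
Proof. by move=> ig; have := integrableZl mD a ig. Qed.

Lemma intg_cst (a : R) : (mu D < +oo)%E -> intg (fun=> a).
Proof.
move=> Dfin; apply: measurable_bounded_integrable => //.
by exists `|a|; split; [exact: num_real|move=> x ax y _; exact: ltW].
Qed.

Lemma intg_indic (A : set R) g : measurable A -> intg g ->
  intg (fun t => \1_A t * g t).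
Proof.
move=> mA ig; apply: intg_le (integrable_norm ig).
  apply: measurable_funM; last exact: intg_measurable.
  by apply: measurable_funTS; exact: measurable_indic.
move=> t _ /=; rewrite normrM ler_piMl// indicE; by case: (t \in A); rewrite ?normr1 ?normr0.
Qed.

(** No measurability is assumed: the integral of a nonnegative function is a supremum over the
    simple functions below it. The integrands in the definition of the Bochner integral may fail to
    be Borel. *)
Lemma ge0_le_integral_sup (f g : R -> \bar R) : (forall t, D t -> 0 <= f t)%E ->
  (forall t, D t -> f t <= g t)%E ->
  (\int[mu]_(t in D) f t <= \int[mu]_(t in D) g t)%E.
Proof.
move=> f0 fg; rewrite !ge0_integralE//; last first.
  by move=> t Dt; exact: le_trans (f0 _ Dt) (fg _ Dt).
apply: le_ereal_sup => _ [h hf <-]; exists h => // t.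
apply: le_trans (hf t) _; rewrite /patch; case: ifPn => // /set_mem; exact: fg.
Qed.

Lemma Rintegral_dominated (f : nat -> R -> R) g :
  (forall n, measurable_fun D (f n)) ->
  {ae mu, forall t, D t -> f n t @[n --> \oo] --> 0} ->
  (forall n t, D t -> `|f n t| <= g t) -> intg g ->
  \int[mu]_(t in D) (f n t) @[n --> \oo] --> 0.
Proof.
move=> mf f0 fg ig.
have [|||||_ _ h] := @dominated_convergence _ _ _ mu D mD
    (fun n => EFin \o f n) (cst 0%E) (EFin \o g).
- by move=> n; apply/measurable_EFinP; exact: mf.
- exact: measurable_cst.
- apply: (ae_imp f0) => t /= h /h h'.
  by apply: (@cvg_EFin _ _ _ _ (fun n => (f n t)%:E)) => //; exact: nearW.
- exact: ig.
- by apply: ae_all => t n Dt /=; rewrite lee_fin fg.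
rewrite integral0 in h.
by have /fine_cvg := h.
Qed.

End real_integrals.

Section weak_integral.
Context {R : realType} {E : normedModType R} (D : set R)
  (mD : measurable (D : set (measurableTypeR R))).
Notation mu := (@lebesgue_measure R).
Implicit Types (e : {linear E -> R^o}).

Local Notation intg g := (mu.-integrable D (EFin \o g)).

(* By Hahn-Banach, v is the Bochner integral of f on D as soon as f is
   integrable. *)
Definition wint (f : R -> E) (v : E) := forall e, continuous e ->
  (e v : R) = \int[mu]_(t in D) (e (f t) : R).

Lemma functional_bound e : continuous e ->
  exists2 k : R, 0 <= k & forall x, `|e x : R| <= k * `|x|.
Proof.
move=> ce; have /linear_boundedP := continuous_linear_bounded 0 (ce 0).
move=> [M [_ MP]]; exists (`|M| + 1); first by rewrite addr_ge0.
by apply: MP; rewrite (le_lt_trans (ler_norm M))// ltrDl.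
Qed.

Lemma bounded_linear_cts (F : normedModType R) (k : R) (h : {linear E -> F}) :
  (forall x, `|h x| <= k * `|x|) -> continuous h.
Proof.
move=> hk; apply: bounded_linear_continuous; apply/linear_boundedP.
exists k; split; first exact: num_real.
by move=> r kr x; rewrite (le_trans (hk x))// ler_wpM2r// ltW.
Qed.

Lemma contractive_cts e : (forall x, `|e x : R| <= `|x|) -> continuous e.
Proof.
by move=> h; apply: (@bounded_linear_cts R^o 1 e) => x; rewrite mul1r; exact: h.
Qed.

Lemma measurable_functional e (f : R -> E) : continuous e -> bmeas f ->
  measurable_fun D (fun t => e (f t) : R).
Proof. by move=> ce mf; apply: measurable_funTS; exact: (bmeas_functional ce mf). Qed.

Lemma intg_functional e (f : R -> E) (g' : R -> R) : continuous e -> bmeas f ->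
  (forall t, D t -> `|f t| <= g' t) -> intg g' -> intg (fun t => e (f t) : R).
Proof.
move=> ce mf fg ig; have [k k0 ek] := functional_bound ce.
apply: (intg_le mD _ _ (intgZ mD k ig)); first exact: measurable_functional.
by move=> t Dt; rewrite (le_trans (ek _))// ler_wpM2l// fg.
Qed.

Lemma intg_norm (f : R -> E) (g' : R -> R) : bmeas f ->
  (forall t, D t -> `|f t| <= g' t) -> intg g' -> intg (fun t => `|f t|).
Proof.
move=> mf fg; apply: (intg_le mD).
  by apply: measurable_funTS; exact: bmeas_norm.
by move=> t Dt; rewrite normr_id fg.
Qed.

(** A functional norming v reduces the estimate to real integrals. *)
Lemma wint_norm (f : R -> E) v (g' : R -> R) : wint f v -> bmeas f ->
  (forall t, D t -> `|f t| <= g' t) -> intg g' -> `|v| <= \int[mu]_(t in D) g' t.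
Proof.
move=> fv mf fg ig; have [e [ec ev]] := norming_functional v.
have ce := contractive_cts ec.
rewrite -ev (fv e ce); apply: le_Rintegral => // [|t Dt].
  exact: intg_functional ig.
exact: le_trans (ler_norm _) (le_trans (ec _) (fg t Dt)).
Qed.

Lemma wint_unique (f : R -> E) v w : wint f v -> wint f w -> v = w.
Proof.
move=> fv fw; apply/eqP; rewrite -subr_eq0; apply/eqP.
have [e [ec ev]] := norming_functional (v - w); have ce := contractive_cts ec.
apply/normr0_eq0; rewrite -ev linearB/=.
by rewrite [e v](fv e ce) [e w](fw e ce) subrr.
Qed.

Lemma eq_wint (f g : R -> E) v : (forall t, D t -> f t = g t) -> wint f v -> wint g v.
Proof.
move=> fg fv e ce; rewrite (fv e ce); apply: eq_Rintegral => t /set_mem Dt.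
by rewrite fg.
Qed.

Lemma wint0 : wint (fun=> 0) 0.
Proof.
by move=> e ce; rewrite /= linear0 Rintegral_cst// mul0r.
Qed.

Lemma wintD (f g : R -> E) v w (f' g' : R -> R) : wint f v -> wint g w -> bmeas f -> bmeas g ->
  (forall t, D t -> `|f t| <= f' t) -> (forall t, D t -> `|g t| <= g' t) ->
  intg f' -> intg g' -> wint (fun t => f t + g t) (v + w).
Proof.
move=> fv gw mf mg ff gg i_f ig e ce.
rewrite linearD/= [e v](fv e ce) [e w](gw e ce) -RintegralD//; last 2 first.
- exact: intg_functional i_f.
- exact: intg_functional ig.
by apply: eq_Rintegral => t _; rewrite linearD.
Qed.

Lemma wint_linear (f : R -> E) v (L : {linear E -> E}) : continuous L -> wint f v ->
  wint (fun t => L (f t)) (L v).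
Proof.
move=> cL fv e ce; have := fv (e \o L : {linear E -> R^o}).
by apply => x; apply: continuous_comp; [exact: cL|exact: ce].
Qed.

Lemma wintZ (f : R -> E) v (a : R) : wint f v -> wint (fun t => a *: f t) (a *: v).
Proof.
move=> fv; apply: (@wint_linear f v ( *:%R a : {linear E -> E})) => // x.
by apply: cvgZ; [exact: cvg_cst|exact: cvg_id].
Qed.

Lemma wintB (f g : R -> E) v w (f' g' : R -> R) : wint f v -> wint g w -> bmeas f -> bmeas g ->
  (forall t, D t -> `|f t| <= f' t) -> (forall t, D t -> `|g t| <= g' t) ->
  intg f' -> intg g' -> wint (fun t => f t - g t) (v - w).
Proof.
move=> fv gw mf mg ff gg i_f ig.
have /(_ _)/= h := @wintD f (fun t => - g t) v (- w) f' g' fv.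
apply: h => //; last 2 first.
- exact: bmeasN.
- by move=> t Dt; rewrite normrN; exact: gg.
by rewrite -scaleN1r; apply: eq_wint (wintZ (-1) gw) => t _; rewrite scaleN1r.
Qed.

Lemma wint_sum n (h : 'I_n -> R -> E) (v : 'I_n -> E) (h' : 'I_n -> R -> R) :
  (forall i, wint (h i) (v i)) -> (forall i, bmeas (h i)) ->
  (forall i t, D t -> `|h i t| <= h' i t) -> (forall i, intg (h' i)) ->
  wint (fun t => \sum_i h i t) (\sum_i v i).
Proof.
move=> hv mh hh ih; elim: n h v h' hv mh hh ih => [|n IH] h v h' hv mh hh ih.
  by rewrite big_ord0; apply: eq_wint wint0 => t _; rewrite big_ord0.
rewrite big_ord_recl.
apply: (@eq_wint (fun t => h ord0 t + \sum_i h (lift ord0 i) t)).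
  by move=> t _; rewrite big_ord_recl.
have isum : intg (fun t => \sum_i h' (lift ord0 i) t).
  have := integrable_sum mD (index_enum 'I_n) (fun i (_ : true) => ih (lift ord0 i)).
  by congr integrable; apply/funext => t /=; rewrite sumEFin.
apply: (wintD (hv ord0) _ (mh ord0) _ (hh ord0) _ (ih ord0) isum).
- exact: (IH (fun i => h (lift ord0 i)) (fun i => v (lift ord0 i))
    (fun i => h' (lift ord0 i)) (fun i => hv _) (fun i => mh _) (fun i => hh _)
    (fun i => ih _)).
- exact: bmeas_sum.
- move=> t Dt; apply: le_trans (ler_norm_sum _ _ _) _.
  by apply: ler_sum => i _; exact: hh.
Qed.

Section finite.
Hypothesis Dfin : (mu D < +oo)%E.

Lemma wint_simple (s : R -> E) : simple_function s -> wint s (simple_integral D s).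
Proof.
move=> ss e ce; have [rs sm] := ss.
have mE v : mu (D `&` s @^-1` [set v]) \is a fin_num.
  rewrite ge0_fin_numE//; apply: le_lt_trans Dfin; apply: le_measure => //.
  - by rewrite inE; apply: measurableI => //; exact: sm.
  - by rewrite inE.
pose r : seq E := finmap.enum_fset (fset_set (range s)).
have rE t : s t \in r.
  have := in_fset_set rs (s t); rewrite mem_set; last by exists t.
  exact.
have ru : uniq r by exact: finmap.fset_uniq.
have indI v : mu.-integrable D (fun t => (e v : R)%:E * (\1_(s @^-1` [set v]) t : R)%:E)%E.
  apply: integrableZl => //.
  have := intg_indic mD (sm v) (intg_cst mD 1 Dfin).
  by congr integrable; apply/funext => t /=; rewrite mulr1.
rewrite /simple_integral fsbig_finite// linear_sum/= /Rintegral.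
rewrite (_ : \int[mu]_(t in D) (e (s t) : R)%:E =
    \int[mu]_(t in D) (\sum_(v <- r) ((e v : R)%:E * (\1_(s @^-1` [set v]) t : R)%:E)))%E; last first.
  apply: eq_integral => t _.
  rewrite (bigD1_seq (s t))//= indicE mem_set// mule1 big1 ?adde0// => v vt.
  by rewrite indicE memNset ?mule0// => /= stv; rewrite stv eqxx in vt.
rewrite integral_sum// -sum_fine => [|v _]; last exact: (integrable_fin_num mD).
apply: eq_bigr => v _.
rewrite integralZl//; last first.
  have := intg_indic mD (sm v) (intg_cst mD 1 Dfin).
  by congr integrable; apply/funext => t /=; rewrite mulr1.
rewrite (integral_indic mu mD (sm v)) (setIC _ D) fineM//= mulrC; exact: linearZ.
Qed.

Lemma simple_bounded (s : R -> E) : simple_function s ->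
  exists k : R, forall t, `|s t| <= k.
Proof.
move=> [/finite_seqP[r rE] _]; exists (\sum_(v <- r) `|v|) => t.
have str : s t \in r by have : [set` r] (s t) by rewrite -rE; exists t.
by rewrite (big_rem _ str)/= lerDl sumr_ge0.
Qed.

End finite.

End weak_integral.

Section bochner_integral.
Context {R : realType} {E : completeNormedModType R} (D : set R)
  (mD : measurable (D : set (measurableTypeR R))).
Notation mu := (@lebesgue_measure R).
Hypothesis Dfin : (mu D < +oo)%E.
Implicit Types (e : {linear E -> R^o}).

Local Notation intg g := (mu.-integrable D (EFin \o g)).

(** The simple functions that converge to f in mean also converge in mean to the Borel version f';
    hence f' is integrable, and applying a functional to their integrals gives in the limit both its
    value at v and the integral of its composition with f'. *)
Lemma bochner_wint (f f' : R -> E) (v : E) : is_bochner_integral D f v -> bmeas f' ->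
  {ae mu, forall t, D t -> f t = f' t} ->
  intg (fun t => `|f' t|) /\ wint D f' v.
Proof.
move=> [_ [s [ss sf sv]]] mf' [N [mN N0 fN]].
have ms n : bmeas (fun t => s n t - f' t).
  by apply: bmeasB => //; exact: simple_bmeas.
have msn n : measurable_fun D (fun t => `|s n t - f' t|).
  by apply: measurable_funTS; exact: bmeas_norm.
(* Set to 0 on the null set N, the measurable integrand lies below the possibly non-Borel one. *)
have le_int n : (\int[mu]_(t in D) (`|s n t - f' t|)%:E <=
    \int[mu]_(t in D) (`|s n t - f t|)%:E)%E.
  rewrite (@ae_eq_integral _ _ _ _ _ (fun t => (\1_(~` N) t * `|s n t - f' t|)%:E))//.
  - apply: ge0_le_integral_sup => t Dt; rewrite lee_fin ?mulr_ge0// indicE.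
    have [/set_mem Nt|_] := boolP (t \in ~` N); last by rewrite mul0r.
    rewrite mul1r (_ : f t = f' t)//; apply: contrapT => h; apply: Nt.
    by apply: fN => /(_ Dt).
  - by apply/measurable_EFinP; exact: msn.
  - apply/measurable_EFinP; apply: measurable_funM; last exact: msn.
    by apply: measurable_funTS; apply: measurable_indic; exact: measurableC.
  - exists N; split => // t /= h; apply: contrapT => Nt; apply: h => Dt.
    by rewrite indicE mem_set// mul1r.
have s'0 : (\int[mu]_(t in D) (`|s n t - f' t|)%:E @[n --> \oo] --> 0)%E.
  apply: (@squeeze_cvge _ _ _ _ (cst 0%E) _ (fun n => \int[mu]_(t in D) (`|s n t - f t|)%:E)%E) => //.
    by apply: nearW => n; rewrite le_int integral_ge0// => t _; rewrite lee_fin.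
  exact: cvg_cst.
have [n0 _ n0P] : \forall n \near \oo,
    (\int[mu]_(t in D) (`|s n t - f' t|)%:E < +oo)%E.
  have [[n0 _ n0P] _] := (fine_cvgP _ _).1 s'0.
  by exists n0 => // n /n0P/= h; rewrite -ge0_fin_numE// integral_ge0.
have isf n : (n0 <= n)%N -> intg (fun t => `|s n t - f' t|).
  move=> n0n; apply/integrableP; split; first by apply/measurable_EFinP; exact: msn.
  by under eq_integral do rewrite /= normr_id; exact: n0P.
have is_ n : intg (fun t => `|s n t|).
  have [k sk] := simple_bounded (ss n).
  apply: (intg_norm mD (simple_bmeas (ss n)) _ (intg_cst mD k Dfin)) => t _; exact: sk.
have if' : intg (fun t => `|f' t|).
  apply: (intg_norm mD mf' _ (intgD mD (isf n0 (leqnn _)) (is_ n0))) => t _.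
  by rewrite -[X in `|X| <= _](subrK (s n0 t)) (le_trans (ler_normD _ _))// distrC.
split => // e ce; have [k k0 ek] := functional_bound ce.
have ef' : intg (fun t => e (f' t) : R).
  by apply: (intg_functional mD ce mf' _ if').
have es n : intg (fun t => e (s n t) : R).
  by apply: (intg_functional mD ce (simple_bmeas (ss n)) _ (is_ n)).
have cv1 : (e (simple_integral D (s n)) : R) @[n --> \oo] --> (e v : R).
  by apply: continuous_cvg => //; exact: ce.
have sR0 : fine (\int[mu]_(t in D) (`|s n t - f' t|)%:E)%E @[n --> \oo] --> (0 : R).
  exact: fine_cvg.
suff cv2 : (e (simple_integral D (s n)) : R) @[n --> \oo] -->
    \int[mu]_(t in D) (e (f' t) : R).
  exact: (cvg_unique _ cv1 cv2).
apply/cvgrPdist_le => d d0; have d1 : 0 < d / (k + 1) by rewrite divr_gt0// ltr_pwDr.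
move/cvgrPdist_lt : sR0 => /(_ _ d1)[n1 _ n1P].
exists (maxn n0 n1) => // n /=; rewrite geq_max => /andP[n0n /n1P/=].
rewrite sub0r normrN => h.
rewrite (wint_simple mD Dfin (ss n) ce) -RintegralB//.
apply: le_trans (le_normr_Rintegral mD _) _; first exact: (intgB mD ef' (es n)).
apply: (@le_trans _ _ (\int[mu]_(t in D) (k * `|s n t - f' t|))).
  apply: le_Rintegral => //.
  - exact: (integrable_norm (intgB mD ef' (es n))).
  - exact: (intgZ mD k (isf n n0n)).
  - by move=> t _; have := ek (f' t - s n t); rewrite linearB/= (distrC (s n t)).
rewrite RintegralZl//; last exact: isf.
rewrite -/(fine _) in h *; rewrite /Rintegral.
apply: (@le_trans _ _ (k * (d / (k + 1)))).
  by rewrite ler_wpM2l// ltW// (le_lt_trans (ler_norm _) h).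
by rewrite mulrA ler_pdivrMr ?ltr_pwDr// mulrC ler_wpM2l ?(ltW d0)// lerDl.
Qed.

(** The approximations of [bmeas_approx] have error at most the norm of f, so they converge in mean
    by dominated convergence, and their integrals form a Cauchy sequence. *)
Lemma wint_bochner (f : R -> E) (g : R -> R) : bmeas f -> (forall t, D t -> `|f t| <= g t) -> intg g ->
  exists v, is_bochner_integral D f v /\ wint D f v.
Proof.
move=> mf fg ig; have if_ : intg (fun t => `|f t|) := intg_norm mD mf fg ig.
have [s [ss sf ms sle]] := bmeas_approx mf.
have msD n : measurable_fun D (fun t => `|s n t - f t|) by exact: measurable_funTS.
have sR0 : \int[mu]_(t in D) `|s n t - f t| @[n --> \oo] --> 0.
  apply: (Rintegral_dominated mD msD _ _ if_) => [|n t Dt].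
    apply: ae_all => t _; rewrite -(normr0 E) -(subrr (f t)).
    by apply: cvg_norm; apply: cvgB; [exact: sf|exact: cvg_cst].
  by rewrite normr_id sle.
have isf n : intg (fun t => `|s n t - f t|).
  by apply: (intg_le mD (msD n) _ if_) => t _; rewrite normr_id sle.
have s0 : (\int[mu]_(t in D) `|s n t - f t|%:E)%E @[n --> \oo] --> 0%E.
  rewrite (_ : (fun n => _) = (fun n => (\int[mu]_(t in D) `|s n t - f t|)%:E)).
    apply: (@cvg_EFin _ _ _ _ (fun n => (\int[mu]_(t in D) `|s n t - f t|)%:E)) => //.
    exact: nearW.
  by apply/funext => n; rewrite /Rintegral fineK//; apply: (integrable_fin_num mD); exact: isf.
have is_ n : intg (fun t => `|s n t|).
  have [k sk] := simple_bounded (ss n).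
  apply: (intg_norm mD (simple_bmeas (ss n)) _ (intg_cst mD k Dfin)) => t _; exact: sk.
have SIle n m : `|simple_integral D (s n) - simple_integral D (s m)| <=
    \int[mu]_(t in D) `|s n t - f t| + \int[mu]_(t in D) `|s m t - f t|.
  rewrite -RintegralD//; apply: (wint_norm mD).
  - apply: (wintB mD (wint_simple mD Dfin (ss n)) (wint_simple mD Dfin (ss m))
      (simple_bmeas (ss n)) (simple_bmeas (ss m)) _ _ (is_ n) (is_ m)) => //.
  - by apply: bmeasB; exact: simple_bmeas.
  - by move=> t _; rewrite (distrC (s m t)) -[X in `|X| <= _](subrKA (f t)) ler_normD.
  - exact: (intgD mD (isf n) (isf m)).
have /cauchy_cvg/cvg_ex[v sv] : cauchy (simple_integral D (s n) @[n --> \oo]).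
  apply: cauchy_exP => d d0; have d2 : 0 < d / 2 by rewrite divr_gt0.
  move/cvgrPdist_lt : sR0 => /(_ _ d2)[n _ nP].
  exists (simple_integral D (s n)); exists n => // m nm /=.
  rewrite -ball_normE/=; apply: le_lt_trans (SIle n m) _.
  have := nP n (leqnn n); have := nP m nm; rewrite /= !sub0r !normrN.
  have := ler_norm (\int[mu]_(t in D) `|s m t - f t|).
  have := ler_norm (\int[mu]_(t in D) `|s n t - f t|); lra.
have fv : is_bochner_integral D f v.
  split; first by exists s => //; apply: ae_all => t _; exact: sf.
  by exists s; split.
exists v; split => //.
by have [] := bochner_wint fv mf (ae_all (fun t (_ : D t) => erefl)).
Qed.

End bochner_integral.

(** * Almost everywhere convergence of convex combinations *)

Section near_minimizers.
Context {R : realType} (X : Type) (H : nat -> set X) (J : X -> R)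
  (mid dif : X -> X -> X).
Hypothesis H0 : forall n, H n !=set0.
Hypothesis Hdec : forall m n, (m <= n)%N -> H n `<=` H m.
Hypothesis Hmid : forall n f g, H n f -> H n g -> H n (mid f g).
Hypothesis J0 : forall f, H 0%N f -> 0 <= J f.
Hypothesis J_ub : exists M, forall f, H 0%N f -> J f <= M.
Hypothesis J_para : forall f g, H 0%N f -> H 0%N g ->
  J (mid f g) + J (dif f g) = 2^-1 * J f + 2^-1 * J g.

(* The infimum I n of J on H n increases with n, and the midpoint of two near
   minimisers does not beat the infimum. *)
Lemma near_minimizers (eps : nat -> R) : (forall i, 0 < eps i) ->
  (forall i, eps i.+1 <= eps i) ->
  exists g : nat -> X, (forall i, H i (g i)) /\
    forall i, J (dif (g i) (g i.+1)) <= 2 * eps i.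
Proof.
move=> eps0 eps_dec; have [M JM] := J_ub.
have HH n : H n `<=` H 0%N by exact: Hdec.
pose I n := inf [set J f | f in H n].
have hlb n : has_lbound [set J f | f in H n].
  by exists 0 => _ [f Hf <-]; apply: J0; exact: HH Hf.
have hne n : [set J f | f in H n] !=set0 by have [f Hf] := H0 n; exists (J f), f.
have IJ n f : H n f -> I n <= J f by move=> Hf; apply: ge_inf => //; exists f.
have IM n : I n <= M.
  by have [f Hf] := H0 n; apply: le_trans (IJ n f Hf) _; apply: JM; exact: HH Hf.
have Ihs : has_sup (range I).
  by split; [exists (I 0%N), 0%N|exists M => _ [n _ <-]].
have Idec m n : (m <= n)%N -> I m <= I n.
  move=> mn; apply: lb_le_inf => // _ [f Hf <-]; apply: IJ; exact: Hdec Hf.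
pose S := sup (range I).
have IS n : I n <= S by apply: ub_le_sup; [case: Ihs|exists n].
have ex i : exists nf : nat * X,
    [/\ (i <= nf.1)%N, H nf.1 nf.2, S - eps i < I nf.1 & J nf.2 < S + eps i].
  have [_ [n _ <-] In] := sup_adherent (eps0 i) Ihs.
  have [_ [f Hf <-] Jf] := inf_adherent (eps0 i) (conj (hne (maxn i n)) (hlb (maxn i n))).
  exists (maxn i n, f); split => //=; first by rewrite leq_maxl.
    by apply: lt_le_trans In (Idec _ _ _); rewrite leq_maxr.
  by apply: lt_le_trans Jf _; rewrite lerD2r; exact: IS.
pose nf i := sval (cid (ex i)); pose g i := (nf i).2.
have nfP i : [/\ (i <= (nf i).1)%N, H (nf i).1 (g i), S - eps i < I (nf i).1 &
    J (g i) < S + eps i] by exact: svalP (cid (ex i)).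
exists g; split=> [i|i]; first by have [h1 h2 _ _] := nfP i; exact: Hdec h1 _ h2.
have [_ Hi Ii Ji] := nfP i; have [_ Hj Ij Jj] := nfP i.+1.
have := J_para (HH _ _ Hi) (HH _ _ Hj).
(* The midpoint lies in the larger of the two hulls, that of the lower index, whose infimum already
   exceeds S - eps i. *)
have : S - eps i < J (mid (g i) (g i.+1)).
  have [nm|mn] := leqP (nf i).1 (nf i.+1).1.
    by apply: lt_le_trans Ii (IJ _ _ (Hmid Hi (Hdec nm Hj))).
  apply: (@le_lt_trans _ _ (S - eps i.+1)); first by have := eps_dec i; lra.
  by apply: lt_le_trans Ij (IJ _ _ (Hmid (Hdec (ltnW mn) Hi) Hj)).
by have := eps_dec i; lra.
Qed.

End near_minimizers.

Section quadratic_form.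
Context {R : realType} {E : normedModType R} (phi : nat -> {linear E -> R^o}).
Notation mu := (@lebesgue_measure R).
Hypothesis phi_le : forall j x, `|phi j x : R| <= `|x|.

Let term j x : R := (phi j x : R) ^+ 2 / (2 ^ j.+1)%:R.

Let term_ge0 j x : 0 <= term j x.
Proof. by rewrite divr_ge0// sqr_ge0. Qed.

(** The square of a Hilbertian seminorm, at most 1 on the unit ball thanks to the weights 2^-(j+1).
    The parallelogram law makes its convexity quantitative. *)
Definition qform (x : E) : \bar R := (\sum_(0 <= j <oo) (term j x)%:E)%E.

Lemma qform_ge0 x : (0 <= qform x)%E.
Proof. by apply: nneseries_ge0 => j _ _; rewrite lee_fin. Qed.

Lemma qform_le1 x : `|x| <= 1 -> (qform x <= 1%:E)%E.
Proof.
move=> x1; apply: le_trans (epsilon_trick0 xpredT ler01).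
apply: lee_nneseries => [j _ _|j _]; rewrite lee_fin//.
rewrite ler_wpM2r// -real_normK ?num_real// expr_le1//.
exact: le_trans (phi_le j x) x1.
Qed.

Lemma qform_parallelogram x y :
  (qform (2^-1 *: (x + y)) + qform (2^-1 *: (x - y)) =
   2^-1%:E * qform x + 2^-1%:E * qform y)%E.
Proof.
rewrite /qform -!nneseriesZl; [|by move=> j _; rewrite lee_fin..].
rewrite -!nneseriesD; [|by move=> j _ _; rewrite ?mule_ge0// lee_fin..].
apply: eq_eseriesr => j _; rewrite -!EFinM -!EFinD; congr EFin.
rewrite /term !linearZ !linearD linearN/=.
set a : R := phi j x; set b : R := phi j y; set k : R := (2 ^ j.+1)%:R.
rewrite [(2^-1 *: (a + b) : R^o)]/(2^-1 * (a + b)).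
rewrite [(2^-1 *: (a - b) : R^o)]/(2^-1 * (a - b)).
have -> : (2^-1 * (a + b)) ^+ 2 = 4^-1 * (a + b) ^+ 2 by rewrite exprMn; congr (_ * _); lra.
have -> : (2^-1 * (a - b)) ^+ 2 = 4^-1 * (a - b) ^+ 2 by rewrite exprMn; congr (_ * _); lra.
by move: (k^-1) => k'; lra.
Qed.

Lemma qform_coord j x : ((term j x)%:E <= qform x)%E.
Proof.
rewrite /qform (nneseriesD1 (n := j))//; last by move=> k _; rewrite lee_fin.
by rewrite leeDl// nneseries_ge0// => k _ _; rewrite lee_fin.
Qed.

Lemma qform_coord_le j x (B : R) : (qform x <= B%:E)%E ->
  (phi j x : R) ^+ 2 <= (2 ^ j.+1)%:R * B.
Proof.
move=> xB; have := le_trans (qform_coord j x) xB.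
by rewrite lee_fin /term ler_pdivrMr// mulrC.
Qed.

Lemma qform_measurable (D : set R) (f : R -> E) : bmeas f ->
  measurable_fun D (fun t => qform (f t)).
Proof.
move=> mf; apply: measurable_funTS.
apply: ge0_emeasurable_sum => j; first by move=> t _ _; rewrite lee_fin.
move=> _; apply/measurable_EFinP; apply: measurable_funM => //.
apply: measurable_funX; apply: bmeas_functional mf.
exact: contractive_cts (phi_le j).
Qed.

End quadratic_form.

Lemma norm_le_cvg (R : realType) (E : normedModType R) (x : nat -> E) (l : E) (b : R) :
  x n @[n --> \oo] --> l -> (forall n, `|x n| <= b) -> `|l| <= b.
Proof.
move=> xl xb; apply/ler_addgt0Pr => e e0.
move/cvgrPdist_lt : xl => /(_ e e0)[n _ /(_ n (leqnn n))/= ln].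
by have := ler_normD (l - x n) (x n); rewrite subrK; have := xb n; lra.
Qed.

Lemma cauchy_geometric (R : realType) (V : completeNormedModType R) (u : nat -> V) (K : R) :
  (forall i, `|u i - u i.+1| <= K / 2 ^+ i) -> cvg (u i @[i --> \oo]).
Proof.
move=> uK; have K0 : 0 <= K.
  by have := uK 0%N; rewrite expr0 divr1; apply: le_trans.
have uKn i n : `|u i - u (i + n)%N| <= 2 * K / 2 ^+ i - 2 * K / 2 ^+ (i + n)%N.
  elim: n => [|n IH]; first by rewrite addn0 !subrr normr0.
  have := ler_normD (u i - u (i + n)%N) (u (i + n)%N - u (i + n.+1)%N).
  rewrite addrA subrK addnS; have := uK (i + n)%N.
  have -> : 2 * K / 2 ^+ (i + n).+1 = K / 2 ^+ (i + n).
    by rewrite exprS invfM mulrACA divff// mul1r.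
  move: IH; have -> : 2 * K / 2 ^+ (i + n) = K / 2 ^+ (i + n) + K / 2 ^+ (i + n).
    by rewrite -mulrA mulr_natl mulr2n.
  lra.
apply: cauchy_cvg; apply: cauchy_exP => e e0.
have [i iK] : exists i, 2 * K / 2 ^+ i < e.
  have [i iP] : exists i, 2 * K / e < i.+1%:R.
    have K2 : 0 <= 2 * K / e by rewrite divr_ge0 ?mulr_ge0// ltW.
    by exists (Num.truncn (2 * K / e)); case/andP: (truncn_itv K2).
  exists i.+1; rewrite ltr_pdivrMr ?exprn_gt0// [e * _]mulrC -ltr_pdivrMr//.
  by apply: lt_trans iP _; rewrite -natrX ltr_nat ltn_expl.
exists (u i), i => // j /= ij; rewrite -ball_normE/= -(subnKC ij).
apply: le_lt_trans (uKn i _) _; apply: le_lt_trans iK; rewrite gerBl.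
by rewrite divr_ge0 ?mulr_ge0// exprn_ge0.
Qed.

Section mazur.
Context {R : realType} {E : completeNormedModType R}.
Notation mu := (@lebesgue_measure R).

Definition midclosed (P : set (R -> E)) := forall f g, P f -> P g ->
  P (fun t => 2^-1 *: (f t + g t)).

(** Midpoints take the place of general convex combinations: they are all that the parallelogram law
    uses, and they keep the coefficients rational. *)
Definition midhull (A : set (R -> E)) : set (R -> E) :=
  [set f | forall P, midclosed P -> A `<=` P -> P f].

Lemma sub_midhull (A : set (R -> E)) : A `<=` midhull A.
Proof. by move=> f Af P _; exact. Qed.

Lemma midhullS (A B : set (R -> E)) : A `<=` B -> midhull A `<=` midhull B.
Proof. by move=> AB f Af P mP BP; apply: Af => // g /AB/BP. Qed.

Lemma midclosed_midhull (A : set (R -> E)) : midclosed (midhull A).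
Proof. by move=> f g Af Ag P mP AP; apply: (mP _ _ (Af P mP AP) (Ag P mP AP)). Qed.

Lemma midhull_cvx (A : set (R -> E)) f (C : set E) t : midhull A f -> cvx C ->
  (forall g, A g -> C (g t)) -> C (f t).
Proof.
move=> Af cC AC; apply: (Af [set g | C (g t)]) => //.
by move=> g h /= Cg Ch; exact: cvx_mid.
Qed.

(* A sequence in a compact set all of whose cluster points coincide converges;
   the functionals phi identify the cluster points. *)
Lemma compact_functional_cvg (A : set E) (x : nat -> E)
    (phi : nat -> {linear E -> R^o}) : compact A -> (forall n, A (x n)) ->
  (forall j, continuous (phi j)) ->
  (forall j, cvg ((phi j (x n) : R) @[n --> \oo])) ->
  (forall p q, (forall e : R, 0 < e -> exists n, `|p - x n| < e) ->
     (forall e : R, 0 < e -> exists n, `|q - x n| < e) ->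
     (forall j, phi j p = phi j q) -> p = q) ->
  cvg (x n @[n --> \oo]).
Proof.
move=> cA Ax cphi phicvg sep.
pose F : set_system E := x n @[n --> \oo].
have clphi (G : set_system E) (FG : F `<=` G) p : cluster G p ->
    forall j, phi j p = lim ((phi j (x n) : R) @[n --> \oo]) :> R.
  move=> clp j; apply/eqP; rewrite -subr_eq0 -normr_eq0; apply/eqP/le_anti.
  rewrite normr_ge0 andbT; apply/ler_addgt0Pr => e e0; rewrite add0r.
  have e2 : 0 < e / 2 by rewrite divr_gt0.
  have /cvgrPdist_lt/(_ _ e2) h1 := phicvg j.
  have /cvgrPdist_lt/(_ _ e2) h2 := cphi j p.
  have Gh : G [set y | `|lim ((phi j (x n) : R) @[n --> \oo]) - (phi j y : R)| < e / 2].
    by apply: FG; exact: h1.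
  have [y [/= y1 y2]] := clp _ _ Gh h2.
  have := ler_normD ((phi j p : R) - phi j y) ((phi j y : R) - lim ((phi j (x n) : R) @[n --> \oo])).
  rewrite addrA subrK [`|(phi j y : R) - _|]distrC; move: y1 y2; rewrite /=; lra.
have clx (G : set_system E) (FG : F `<=` G) p : cluster G p ->
    forall e : R, 0 < e -> exists n, `|p - x n| < e.
  move=> clp e e0; have Gr : G (range x) by apply: FG; exists 0%N => // n _; exists n.
  have [_ [[n _ <-]]] := clp _ _ Gr (nbhsx_ballx p e e0).
  by rewrite -ball_normE; exists n.
have FA : F A by exists 0%N => // n _; exact: Ax.
have [p [Ap clp]] := cA F _ FA.
apply/cvg_ex; exists p; apply/cvgrPdist_lt => e e0; apply: contrapT => nF.
(* If x n leaves the ball around p infinitely often, the trace of the tails outside the ball is a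
   proper filter with a cluster point q, which the functionals identify with p. *)
pose G : set_system E := [set S | F (S `|` ball p e)].
have FG : F `<=` G by move=> S FS; apply: filterS FS => y; left.
have GF : ProperFilter G.
  split; first by rewrite /G/= set0U -ball_normE => h; apply: nF; exact: h.
  split.
  - by apply: filterS (@filterT _ F _) => y _; left.
  - move=> S1 S2 h1 h2; apply: (@filterS _ F _ _ _ _ (@filterI _ F _ _ _ h1 h2)) => y [[y1|y1] [y2|y2]]; by [left|right].
  - by move=> S1 S2 S12; apply: (@filterS _ F) => y [/S12|]; [left|right].
have [q [Aq clq]] := cA G GF (FG _ FA).
have pq : p = q.
  apply: sep; [exact: clx clp|exact: clx clq|move=> j].
  by apply: etrans (clphi _ _ _ clp j) _; last exact/esym/(clphi _ FG _ clq j).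
have Gb : G (~` ball p e).
  by apply: filterS (@filterT _ F _) => y _; have [|] := pselect (ball p e y); [right|left].
rewrite -pq in clq.
by have [y [ny yb]] := clq _ _ Gb (nbhsx_ballx p e e0).
Qed.

Variables (D : set R) (mD : measurable (D : set (measurableTypeR R))).
Hypothesis Dfin : (mu D < +oo)%E.

(** The same functionals serve all t: the values of the midpoint hull are approximated by rational
    combinations of a sequence dense in the ranges of all w n, and one norming functional is taken
    for each of these countably many combinations. *)
Lemma countable_separating (w : nat -> R -> E) : (forall n, bmeas (w n)) ->
  exists phi : nat -> {linear E -> R^o}, (forall j x, `|phi j x : R| <= `|x|) /\
    forall t p q,
     (forall e : R, 0 < e -> exists2 f, midhull (range w) f & `|p - f t| < e) ->
     (forall e : R, 0 < e -> exists2 f, midhull (range w) f & `|q - f t| < e) ->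
     (forall j, phi j p = phi j q) -> p = q.
Proof.
move=> mw; have hd n := cid (mw n).1.
pose d n := if unpickle n is Some (i, j) then sval (hd i) j else 0.
have dP n t (e : R) : 0 < e -> exists j, `|w n t - d j| < e.
  move=> e0; have [j jP] := svalP (hd n) t e e0.
  by exists (pickle (n, j)); rewrite /d pickleK.
pose ev (l : seq (rat * nat)) := \sum_(k <- l) ratr k.1 *: d k.2.
have evD l m : ev (l ++ m) = ev l + ev m by rewrite /ev big_cat.
pose sc (a : rat) (l : seq (rat * nat)) := [seq (a * k.1, k.2) | k <- l].
have evZ a l : ev (sc a l) = ratr a *: ev l.
  rewrite /ev big_map scaler_sumr; apply: eq_bigr => k _ /=.
  by rewrite rmorphM/= scalerA.
have evP f t (e : R) : midhull (range w) f -> 0 < e -> exists l, `|f t - ev l| < e.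
  move=> hf; move: e; apply: (hf [set f | forall e : R, 0 < e -> exists l, `|f t - ev l| < e]).
    move=> g h /= gP hP e e0; have [l lP] := gP e e0; have [m mP] := hP e e0.
    exists (sc 2^-1 (l ++ m)); rewrite evZ evD fmorphV/= ratr_nat -scalerBr.
    rewrite normrZ gtr0_norm ?invr_gt0// opprD addrACA.
    have := ler_normD (g t - ev l) (h t - ev m); lra.
  move=> _ [n _ <-] e /= /(dP n t)[j jP]; exists [:: (1, j)].
  by rewrite /ev big_seq1/= rmorph1 scale1r.
pose v n := if unpickle n is Some l then ev l else 0.
have hphi n := cid (norming_functional (v n)).
exists (fun n => sval (hphi n)); split=> [j x|t p q hp hq pq].
  exact: (svalP (hphi j)).1.
apply/eqP; rewrite -subr_eq0; apply/negPn/negP => pq0.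
(* Four errors of a twelfth put a combination v n within a third of p - q. If the functional norming
   v n vanishes at p - q, then v n has norm at most a third of that of p - q, which is
   contradictory. *)
have e0 : 0 < `|p - q| / 12 by rewrite divr_gt0// normr_gt0.
have [f hf pf] := hp _ e0; have [g hg qg] := hq _ e0.
have [l lP] := evP f t _ hf e0; have [m mP] := evP g t _ hg e0.
have vE : v (pickle (l ++ sc (-1) m)) = ev l - ev m.
  by rewrite /v pickleK evD evZ rmorphN rmorph1 scaleN1r.
set n := pickle _ in vE; have [pc pn] := svalP (hphi n).
have close : `|p - q - v n| <= 4 * (`|p - q| / 12).
  have -> : p - q - v n = p - ev l - (q - ev m).
    by rewrite vE !opprB [ev m - ev l]addrC addrACA [- q + _]addrC.
  have := ler_normB (p - ev l) (q - ev m).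
  have := ler_normD (p - f t) (f t - ev l); have := ler_normD (q - g t) (g t - ev m).
  by rewrite !addrA !subrK; move: pf qg lP mP; lra.
have e1 : (sval (hphi n) (p - q) : R) = 0 by rewrite linearB/= pq subrr.
have := pc (p - q - v n); rewrite linearB/= e1 sub0r normrN pn => h.
rewrite normr_id in h; have := ler_normD (p - q - v n) (v n); rewrite subrK.
by move: e0 close h; lra.
Qed.

(* Near minimisers of a strictly convex integral functional on the hulls of the
   tails form a sequence which is Cauchy for the weak topology pointwise almost
   everywhere, hence convergent in norm by compactness. *)
Theorem mazur_ae (w : nat -> R -> E) (c : R -> R) : (forall n, bmeas (w n)) ->
  measurable_fun setT c -> (forall n t, `|w n t| <= c t) ->
  {ae mu, forall t, D t -> forall e : R, 0 < e -> fnet e (range (w^~ t))} ->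
  exists (g : nat -> R -> E) (u : R -> E),
    [/\ forall i, midhull [set w k | k in [set k | (i <= k)%N]] (g i),
        bmeas u, forall t, `|u t| <= c t &
        {ae mu, forall t, D t -> g i t @[i --> \oo] --> u t}].
Proof.
move=> mw mc wc tbw; have [phi [phi_le phi_sep]] := countable_separating mw.
have c0 t : 0 <= c t by apply: le_trans (wc 0%N t).
(* Since c <= exp c, this factor brings all values into the unit ball, so that the functional J is
   bounded by the measure of D although c is not assumed integrable here. *)
pose a t := expR (- c t).
have ma : measurable_fun setT a.
  by apply: measurableT_comp => //; exact: measurableT_comp.
have a0 t : 0 < a t by exact: expR_gt0.
have ac t x : `|x| <= c t -> `|a t *: x| <= 1.
  move=> xc; rewrite normrZ gtr0_norm// /a expRN mulrC ler_pdivrMr ?expR_gt0// mul1r.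
  by rewrite (le_trans xc)// (le_trans _ (expR_ge1Dx _))// lerDr.
pose H n := midhull [set w k | k in [set k | (n <= k)%N]].
have Hw n : H n `<=` midhull (range w).
  by apply: midhullS => _ [k _ <-]; exists k.
have adm f : midhull (range w) f -> bmeas f /\ forall t, `|f t| <= c t.
  move=> hf; split.
    apply: hf => [g h mg mh|_ [n _ <-]//]; apply: bmeas_scale; last exact: bmeasD.
    exact: measurable_cst.
  move=> t; have := @midhull_cvx _ f [set x | `|x - 0| <= c t] t hf (closed_norm_le _ _).2.
  by rewrite /= subr0; apply => _ [n _ <-]; rewrite subr0.
pose mid (f g : R -> E) := fun t => 2^-1 *: (f t + g t).
pose dif (f g : R -> E) := fun t => 2^-1 *: (f t - g t).
pose J (f : R -> E) := (\int[mu]_(t in D) qform phi (a t *: f t))%E.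
have mJ f : bmeas f -> measurable_fun D (fun t => qform phi (a t *: f t)).
  by move=> mf; apply: qform_measurable => //; exact: bmeas_scale.
have J_ge0 f : (0 <= J f)%E by apply: integral_ge0 => t _; exact: qform_ge0.
have J_le f : bmeas f -> (forall t, `|f t| <= c t) -> (J f <= mu D)%E.
  move=> mf fc; rewrite -[leRHS]mul1e -(integral_cst mu mD).
  apply: ge0_le_integral => //.
  - by move=> t _; exact: qform_ge0.
  - exact: mJ.
  - by move=> t _; apply: qform_le1 => //; exact: ac.
have difP f g : bmeas f -> bmeas g -> (forall t, `|f t| <= c t) ->
    (forall t, `|g t| <= c t) -> bmeas (dif f g) /\ forall t, `|dif f g t| <= c t.
  move=> mf mg fc gc; split.
    by apply: bmeas_scale; [exact: measurable_cst|exact: bmeasB].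
  move=> t; rewrite normrZ gtr0_norm ?invr_gt0//.
  by have := ler_normB (f t) (g t); have := fc t; have := gc t; lra.
have J_fin f : bmeas f -> (forall t, `|f t| <= c t) -> J f \is a fin_num.
  by move=> mf fc; rewrite ge0_fin_numE//; exact: le_lt_trans (J_le f mf fc) Dfin.
have J_para f g : bmeas f -> bmeas g ->
    (J (mid f g) + J (dif f g) = 2^-1%:E * J f + 2^-1%:E * J g)%E.
  move=> mf mg; have mm : bmeas (mid f g).
    by apply: bmeas_scale; [exact: measurable_cst|exact: bmeasD].
  have md : bmeas (dif f g).
    by apply: bmeas_scale; [exact: measurable_cst|exact: bmeasB].
  have q0 h t : D t -> (0 <= qform phi (a t *: h t))%E by move=> _; exact: qform_ge0.
  rewrite /J -!ge0_integralZl_EFin//; [|by move=> t Dt; exact: q0|exact: mJ|by move=> t Dt; exact: q0|exact: mJ].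
  rewrite -!ge0_integralD//.
  - apply: eq_integral => t _; rewrite /mid /dif -qform_parallelogram//.
    by rewrite !scalerA ![_ * 2^-1]mulrC -!scalerA scalerDr scalerBr.
  - by move=> t Dt; rewrite mule_ge0// q0.
  - by apply: measurable_funeM; exact: mJ.
  - by move=> t Dt; rewrite mule_ge0// q0.
  - by apply: measurable_funeM; exact: mJ.
  - by move=> t Dt; exact: q0.
  - exact: mJ.
  - by move=> t Dt; exact: q0.
  - exact: mJ.
have HA n f : H n f -> bmeas f /\ forall t, `|f t| <= c t by move/Hw/adm.
(* The rate 16^-i survives the multiplication by 8^i in S, since the sum of the 8^i * 2 / 16^i is 4;
   the finiteness of S almost everywhere then leaves the decay 8^-i of the squares. *)
have [||||||i|i|g [gH gJ]] := @near_minimizers _ _ H (fine \o J) mid dif _ _ _ _ _ _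
    (fun i => (16 ^+ i)^-1).
- by move=> n; exists (w n); apply: sub_midhull; exists n => /=.
- by move=> m n mn; apply: midhullS => _ [k /= nk <-]; exists k => //=; exact: leq_trans nk.
- by move=> n f h; exact: midclosed_midhull.
- by move=> f _; exact: fine_ge0.
- exists (fine (mu D)) => f /HA[mf fc] /=; rewrite fine_le//; first exact: J_fin.
    by rewrite ge0_fin_numE.
  exact: J_le.
- move=> f h /HA[mf fc] /HA[mh hc] /=; have [md dc] := difP f h mf mh fc hc.
  have mm : bmeas (mid f h) /\ forall t, `|mid f h t| <= c t.
    split; first by apply: bmeas_scale; [exact: measurable_cst|exact: bmeasD].
    move=> t; rewrite normrZ gtr0_norm ?invr_gt0//.
    by have := ler_normD (f t) (h t); have := fc t; have := hc t; lra.
  have Fm := J_fin _ mm.1 mm.2; have Fd := J_fin _ md dc.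
  have Ff := J_fin f mf fc; have Fh := J_fin h mh hc.
  have := J_para f h mf mh.
  by rewrite -(fineK Fm) -(fineK Fd) -(fineK Ff) -(fineK Fh) -!EFinM -!EFinD => -[].
- by rewrite invr_gt0 exprn_gt0.
- by rewrite lef_pV2 ?posrE ?exprn_gt0// exprS ler_peMl ?exprn_ge0//; lra.
have gA i : bmeas (g i) /\ forall t, `|g i t| <= c t by exact: HA (gH i).
pose h i := dif (g i) (g i.+1).
have hA i : bmeas (h i) /\ forall t, `|h i t| <= c t.
  by have [? ?] := gA i; have [? ?] := gA i.+1; exact: difP.
pose S t := (\sum_(0 <= i <oo) ((8 ^+ i)%:E * qform phi (a t *: h i t)))%E.
have S_int : (\int[mu]_(t in D) S t < +oo)%E.
  rewrite /S integral_nneseries//; last 2 first.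
  - by move=> i; apply: measurable_funeM; apply: mJ; case: (hA i).
  - by move=> i t _; rewrite mule_ge0 ?qform_ge0// lee_fin exprn_ge0.
  apply: le_lt_trans (ltry 4).
  apply: le_trans (epsilon_trick0 xpredT (ler0n _ 4)).
  apply: lee_nneseries => [i _ _|i _].
    by apply: integral_ge0 => t _; rewrite mule_ge0 ?qform_ge0// lee_fin exprn_ge0.
  rewrite ge0_integralZl_EFin//; first last.
    all: try by rewrite exprn_ge0.
    all: try by apply: mJ; case: (hA i).
    all: try by move=> t _; exact: qform_ge0.
  rewrite -/(J (h i)) -(fineK (J_fin _ (hA i).1 (hA i).2)) -EFinM lee_fin.
  apply: (@le_trans _ _ (8 ^+ i * (2 / 16 ^+ i))).
    by rewrite ler_wpM2l ?exprn_ge0//; exact: gJ.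
  rewrite natrX exprS (_ : 16 ^+ i = 8 ^+ i * 2 ^+ i :> R); last first.
    by rewrite -exprMn; congr (_ ^+ _); lra.
  have E8 (x y : R) : x != 0 -> y != 0 -> x * (2 / (x * y)) = 4 / (2 * y).
    by move=> x0 y0; field; rewrite x0 y0.
  by rewrite E8 ?expf_neq0.
have S_fin : {ae mu, forall t, D t -> S t \is a fin_num}.
  apply: integrable_ae => //; apply/integrableP; split.
    apply: ge0_emeasurable_sum => [i t _ _|i _].
      by rewrite mule_ge0 ?qform_ge0// lee_fin exprn_ge0.
    by apply: measurable_funeM; apply: mJ; case: (hA i).
  rewrite (_ : (\int[mu]_(t in D) `|S t| = \int[mu]_(t in D) S t)%E)//.
  apply: eq_integral => t _; rewrite gee0_abs//; apply: nneseries_ge0 => i _ _.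
  by rewrite mule_ge0 ?qform_ge0// lee_fin exprn_ge0.
have g_cvg : {ae mu, forall t, D t -> cvg (g i t @[i --> \oo])}.
  apply: (ae_imp (ae_and S_fin tbw)) => t [Sf tb] Dt.
  pose A := clco (range (w^~ t)).
  have cA : compact A.
    apply: fnet_compact; first exact: closed_clco.
    move=> e e0; have e2 : 0 < e / 2 by rewrite divr_gt0.
    by have := fnet_clco e2 (tb Dt _ e2); rewrite -splitr.
  apply: (@compact_functional_cvg A _ phi cA).
  - move=> i; apply: (midhull_cvx (gH i) (@cvx_clco _ _ _)) => _ [k _ <-].
    by apply: sub_clco; exists k.
  - by move=> j; exact: contractive_cts (phi_le j).
  - move=> j; set s := fine (S t).
    have qs i : (qform phi (a t *: h i t) <= (s / 8 ^+ i)%:E)%E.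
      have : ((8 ^+ i)%:E * qform phi (a t *: h i t) <= s%:E)%E.
        rewrite /s fineK; last exact: Sf.
        rewrite /S (nneseriesD1 (n := i))//; last first.
          by move=> k _; rewrite mule_ge0 ?qform_ge0// lee_fin exprn_ge0.
        rewrite leeDl// nneseries_ge0// => k _ _.
        by rewrite mule_ge0 ?qform_ge0// lee_fin exprn_ge0.
      by rewrite muleC -lee_pdivlMr ?exprn_gt0// EFinM.
    have s0 : 0 <= s.
      by apply: fine_ge0; apply: nneseries_ge0 => i _ _; rewrite mule_ge0 ?qform_ge0// lee_fin exprn_ge0.
    pose B : R := (2 ^ j.+1)%:R * s.
    have B0 : 0 <= B by rewrite mulr_ge0.
    apply: (@cauchy_geometric R R^o _ (2 / a t * (1 + B))) => i.
    have h1 : (phi j (a t *: h i t) : R) ^+ 2 <= B / 8 ^+ i.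
      by rewrite /B -mulrA; exact: qform_coord_le (qs i).
    (* Root of the previous bound, by B <= (1 + B)^2 and 4^i <= 8^i. *)
    have h2 : `|phi j (a t *: h i t) : R| <= (1 + B) / 2 ^+ i.
      rewrite -(@ler_pXn2r _ 2)// ?nnegrE// ?divr_ge0 ?addr_ge0 ?exprn_ge0//.
      rewrite real_normK ?num_real//; apply: le_trans h1 _.
      rewrite exprMn exprVn -exprM mulnC exprM.
      apply: ler_pM; rewrite ?invr_ge0 ?exprn_ge0//.
        by rewrite sqrrD expr1n mul1r mulr2n; have := sqr_ge0 B; lra.
      rewrite lef_pV2 ?posrE ?exprn_gt0//.
      by apply: lerXn2r; rewrite ?nnegrE; lra.
    have hE : (phi j (g i t) : R) - phi j (g i.+1 t) = 2 / a t * (phi j (a t *: h i t) : R).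
      rewrite -linearB/= [phi j (a t *: _)]linearZ/= /h /dif [phi j (2^-1 *: _)]linearZ/=.
      rewrite [X in _ = _ * X]/(a t * (2^-1 * (phi j (g i t - g i.+1 t) : R))).
      by rewrite !mulrA mulfVK ?gt_eqF// divff ?mul1r.
    have a2 : 0 <= 2 / a t by rewrite divr_ge0// ltW.
    by rewrite hE normrM ger0_norm// -[leRHS]mulrA ler_wpM2l.
  - move=> p q hp hq; apply: (phi_sep t).
    + by move=> e /hp[n nP]; exists (g n) => //; exact: Hw (gH n).
    + by move=> e /hq[n nP]; exists (g n) => //; exact: Hw (gH n).
have [N [mN N0 gN]] := g_cvg.
pose A := D `&` ~` N.
have mA : measurable (A : set (measurableTypeR R)).
  by apply: measurableI => //; exact: measurableC.
have gAcvg t : A t -> cvg (g i t @[i --> \oo]).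
  by move=> [Dt Nt]; apply: contrapT => ncv; apply: Nt; apply: gN => /(_ Dt).
pose u t := if t \in A then lim (g i t @[i --> \oo]) else 0.
have gu t : (if t \in A then g i t else 0) @[i --> \oo] --> u t.
  by rewrite /u; case: ifPn => [/set_mem/gAcvg//|_]; exact: cvg_cst.
exists g, u; split => //.
- apply: bmeas_cvg gu => i; apply: bmeas_patch => //; exact: (gA i).1.
- move=> t; apply: (norm_le_cvg (gu t)) => i.
  by case: ifP => _; [exact: (gA i).2|rewrite normr0].
- exists N; split => // t /= ncv; apply: contrapT => Nt; apply: ncv => Dt.
  by have := gu t; rewrite mem_set.
Qed.

End mazur.

(** * Noncompactness of integrals *)

Section noncompactness_of_integrals.
Context {R : realType} {E : completeNormedModType R}.
Notation mu := (@lebesgue_measure R).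
Variables (D : set R) (mD : measurable (D : set (measurableTypeR R))).
Hypothesis Dfin : (mu D < +oo)%E.

Local Notation intg g := (mu.-integrable D (EFin \o g)).

Lemma simple_integral_seq (u : R -> E) (s : seq E) : simple_function u -> uniq s ->
  (forall t, u t \in s) ->
  simple_integral D u = \sum_(i < size s) fine (mu (D `&` u @^-1` [set nth 0 s i])) *: nth 0 s i.
Proof.
move=> _ us ur; rewrite /simple_integral (@fsbig_widen _ _ _ _ _ [set` s]).
- by rewrite -fsbig_seq// (big_nth 0) big_mkord.
- by move=> _ [t _ <-]; exact: ur.
- move=> v [_ vr] /=; rewrite (_ : u @^-1` [set v] = set0) ?setI0 ?measure0 ?scale0r//.
  by apply/seteqP; split => // t /= tv; apply: vr; exists t.
Qed.

(** These integrals are combinations of finitely many fixed vectors with coefficients in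
    [0, mu D]. *)
Lemma simple_integral_fnet (s : seq E) (e : R) : 0 < e ->
  fnet e [set simple_integral D u | u in
    [set u : R -> E | simple_function u /\ forall t, u t \in s]].
Proof.
move=> e0; pose s' := undup s.
apply: fnetS (fnet_box (fun i : 'I_(size s') => nth 0 s' i) (fine (mu D)) e0).
move=> _ [u [su us] <-] /=.
exists (fun i : 'I_(size s') => fine (mu (D `&` u @^-1` [set nth 0 s' i]))); last first.
  apply: simple_integral_seq => //; first exact: undup_uniq.
  by move=> t; rewrite mem_undup.
move=> i; pose B := D `&` u @^-1` [set nth 0 s' i]; rewrite -/B.
have mB : measurable B.
  by apply: measurableI => //; exact: simple_preimage.
have le : (mu B <= mu D)%E.
  by apply: le_measure; [exact: mem_set|exact: mem_set|move=> t []].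
rewrite fine_ge0//= fine_le// ge0_fin_numE//.
exact: le_lt_trans le Dfin.
Qed.

(* Up to an error in mean, all w k take their values in a common finite set:
   approximate w k t by the nearest of the first p terms of a sequence which is
   dense in all the ranges. *)
Theorem fnet_integrals (w : nat -> R -> E) (v : nat -> E) (c r : R -> R) (rho : R) :
  (forall n, bmeas (w n)) -> (forall n t, `|w n t| <= c t) -> intg c -> intg r ->
  (forall t, D t -> 0 <= r t) ->
  {ae mu, forall t, D t -> forall e, r t < e -> fnet e (range (w^~ t))} ->
  (forall n, wint D (w n) (v n)) -> 2 * (\int[mu]_(t in D) r t) < rho ->
  fnet rho (range v).
Proof.
move=> mw wc ic ir r0 wnet wv rrho; have hd n := cid (mw n).1.
pose d n := if n is n'.+1 then
  if unpickle n' is Some (i, j) then sval (hd i) j else 0 else 0.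
have dP n t (e : R) : 0 < e -> exists j, `|w n t - d j| < e.
  move=> e0; have [j jP] := svalP (hd n) t e e0.
  by exists (pickle (n, j)).+1; rewrite /d pickleK.
pose f p k t := `|w k t - nearest d (w k) p t|.
have fc p k t : f p k t <= c t.
  by apply: le_trans (nearest_le d (w k) t (leq0n p)) _; rewrite subr0.
have mf p k : measurable_fun setT (f p k) by exact: (nearest_simple d p (mw k).2).2.
have ub p t : has_ubound (range ((f p)^~ t)) by exists (c t) => _ [k _ <-].
pose eps p t := sups ((f p)^~ t) 0.
have epsE p t : eps p t = sup (range ((f p)^~ t)).
  by rewrite /eps /sups; congr sup; apply/seteqP; split => _ [k _ <-]; exists k.
have f_eps p k t : f p k t <= eps p t.
  by rewrite epsE; apply: ub_le_sup; [exact: ub|exists k].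
have eps_le p t b : (forall k, f p k t <= b) -> eps p t <= b.
  move=> fb; rewrite epsE; apply: ge_sup; first by exists (f p 0%N t), 0%N.
  by move=> _ [k _ <-].
have eps0 p t : 0 <= eps p t by exact: le_trans (normr_ge0 _) (f_eps p 0%N t).
have epsc p t : eps p t <= c t by exact: eps_le.
have meps p : measurable_fun D (eps p).
  apply: measurable_fun_sups => [t _|k]; first exact: ub.
  exact: measurable_funTS.
have mr := intg_measurable ir.
(* The excess of the uniform error over 2 r tends to 0 almost everywhere and is dominated by c. *)
pose h p t := Num.max 0 (eps p t - 2 * r t).
have h_cvg : \int[mu]_(t in D) h p t @[p --> \oo] --> 0.
  apply: (@Rintegral_dominated _ D mD h c) => //.
  - move=> p; apply: measurable_maxr; first exact: measurable_cst.
    apply: measurable_funB; first exact: meps.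
    by apply: measurable_funM => //; exact: measurable_cst.
  - apply: (ae_imp wnet) => t tnet Dt; apply/cvgrPdist_le => e e0.
    have e3 : r t < r t + e / 3 by rewrite ltrDl divr_gt0.
    have [s sP] := tnet Dt _ e3.
    (* The factor 2 arises here: the centre x of a net is replaced by some d j close to a value w k0
       t in the same ball, at distance at most 2 (r + e / 3) + e / 3 from the other values in that
       ball. *)
    have [P PP] : exists P, forall x, x \in s -> forall k, `|w k t - x| < r t + e / 3 ->
        exists2 j, (j <= P)%N & `|w k t - d j| <= 2 * r t + e.
      elim: s {sP} => [|x s [P IH]]; first by exists 0%N.
      have [[k0 k0x]|nk] := pselect (exists k, `|w k t - x| < r t + e / 3); last first.
        exists P => y; rewrite inE => /predU1P[-> k kx|/IH//].
        by exfalso; apply: nk; exists k.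
      have [j jP] := dP k0 t (e / 3) ltac:(by rewrite divr_gt0).
      exists (maxn P j) => y; rewrite inE => /predU1P[-> k kx|/IH yP k /yP[i iP ik]].
        exists j; first by rewrite leq_maxr.
        have := ler_normD (w k t - x) (x - w k0 t).
        have := ler_normD (w k t - w k0 t) (w k0 t - d j).
        by rewrite !addrA !subrK (distrC x); lra.
      by exists i => //; apply: leq_trans iP _; rewrite leq_maxl.
    exists P => // p /= Pp; rewrite sub0r normrN ger0_norm ?le_max ?lexx//.
    rewrite ge_max (ltW e0)/= lerBlDl; apply: eps_le => k.
    have [x xs kx] := sP (w k t) (ex_intro2 _ _ k I erefl).
    have [j jP kj] := PP x xs k kx.
    by apply: le_trans kj; apply: nearest_le; exact: leq_trans Pp.
  - move=> p t Dt; rewrite ger0_norm ?le_max ?lexx// ge_max.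
    rewrite (le_trans (eps0 p t) (epsc p t))/= (le_trans _ (epsc p t))//.
    by rewrite gerBl mulr_ge0// r0.
pose d1 := (rho - 2 * \int[mu]_(t in D) r t) / 2.
have d10 : 0 < d1 by rewrite divr_gt0// subr_gt0.
move/cvgrPdist_lt : h_cvg => /(_ _ d10)[p _ /(_ p (leqnn p))/=].
rewrite sub0r normrN => hp.
have ieps : intg (eps p).
  by apply: (intg_le mD (meps p) _ ic) => t _; rewrite ger0_norm.
have ih : intg (h p).
  apply: (intg_le mD _ _ ic).
    apply: measurable_maxr; first exact: measurable_cst.
    apply: measurable_funB; first exact: meps.
    by apply: measurable_funM => //; exact: measurable_cst.
  move=> t Dt; rewrite ger0_norm ?le_max ?lexx// ge_max.
  rewrite (le_trans (eps0 p t) (epsc p t))/= (le_trans _ (epsc p t))//.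
  by rewrite gerBl mulr_ge0// r0.
have int_eps : \int[mu]_(t in D) eps p t < 2 * (\int[mu]_(t in D) r t) + d1.
  apply: (@le_lt_trans _ _ (\int[mu]_(t in D) (2 * r t + h p t))).
    apply: le_Rintegral => //; first exact: (intgD mD (intgZ mD 2 ir) ih).
    by move=> t _; rewrite -lerBlDl le_max lexx orbT.
  rewrite RintegralD//; last exact: (intgZ mD 2 ir).
  rewrite RintegralZl// ltrD2l; exact: le_lt_trans (ler_norm _) hp.
have d20 : 0 < d1 / 2 by rewrite divr_gt0.
pose s := [seq d j | j <- iota 0 p.+1].
apply: (@fnet_le _ _ (d1 / 2 + \int[mu]_(t in D) eps p t)).
  by move: int_eps d10; rewrite /d1; lra.
apply: fnet_shift (simple_integral_fnet s d20) => _ [k _ <-].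
have [ss _] := nearest_simple d p (mw k).2.
exists (simple_integral D (nearest d (w k) p)).
  exists (nearest d (w k) p) => //; split => // t.
  have [j jp ->] := nearest_in d (w k) p t.
  by apply: map_f; rewrite mem_iota.
have iu : intg (fun t => `|nearest d (w k) p t|).
  have [b ub'] := simple_bounded ss.
  by apply: (intg_norm mD (simple_bmeas ss) _ (intg_cst mD b Dfin)) => t _; exact: ub'.
apply: (wint_norm mD _ _ _ ieps).
- apply: (wintB mD (wv k) (wint_simple mD Dfin ss) (mw k) (simple_bmeas ss) _ _ ic iu) => //.
- by apply: bmeasB => //; exact: simple_bmeas.
- by move=> t _; exact: f_eps.
Qed.

End noncompactness_of_integrals.

(** * Weights and evolution operators *)

Section bielecki_weight.
Context {R : realType} (T : R) (T0 : 0 < T).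
Notation mu := (@lebesgue_measure R).
Local Notation I := (`[0, T]%classic : set R).
Local Notation intg g := (mu.-integrable I (EFin \o g)).

Lemma measurable_I : measurable (I : set (measurableTypeR R)).
Proof. exact: measurable_itv. Qed.
Let mI := measurable_I.

Lemma finite_I : (mu I < +oo)%E.
Proof. by rewrite lebesgue_measure_itv/= lte_fin T0 ltry. Qed.

Definition cell (N : nat) (t : R) : nat := Num.truncn (t * N.+1%:R / T).

Lemma le_cell N s t : s <= t -> (cell N s <= cell N t)%N.
Proof.
by move=> st; apply: le_truncn; rewrite ler_pM2r ?invr_gt0// ler_pM2r.
Qed.

Lemma cell_itv N t : 0 <= t ->
  (cell N t)%:R * T / N.+1%:R <= t < (cell N t).+1%:R * T / N.+1%:R.
Proof.
move=> t0; have u0 : 0 <= t * N.+1%:R / T by rewrite divr_ge0 ?mulr_ge0// ltW.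
have /andP[] := truncn_itv u0; rewrite -/(cell N t) => h1 h2.
by rewrite ler_pdivrMr// ltr_pdivlMr// -ler_pdivlMr// h1 -ltr_pdivrMr.
Qed.

Lemma cell_eq N j t : j%:R * T / N.+1%:R <= t < j.+1%:R * T / N.+1%:R -> cell N t = j.
Proof.
rewrite ler_pdivrMr// ltr_pdivlMr// -ler_pdivlMr// -ltr_pdivrMr// => h.
exact: truncn_def.
Qed.

Lemma cell_dist N s t : 0 <= s -> 0 <= t -> cell N s = cell N t ->
  `|s - t| < T / N.+1%:R.
Proof.
move=> s0 t0 st; have := cell_itv N s0; have := cell_itv N t0; rewrite st.
rewrite -(natr1 (cell N t)) !mulrDl !mul1r ltr_norml.
by move: (_ * T / _) (T / _) => x y; lra.
Qed.

Definition node (N j : nat) : R := j%:R * T / N.+1%:R.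

(** The endpoint T opens a cell of its own, with index N + 1; hence N + 2 nodes. *)
Lemma node_cell N s : 0 <= s <= T -> [/\ (cell N s < N.+2)%N,
  0 <= node N (cell N s) <= T, node N (cell N s) <= s &
  `|s - node N (cell N s)| < T / N.+1%:R].
Proof.
move=> /andP[s0 sT]; have /andP[h1 h2] := cell_itv N s0.
have n0 : 0 <= node N (cell N s) by rewrite divr_ge0// mulr_ge0// ltW.
split=> //; last 2 first.
- by rewrite n0 (le_trans h1).
- rewrite ger0_norm ?subr_ge0// ltrBlDr; apply: lt_le_trans h2 _.
  by rewrite /node -natr1 !mulrDl mul1r addrC.
rewrite ltnS -(ler_nat R) -(ler_pM2r T0) [leRHS]mulrC -ler_pdivrMr//.
exact: le_trans h1 sT.
Qed.

Lemma small_cells (e : R) : 0 < e -> exists N : nat, T / N.+1%:R < e.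
Proof.
move=> e0; exists (Num.truncn (T / e)); rewrite ltr_pdivrMr// mulrC -ltr_pdivrMr//.
by have /andP[] := truncn_itv (divr_ge0 (ltW T0) (ltW e0)).
Qed.

Lemma measurable_cell N : measurable_fun setT (fun t => 2 ^+ cell N t : R).
Proof.
apply: nondecreasing_measurable => // s t st.
by rewrite ler_weXn2l ?le_cell//; lra.
Qed.

(** Absolute continuity of the integral: the part of h above a height n has small integral by
    dominated convergence, and the rest contributes at most (n + 1) (b - a). *)
Lemma Rintegral_itv_small (h : R -> R) (e : R) : (forall t, 0 <= h t) -> intg h ->
  0 < e -> exists2 d : R, 0 < d & forall a b : R, a <= b -> b - a < d ->
    \int[mu]_(t in I) (\1_`[a, b]%classic t * h t) <= e.
Proof.
move=> h0 ih e0; have mh := intg_measurable ih.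
pose f n t := h t - Num.min (h t) n%:R.
have f0 n t : 0 <= f n t by rewrite subr_ge0 ge_min lexx.
have fh n t : f n t <= h t by rewrite gerBl le_min h0 ler0n.
have mf n : measurable_fun I (f n).
  apply: measurable_funB; first exact: mh.
  by apply: measurable_minr; [exact: mh|exact: measurable_cst].
have fcvg : \int[mu]_(t in I) f n t @[n --> \oo] --> 0.
  apply: (Rintegral_dominated mI mf _ _ ih) => [|n t _]; last by rewrite ger0_norm.
  apply: ae_all => t _; apply/cvgrPdist_lt => d d0.
  exists (Num.truncn (h t)).+1 => // n /= hn.
  rewrite /f min_l ?subrr ?subr0 ?normr0//.
  have /andP[_ h1] := truncn_itv (h0 t).
  by apply: le_trans (ltW h1) _; rewrite ler_nat.
have e2 : 0 < e / 2 by rewrite divr_gt0.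
move/cvgrPdist_lt : fcvg => /(_ _ e2)[n _ /(_ n (leqnn n))/=].
rewrite sub0r normrN => fn.
exists (e / 2 / n.+1%:R); first by rewrite divr_gt0.
move=> a b ab abd; pose A : set R := `[a, b]%classic.
have mA : measurable A by exact: measurable_itv.
have ind1 : intg (fun t => \1_A t : R).
  have := intg_indic mI mA (intg_cst mI 1 finite_I).
  by congr integrable; apply/funext => t /=; rewrite mulr1.
have iindn : intg (fun t => n.+1%:R * (\1_A t : R)) by exact: intgZ.
have ifn : intg (f n).
  by apply: (intg_le mI (mf n) _ ih) => t _; rewrite ger0_norm.
apply: (@le_trans _ _ (\int[mu]_(t in I) (f n t + n.+1%:R * \1_A t))).
  apply: le_Rintegral => //; first exact: (intg_indic mI mA ih).
    exact: (intgD mI ifn iindn).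
  move=> t _; rewrite indicE; have [tA|tA] := boolP (t \in A).
    rewrite mul1r mulr1 /f -lerBlDl opprB addrC subrK ge_min.
    by rewrite ler_nat leqnSn orbT.
  by rewrite mul0r mulr0 addr0.
rewrite RintegralD// RintegralZl//.
have indE : \int[mu]_(t in I) \1_A t <= b - a.
  rewrite /Rintegral (integral_indic mu mI mA).
  have muA : mu A = (b - a)%:E.
    rewrite lebesgue_measure_itv/= lte_fin; case: ltP => // ba.
    by rewrite (_ : a = b) ?subrr//; apply/le_anti; rewrite ab ba.
  have le : (mu (A `&` I) <= (b - a)%:E)%E.
    rewrite -muA; apply: le_measure; rewrite ?inE//.
      by apply: measurableI => //; exact: mI.
  rewrite -[leRHS]/(fine (b - a)%:E) fine_le// ge0_fin_numE//.
  exact: le_lt_trans le (ltry _).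
have k1 := le_trans (ler_norm _) (ltW fn).
have k2 := ler_wpM2l (ler0n R n.+1) indE.
have k3 : n.+1%:R * (b - a) <= e / 2 by rewrite -ler_pdivlMl// mulrC ltW.
by apply: le_trans (lerD k1 (le_trans k2 k3)) _; rewrite -splitr.
Qed.

(* An equivalent weight 2 ^ (cell t) making t |-> int_0^t h contractive with
   constant q, by the absolute continuity of the integral. *)
Lemma bielecki (h : R -> R) (q : R) : (forall t, 0 <= h t) -> intg h -> 0 < q ->
  exists N, forall t, 0 <= t <= T ->
    \int[mu]_(s in I) (\1_`[0, t]%classic s * (h s * 2 ^+ cell N s)) <=
    q * 2 ^+ cell N t.
Proof.
move=> h0 ih q0; have q2 : 0 < q / 2 by rewrite divr_gt0.
have [d d0 dP] := Rintegral_itv_small h0 ih q2.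
have [N Nd] := small_cells d0; exists N.
pose p s : R := 2 ^+ cell N s; pose b j : R := j%:R * T / N.+1%:R.
have p0 s : 0 <= p s by rewrite exprn_ge0.
have mh := intg_measurable ih.
have ihp : intg (fun s => h s * p s).
  apply: (intg_le mI _ _ (intgZ mI (2 ^+ cell N T) ih)).
    by apply: measurable_funM => //; apply: measurable_funTS; exact: measurable_cell.
  move=> t /=; rewrite in_itv/= => /andP[_ tT].
  rewrite ger0_norm ?mulr_ge0// mulrC ler_wpM2r// ler_weXn2l ?le_cell//; lra.
have iA (A : set R) : measurable A -> intg (fun s => \1_A s * (h s * p s)).
  by move=> mA; exact: (intg_indic mI mA ihp).
(* The cell j adds at most 2^j * q / 2, so the bound at most doubles from one node to the next; the
   final estimate is the one at the right end of the cell of t. *)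
have bj j : \int[mu]_(s in I) (\1_`[0, b j[%classic s * (h s * p s)) <= q / 2 * 2 ^+ j.
  elim: j => [|j IH].
    rewrite (_ : \int[mu]_(s in I) _ = \int[mu]_(s in I) (cst 0 s)).
      by rewrite Rintegral_cst// mul0r expr0 mulr1 ltW.
    apply: eq_Rintegral => s _; rewrite indicE memNset ?mul0r// /b !mul0r /= in_itv/=.
    by move=> /andP[]; lra.
  have bb : b j.+1 = b j + T / N.+1%:R by rewrite /b -natr1 mulrDl mul1r mulrDl.
  have step : \int[mu]_(s in I) (\1_`[b j, b j.+1]%classic s * h s) <= q / 2.
    apply: dP; first by rewrite bb lerDl divr_ge0// ltW.
    by rewrite bb addrC addKr.
  apply: (@le_trans _ _ (\int[mu]_(s in I)
     (\1_`[0, b j[%classic s * (h s * p s) + 2 ^+ j * (\1_`[b j, b j.+1]%classic s * h s)))).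
    apply: le_Rintegral => //; first by apply: iA; exact: measurable_itv.
      apply: (intgD mI); first by apply: iA; exact: measurable_itv.
      by apply: (intgZ mI); apply: (intg_indic mI) => //; exact: measurable_itv.
    move=> s _; rewrite !indicE.
    have [/set_mem/=|_] := boolP (s \in `[0, b j.+1[%classic); last first.
      by rewrite mul0r addr_ge0// !mulr_ge0// exprn_ge0.
    rewrite in_itv/= => /andP[s0 sb]; have [sj|sj] := ltP s (b j).
      have sA : s \in `[0, b j[%classic by rewrite mem_set//= in_itv/= s0.
      by rewrite sA lerDl !mulr_ge0// exprn_ge0.
    have sA : s \in `[b j, b j.+1]%classic by rewrite mem_set//= in_itv/= sj ltW.
    rewrite sA !mul1r /p (@cell_eq N j) ?sj// mulrC lerDr.
    by rewrite !mulr_ge0// exprn_ge0.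
  have i1 : intg (fun s => \1_`[b j, b j.+1]%classic s * h s).
    by apply: (intg_indic mI) => //; exact: measurable_itv.
  rewrite RintegralD//; [|by apply: iA; exact: measurable_itv|exact: (intgZ mI)].
  rewrite RintegralZl// exprS.
  have j0 : 0 <= 2 ^+ j :> R by rewrite exprn_ge0.
  have := ler_wpM2l j0 step; move: IH.
  by rewrite (_ : q / 2 * (2 * 2 ^+ j) = q / 2 * 2 ^+ j + 2 ^+ j * (q / 2)); lra.
move=> t /andP[t0 tT]; apply: (@le_trans _ _ (q / 2 * 2 ^+ (cell N t).+1)); last first.
  by rewrite exprS mulrA divfK.
apply: le_trans (bj _); apply: le_Rintegral => //.
- by apply: iA; exact: measurable_itv.
- by apply: iA; exact: measurable_itv.
- move=> s _; rewrite ler_wpM2r ?mulr_ge0// !indicE.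
  have [/set_mem/=|//] := boolP (s \in `[0, t]%classic); rewrite in_itv/= => /andP[s0 st].
  rewrite mem_set//= in_itv/= s0/=.
  by have /andP[_] := cell_itv N t0; exact: le_lt_trans.
Qed.

End bielecki_weight.

Section evolution_operators.
Context {R : realType} {E : completeNormedModType R}.

Lemma opnorm_bound (f : E -> E) (k : R) : (forall a x, f (a *: x) = a *: f x) ->
  (opnorm f <= k%:E)%E -> forall x, `|f x| <= k * `|x|.
Proof.
move=> fZ fk x; have [->|x0] := eqVneq x 0.
  by rewrite -[in f _](scale0r (0 : E)) fZ scale0r normr0 mulr0.
have nx : 0 < `|x| by rewrite normr_gt0.
pose y := `|x|^-1 *: x.
have xy : x = `|x| *: y by rewrite scalerA divff ?scale1r// gt_eqF.
have fy : `|f y| <= k.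
  rewrite -lee_fin; apply: le_trans fk; apply: ereal_sup_ubound; exists y => //=.
  by rewrite normrZ ger0_norm ?invr_ge0// mulVf ?gt_eqF.
by rewrite {1}xy fZ normrZ normr_id mulrC ler_wpM2r.
Qed.

(** The solution is the fixed point of x |-> y + (x - V x), a contraction with constant 1/2. *)
Lemma neumann (V : {linear E -> E}) : (forall x, `|V x - x| <= 2^-1 * `|x|) ->
  forall y, exists2 x, V x = y & `|x| <= 2 * `|y|.
Proof.
move=> V2 y; pose P x := x - V x.
have P2 x z : `|P x - P z| <= 2^-1 * `|x - z|.
  apply: le_trans (V2 (x - z)); rewrite -[leRHS]normrN opprB (linearB V)/= /P.
  by rewrite !opprB [V z - z]addrC addrACA [- V x + V z]addrC.
pose x := fix x n := if n is n'.+1 then y + P (x n') else y.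
have xK i : `|x i - x i.+1| <= `|P y| / 2 ^+ i.
  elim: i => [|i IH]; first by rewrite expr0 divr1 /= opprD addrA subrr sub0r normrN.
  rewrite /= opprD addrACA subrr add0r (le_trans (P2 _ _))//.
  rewrite exprS invfM mulrCA ler_wpM2l//; exact: IH.
have /cvg_ex[l xl] := cauchy_geometric xK.
have lE : l = y + P l.
  have h1 : x n.+1 @[n --> \oo] --> l by rewrite (cvg_shiftS x).
  suff h2 : x n.+1 @[n --> \oo] --> y + P l by exact: (cvg_unique _ h1 h2).
  apply: cvgD; first exact: cvg_cst.
  apply/cvgrPdist_lt => e e0; move/cvgrPdist_lt : xl => /(_ e e0).
  apply: filterS => n le; apply: le_lt_trans (P2 _ _) _.
  by have := normr_ge0 (l - x n); lra.
exists l; first by apply: (addrI l); rewrite {1}lE /P addrA subrK addrC.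
have := ler_normD y (P l); rewrite -lE.
have := P2 l 0; rewrite {2}/P linear0 !subr0.
lra.
Qed.

(** The real mean value theorem, applied after composition with a functional norming f t - f s. *)
Lemma derivative_bound (f df : R -> E) (D : set R) (s t k : R) : s < t ->
  (forall r, s < r < t -> exists2 e : R, 0 < e &
     forall r', `|r' - r| < e -> D r') ->
  (forall r, s < r < t -> is_derive_in D f r (df r)) ->
  {within `[s, t], continuous f} ->
  (forall r, s < r < t -> `|df r| <= k) -> `|f t - f s| <= k * (t - s).
Proof.
move=> st Dr fD cf dfk; have [e [ec ev]] := norming_functional (f t - f s).
have ce := contractive_cts ec.
pose g r : R := e (f r).
have [||c cst gE] := @MVT _ g (fun r => e (df r) : R) s t st.
- move=> r; rewrite in_itv/= => rst.
  have h : h^-1 *: (g (h *: 1 + r) - g r) @[h --> 0^'] --> (e (df r) : R).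
    apply/cvgrPdist_lt => d d0.
    have := fD r rst; rewrite /is_derive_in => /cvgrPdist_lt/(_ d d0).
    rewrite /within/= => -[d1 d10 d1P]; have [d2 d20 d2P] := Dr r rst.
    exists (Num.min d1 d2); first by rewrite /= lt_min d10.
    move=> h /=; rewrite sub0r normrN lt_min => /andP[h1 h2] h0.
    have hr : h *: 1 + r - r = h by rewrite addrK /GRing.scale/= mulr1.
    have /(_ _ _ _)/= := d1P (h *: 1 + r).
    rewrite distrC hr => /(_ h1).
    have h0' : h *: 1 + r != r by rewrite -subr_eq0 hr.
    move=> /(_ h0' (d2P _ _)); rewrite hr => /(_ h2) le.
    have := ec (df r - h^-1 *: (f (h *: 1 + r) - f r)).
    rewrite linearB linearZ linearB/= => le'; exact: le_lt_trans le' le.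
  apply: DeriveDef; first by apply/cvg_ex; exists (e (df r)).
  exact: cvg_lim h.
- move=> r; apply: continuous_comp; first exact: cf.
  exact: ce.
- move: cst; rewrite in_itv/= => cst.
  rewrite -ev linearB/= -/(g t) -/(g s) gE ler_wpM2r ?subr_ge0 ?(ltW st)//.
  exact: le_trans (ler_norm _) (le_trans (ec _) (dfk c cst)).
Qed.

Section everywhere_defined.
Variables (T : R) (T0 : 0 < T) (D : set E) (A : R -> linop E).
Variables (U : R -> R -> {linear E -> E}).
Hypothesis P2 : exists M : R, forall (t : R) (lambda : R[i]), t \in `[0, T] ->
  complex.Re lambda <= 0 ->
  exists2 Q : E * E -> E * E, is_resolvent (A t) lambda Q &
    (opnorm_wrt (@cplx_norm R E) Q <= (M / (Normc.normc lambda + 1))%:E)%E.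
Hypothesis P3 : exists L alpha : R, 0 < alpha <= 1 /\
  forall s t tau : R, s \in `[0, T] -> t \in `[0, T] -> tau \in `[0, T] ->
    (opnorm (fun x : E => A t (opinv (A tau) x) - A s (opinv (A tau) x))%R
       <= (L * `|t - s| `^ alpha)%:E)%E.
Hypothesis domA : forall t : R, t \in `[0, T] -> dom (A t) = [set: E].

Let A_linear t a x y : t \in `[0, T] -> A t (a *: x + y) = a *: A t x + A t y.
Proof. by move=> tI; apply: opfun_linear; rewrite domA. Qed.

Let A0 t : t \in `[0, T] -> A t 0 = 0.
Proof.
move=> tI; have := A_linear 1 0 0 tI; rewrite !scale1r addr0 => /eqP.
by rewrite -subr_eq0 opprD addrA subrr sub0r oppr_eq0 => /eqP.
Qed.

Let AZ t a x : t \in `[0, T] -> A t (a *: x) = a *: A t x.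
Proof. by move=> tI; have := A_linear a x 0 tI; rewrite A0// !addr0. Qed.

(** The resolvent at 0 is the inverse of - A(t); the second component of the complexification is set
    to 0. *)
Let A_bij t : t \in `[0, T] ->
  (forall y, exists x, A t x = y) /\ (forall x x', A t x = A t x' -> x = x').
Proof.
move=> tI; have [M MP] := P2.
have [|Q [_ Qr Ql _] _] := MP t 0%C tI; first by rewrite /=.
have shE z : shift_op (A t) 0%C z = (- A t z.1, - A t z.2).
  by rewrite /shift_op/= !scale0r subr0 addr0 !sub0r.
split=> [y|x x' Axx'].
  exists (Q (- y, 0)).1; have := Qr (- y, 0); rewrite shE => -[].
  by move/oppr_inj.
have dA y : dom (A t) y by rewrite domA.
have := Ql (x, 0) (dA _) (dA _); rewrite shE/= Axx'.
by have := Ql (x', 0) (dA _) (dA _); rewrite shE/= => -> [].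
Qed.

Let A_inv t y : t \in `[0, T] -> A t (opinv (A t) y) = y.
Proof.
move=> tI; have [[x xy] _] := ((A_bij tI).1 y, 0%N).
have := @xgetPex _ 0 [set x | dom (A t) x /\ A t x = y].
by case; first by exists x; rewrite domA.
Qed.

Let inv_A t x : t \in `[0, T] -> opinv (A t) (A t x) = x.
Proof. by move=> tI; apply: (A_bij tI).2; rewrite A_inv. Qed.

Let inv_Z t a x : t \in `[0, T] -> opinv (A t) (a *: x) = a *: opinv (A t) x.
Proof. by move=> tI; apply: (A_bij tI).2; rewrite AZ// !A_inv. Qed.

Hypothesis U_evol : evolution_system T D A U.
Hypothesis U_unif : forall t s : R, t \in `[0, T] -> s \in `[0, t] ->
  opnorm (U t r \- U t s) @[r --> within `[0, t] (nbhs s)] --> 0%E.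

(** By uniform continuity of U(T, .) at T, some U(T, r) with r < T is within 1/2 of the identity,
    hence onto with a bounded choice of preimages. As A(T) U(T, r) is bounded, so is A(T); then (P3)
    with tau = T bounds all A(t) uniformly. *)
Lemma A_bounded : exists2 k : R, 0 <= k & forall t x, t \in `[0, T] -> `|A t x| <= k * `|x|.
Proof.
have TI : T \in `[0, T] by rewrite in_itv/= lexx (ltW T0).
have [C [dU [U1 [_ [_ [_ [UdU _]]]]]]] := U_evol.
have [r [r0 rT rP]] : exists r, [/\ 0 <= r, r < T & (opnorm (U T r \- U T T)%R < 2^-1%:E)%E].
  have := U_unif TI TI => /fine_cvgP[]; rewrite /within/= => -[e e0 eP].
  have half0 : 0 < 2^-1 :> R by rewrite invr_gt0.
  move=> cv; have {cv} := (@cvgrPdist_lt _ _ _ _ (within_filter `[0, T]%classic _) _ _).1 cv _ half0.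
  rewrite /within/= => -[e' e'0 e'P].
  pose r := T - Num.min (Num.min e e') T / 2.
  have m0 : 0 < Num.min (Num.min e e') T by rewrite !lt_min e0 e'0.
  have mT : Num.min (Num.min e e') T <= T by rewrite ge_min lexx orbT.
  have me : Num.min (Num.min e e') T <= e by rewrite !ge_min lexx.
  have me' : Num.min (Num.min e e') T <= e' by rewrite !ge_min lexx orbT.
  have r0 : 0 <= r by rewrite /r; lra.
  have rT : r < T by rewrite /r; lra.
  have rI : r \in `[0, T] by rewrite in_itv/= r0 ltW.
  exists r; split => //.
  have Tre : `|T - r| < e by rewrite gtr0_norm /r; lra.
  have Tre' : `|T - r| < e' by rewrite gtr0_norm /r; lra.
  have fin := eP r Tre rI.
  have := e'P r Tre' rI; rewrite sub0r normrN => lt.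
  by rewrite -(fineK fin) lte_fin (le_lt_trans (ler_norm _) lt).
have [_ _ UdA _ dUn] := UdU r T r0 rT (lexx T).
have Tr : 0 < T - r by rewrite subr_gt0.
have V2 x : `|U T r x - x| <= 2^-1 * `|x|.
  have UZ (a : R) z : (U T r \- U T T) (a *: z) = a *: (U T r \- U T T) z.
    by rewrite /= scalerBr; congr (_ - _); exact: linearZ.
  by have := opnorm_bound UZ (ltW rP) x; rewrite /= U1.
have B0 : 0 <= `|C| / (T - r) by rewrite divr_ge0// ltW.
have AT x : `|A T x| <= 2 * (`|C| / (T - r)) * `|x|.
  have [z <- zx] := neumann V2 x.
  rewrite -normrN -(add0r (- _)) -(UdA z) addrK.
  have dUZ (a : R) y : dU T r (a *: y) = a *: dU T r y by rewrite linearZ.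
  apply: le_trans (opnorm_bound dUZ dUn z) _.
  apply: (@le_trans _ _ (`|C| / (T - r) * `|z|)).
    by rewrite ler_wpM2r// ler_wpM2r ?invr_ge0 ?(ltW Tr)// ler_norm.
  by apply: le_trans (ler_wpM2l B0 zx) _; rewrite mulrCA mulrA.
have [L [alpha [/andP[al0 _] AL]]] := P3.
pose k := 2 * (`|C| / (T - r)).
have k0 : 0 <= k by rewrite mulr_ge0.
have l0 : 0 <= `|L| * T `^ alpha by rewrite mulr_ge0// powR_ge0.
exists ((1 + `|L| * T `^ alpha) * k); first by rewrite mulr_ge0// addr_ge0.
move=> t x tI.
have := @opnorm_bound (fun x => A t (opinv (A T) x) - A T (opinv (A T) x)) _ _ (AL T t T TI tI TI) (A T x).
rewrite inv_A// => /(_ _) h.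
have {}h : `|A t x - A T x| <= L * `|t - T| `^ alpha * `|A T x|.
  by apply: h => a z; rewrite inv_Z// !AZ// scalerBr.
have le1 : L * `|t - T| `^ alpha * `|A T x| <= `|L| * T `^ alpha * `|A T x|.
  rewrite ler_wpM2r//; apply: (@le_trans _ _ (`|L| * `|t - T| `^ alpha)).
    by rewrite ler_wpM2r ?powR_ge0// ler_norm.
  rewrite ler_wpM2l//; apply: ge0_ler_powR; rewrite ?nnegrE ?(ltW al0) ?(ltW T0)//.
  by move: tI; rewrite in_itv/= ler_norml; lra.
have := ler_normD (A t x - A T x) (A T x); rewrite subrK => le2.
have le3 : (1 + `|L| * T `^ alpha) * `|A T x| <= (1 + `|L| * T `^ alpha) * (k * `|x|).
  by rewrite ler_wpM2l ?addr_ge0//; exact: AT.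
by rewrite -mulrA; lra.
Qed.

(** All that the construction of solutions retains of the evolution system; the operators A(t) no
    longer occur. *)
Definition evolution_bounds (C a : R) :=
  [/\ 1 <= C /\ 0 <= a,
      forall s x, 0 <= s <= T -> U s s x = x,
      forall s r t x, 0 <= s -> s <= r -> r <= t -> t <= T -> U t r (U r s x) = U t s x,
      forall s t x, 0 <= s -> s <= t -> t <= T -> `|U t s x| <= C * `|x|
    & forall s t x, 0 <= s -> s <= t -> t <= T -> `|U t s x - x| <= a * (t - s) * `|x|].

Lemma evolution_is_bounded : exists C a, evolution_bounds C a.
Proof.
have [C [dU [U1 [UU [Uc [Ub [UdU _]]]]]]] := U_evol.
have [k k0 Ak] := A_bounded.
have UC s t x : 0 <= s -> s <= t -> t <= T -> `|U t s x| <= (`|C| + 1) * `|x|.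
  move=> s0 st tT; have UZ (a : R) z : U t s (a *: z) = a *: U t s z by rewrite linearZ.
  apply: le_trans (opnorm_bound UZ (Ub s t s0 st tT) x) _.
  by rewrite ler_wpM2r//; have := ler_norm C; lra.
exists (`|C| + 1), (k * (`|C| + 1)); split=> //.
- by split; [rewrite lerDr|rewrite mulr_ge0// addr_ge0].
- move=> s t x s0; rewrite le_eqVlt => /predU1P[<-|st] tT.
    by rewrite U1 ?subrr ?normr0 ?mulr0 ?mul0r// in_itv/= s0.
  have lip := @derivative_bound (fun r => U r s x) (fun r => dU r s x)
    `]s, T]%classic s t (k * (`|C| + 1) * `|x|) st.
  rewrite -[X in _ - X](U1 s x); last by rewrite in_itv/= s0 (le_trans (ltW st) tT).
  rewrite -mulrA [(t - s) * _]mulrC mulrA; apply: lip.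
  + move=> r /andP[sr rt]; exists (Num.min (r - s) (t - r)).
      by rewrite lt_min !subr_gt0 sr.
    by move=> r'; rewrite lt_min !ltr_norml /= in_itv/=; lra.
  + move=> r /andP[sr rt]; have rT : r <= T by lra.
    by have [_ + _ _ _] := UdU s r s0 sr rT; apply.
  + apply/subspace_continuousP => r /=; rewrite in_itv/= => /andP[sr rt].
    have /subspace_continuousP/(_ (r, s)) := Uc x.
    have rS : 0 <= s <= r /\ r <= T by split; [rewrite s0|lra].
    move=> /(_ rS) h; apply/cvgrPdist_lt => e e0.
    have {h} := (@cvgrPdist_lt _ _ _ _ (within_filter _ (nbhs_filter (r, s))) _ _).1 h _ e0.
    rewrite /within/= => -[[P Q] /= [rP sQ] PQ].
    apply: filterS rP => r' Pr' /=; rewrite in_itv/= => /andP[sr' r't].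
    apply: (PQ (r', s)) => /=; first by split => //; exact: nbhs_singleton sQ.
    by split; [rewrite s0|lra].
  + move=> r /andP[sr rt]; have rT : r <= T by lra.
    have [_ _ + _ _] := UdU s r s0 sr rT => /(_ x) /eqP; rewrite addr_eq0 => /eqP ->.
    rewrite normrN (le_trans (Ak _ _ _))//; first by rewrite in_itv/=; lra.
    by rewrite -mulrA ler_wpM2l// UC// ltW.
Qed.

End everywhere_defined.
End evolution_operators.

(** * Paths and controls *)

Section max_min_distance.
Context {R : realFieldType}.
Implicit Types x y z : R.

Lemma max_dist x y z : `|Num.max x z - Num.max y z| <= `|x - y|.
Proof.
wlog xy : x y / x <= y.
  move=> h; have [|/ltW] := leP x y => xy; first exact: h.
  by rewrite distrC (distrC x); exact: h.
rewrite (distrC (Num.max x z)) (distrC x y) !ger0_norm ?subr_ge0//; last first.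
  by rewrite ge_max !le_max xy lexx orbT.
by have [] := leP x z; have [] := leP y z; lra.
Qed.

Lemma min_dist x y z : `|Num.min x z - Num.min y z| <= `|x - y|.
Proof.
have -> : Num.min x z = - Num.max (- x) (- z) by rewrite -oppr_min opprK.
have -> : Num.min y z = - Num.max (- y) (- z) by rewrite -oppr_min opprK.
by rewrite -opprD normrN; apply: le_trans (max_dist _ _ _) _; rewrite -opprD normrN.
Qed.

End max_min_distance.

Section differential_inclusion.
Context {R : realType} {E : completeNormedModType R}.
Notation mu := (@lebesgue_measure R).
Variables (T : R) (T0 : 0 < T) (x0 : E).
Variables (U : R -> R -> {linear E -> E}) (C a : R).
Hypothesis HU : evolution_bounds T U C a.
Variables (F : R -> E -> set E) (c eta : R -> R) (N : nat).

Local Notation I := (`[0, T]%classic : set R).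
Local Notation intg g := (mu.-integrable I (EFin \o g)).

Hypothesis F_closed_cvx : forall t x, 0 <= t <= T ->
  [/\ F t x !=set0, closed (F t x) & cvx (F t x)].
Hypothesis F_selection : forall x, exists2 f : R -> E, bmeas f &
  {ae mu, forall t : R, 0 <= t <= T -> F t x (f t)}.
Hypothesis F_uhc : {ae mu, forall t : R, 0 <= t <= T -> upper_hemicontinuous (F t)}.
Hypotheses (mc : measurable_fun setT c) (c_ge0 : forall t : R, 0 <= c t) (ic : intg c).
Hypothesis F_growth : {ae mu, forall t : R, 0 <= t <= T ->
  forall x y, F t x y -> `|y| <= c t * (1 + `|x|)}.
Hypotheses (eta_ge0 : forall t : R, 0 <= eta t) (ieta : intg eta).
(** (F5) in terms of nets; the null set depends on Omega, so that only countably many Omega can be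
    treated together. *)
Hypothesis F_fnet : forall (Omega : set E) (r : R), 0 <= r ->
  (forall e : R, r < e -> fnet e Omega) ->
  {ae mu, forall t : R, 0 <= t <= T ->
    forall e : R, eta t * r < e -> fnet e (\bigcup_(x in Omega) F t x)}.

Local Notation weight s := (2 ^+ cell T N s : R).

(* 8 leaves room for the two factors 2 of [fnet_seq] and [fnet_integrals] in
   [Bd_half]. *)
Hypothesis N_bielecki : forall t : R, 0 <= t <= T ->
  \int[mu]_(s in I) (\1_`[0, t]%classic s * (C * (c s + 8 * eta s) * weight s)) <=
  4^-1 * weight t.

Let mI := measurable_I T.
Let Ifin := finite_I T0.

Let C1 : 1 <= C. Proof. by have [[]] := HU. Qed.
Let C0 : 0 <= C. Proof. by have := C1; lra. Qed.
Let Cpos : 0 < C. Proof. by have := C1; lra. Qed.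
Let a0 : 0 <= a. Proof. by have [[]] := HU. Qed.
Let Uid s x : 0 <= s <= T -> U s s x = x. Proof. by have [_ + _ _ _] := HU; apply. Qed.
Let UU s r t x : 0 <= s -> s <= r -> r <= t -> t <= T -> U t r (U r s x) = U t s x.
Proof. by have [_ _ + _ _] := HU; apply. Qed.
Let UC s t x : 0 <= s -> s <= t -> t <= T -> `|U t s x| <= C * `|x|.
Proof. by have [_ _ _ + _] := HU; apply. Qed.
Let Ulip s t x : 0 <= s -> s <= t -> t <= T -> `|U t s x - x| <= a * (t - s) * `|x|.
Proof. by have [_ _ _ _ +] := HU; apply. Qed.

(** For r <= r' the difference is U(t, r') applied to U(r', r) x - x. *)
Lemma U_lipschitz r r' t x : 0 <= r <= t -> 0 <= r' <= t -> t <= T ->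
  `|U t r x - U t r' x| <= C * a * `|r - r'| * `|x|.
Proof.
wlog rr' : r r' / r <= r'.
  move=> h rt rt' tT; have [|/ltW] := leP r r' => ?; first exact: h.
  by rewrite distrC (distrC r); exact: h.
move=> /andP[r0 rt] /andP[r'0 r't] tT.
rewrite -(UU _ r0 rr' r't tT) -linearB.
apply: le_trans (UC _ r'0 r't tT) _; rewrite -!mulrA ler_wpM2l//.
rewrite (distrC r r') (@ger0_norm _ (r' - r)) ?subr_ge0// mulrA.
by apply: Ulip => //; exact: le_trans r't tT.
Qed.

Lemma weight_ge1 s : 1 <= weight s.
Proof. by rewrite exprn_ege1//; lra. Qed.

Let w0 s : 0 <= weight s. Proof. by have := weight_ge1 s; lra. Qed.

Lemma le_weight s t : s <= t -> weight s <= weight t.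
Proof. by move=> st; rewrite ler_weXn2l ?le_cell//; lra. Qed.

(** A number b with C |x0| + (1 + b) / 4 <= b, so that the a priori estimate in the weighted norm
    reproduces itself. *)
Definition path_bound : R := 2 * C * `|x0| + 1.

Let M1 : 1 <= path_bound. Proof. by rewrite /path_bound lerDr !mulr_ge0. Qed.

Let M0 : 0 <= path_bound. Proof. by have := M1; lra. Qed.

(* The integrable bound for the controls w = x' + A x of the solutions. *)
Definition control_bound s : R := c s * (1 + path_bound * weight s).

Lemma cM_ge0 s : 0 <= control_bound s.
Proof. by rewrite mulr_ge0// addr_ge0// mulr_ge0. Qed.

Lemma measurable_growth (B : R) : measurable_fun setT (fun s => c s * (1 + B * weight s)).
Proof.
apply: measurable_funM => //; apply: measurable_funD; first exact: measurable_cst.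
by apply: measurable_funM; [exact: measurable_cst|exact: measurable_cell].
Qed.

Lemma integrable_growth (B : R) : 0 <= B -> intg (fun s => c s * (1 + B * weight s)).
Proof.
move=> B0; apply: (intg_le mI _ _ (intgZ mI (1 + B * weight T) ic)).
  by apply: measurable_funTS; exact: measurable_growth.
move=> t /=; rewrite in_itv/= => /andP[_ tT].
rewrite ger0_norm; last by rewrite mulr_ge0// addr_ge0// mulr_ge0.
by rewrite mulrC ler_wpM2r// lerD2l ler_wpM2l ?le_weight.
Qed.

Lemma measurable_cM : measurable_fun setT control_bound.
Proof. exact: measurable_growth. Qed.

Lemma integrable_cM : intg control_bound.
Proof. exact: integrable_growth. Qed.

(** The extension by 0 lets all integrals run over the fixed interval I. *)
Definition kern t s v : E := if 0 <= s <= t then U t s v else 0.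

Lemma kern_norm t s v : t <= T -> `|kern t s v| <= C * (\1_`[0, t]%classic s * `|v|).
Proof.
move=> tT; rewrite /kern indicE; case: ifP => [/andP[s0 st]|h].
  by rewrite mem_set ?mul1r ?UC//= in_itv/= s0.
by rewrite normr0 memNset ?mul0r ?mulr0//= in_itv/= h.
Qed.

Lemma kern_le t s v : t <= T -> `|kern t s v| <= C * `|v|.
Proof.
move=> tT; apply: le_trans (kern_norm s v tT) _; rewrite ler_wpM2l// ler_piMl//.
Qed.

Lemma kern0 t s : kern t s 0 = 0.
Proof. by rewrite /kern linear0; case: ifP. Qed.

Lemma kernD t s u v : kern t s (u + v) = kern t s u + kern t s v.
Proof. by rewrite /kern linearD; case: ifP => //; rewrite addr0. Qed.

Lemma kernB t s u v : kern t s (u - v) = kern t s u - kern t s v.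
Proof. by rewrite /kern linearB; case: ifP => //; rewrite subr0. Qed.

Lemma kernZ t s (b : R) v : kern t s (b *: v) = b *: kern t s v.
Proof. by rewrite /kern linearZ; case: ifP => //; rewrite scaler0. Qed.

Lemma kern_U r t s v : r <= t -> t <= T ->
  U t r (kern r s v) = if s <= r then kern t s v else 0.
Proof.
move=> rt tT; rewrite /kern; have [s0|s0] := leP 0 s; last by rewrite /= linear0; case: ifP.
have [sr|rs] /= := leP s r; last by rewrite linear0.
by rewrite (le_trans sr rt) UU.
Qed.

Lemma bmeas_kern t w : 0 <= t <= T -> bmeas w -> bmeas (fun s => kern t s (w s)).
Proof.
move=> /andP[t0 tT]; apply: bmeas_kernel => [u|s].
  have ct : {within `[0, t], continuous (fun s => U t s u)}.
    apply/subspace_continuousP => s /=; rewrite in_itv/= => st.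
    apply/cvgrPdist_lt => e e0.
    have k0 : 0 < C * a * `|u| + 1 by rewrite ltr_pwDr// !mulr_ge0.
    exists (e / (C * a * `|u| + 1)); first by rewrite /= divr_gt0.
    move=> s' /= ss'; rewrite in_itv/= => s't.
    apply: le_lt_trans (U_lipschitz u st s't tT) _.
    move: ss'; rewrite ltr_pdivlMr// mulrDr mulr1.
    rewrite (_ : C * a * `|s - s'| * `|u| = `|s - s'| * (C * a * `|u|)); last by ring.
    by have := normr_ge0 (s - s'); lra.
  have := bmeas_continuous_itv ct; congr bmeas; apply/funext => s.
  rewrite /kern; have [h|h] := boolP (0 <= s <= t).
    by rewrite mem_set//= in_itv/= h.
  by rewrite memNset//= in_itv/=; exact/negP.
case: (boolP (0 <= s <= t)) => [/andP[s0 st]|h].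
  rewrite (_ : kern t s = U t s); last by apply/funext => v; rewrite /kern s0 st.
  by apply: (@bounded_linear_cts _ _ _ C) => v; exact: UC.
rewrite (_ : kern t s = fun=> 0); last by apply/funext => v; rewrite /kern (negPf h).
exact: cst_continuous.
Qed.

Definition kint t (w : R -> E) : E := xget 0 [set v | wint I (fun s => kern t s (w s)) v].

Lemma kintP t (w : R -> E) (b : R -> R) : 0 <= t <= T -> bmeas w ->
  (forall s, I s -> `|w s| <= b s) -> intg b ->
  wint I (fun s => kern t s (w s)) (kint t w).
Proof.
move=> tI mw wb ib; apply: (@xgetPex _ 0 [set v | wint I (fun s => kern t s (w s)) v]).
have [v [_ wv]] := @wint_bochner _ _ _ mI Ifin (fun s => kern t s (w s))
  (fun s => C * b s) (bmeas_kern tI mw)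
  (fun s Is => le_trans (kern_le s (w s) (andP tI).2) (ler_wpM2l C0 (wb s Is)))
  (intgZ mI C ib).
by exists v.
Qed.

Lemma kint_eq t w v : wint I (fun s => kern t s (w s)) v -> kint t w = v.
Proof. by move=> wv; apply: (wint_unique (xgetPex 0 (ex_intro _ v wv)) wv). Qed.

Lemma kint_le t (w : R -> E) (b : R -> R) : 0 <= t <= T -> bmeas w ->
  (forall s, I s -> `|w s| <= b s) -> intg b ->
  `|kint t w| <= \int[mu]_(s in I) (\1_`[0, t]%classic s * (C * b s)).
Proof.
move=> tI mw wb ib.
apply: (wint_norm mI (kintP tI mw wb ib) (bmeas_kern tI mw)) => [s Is|].
  apply: le_trans (kern_norm _ _ (andP tI).2) _; rewrite mulrCA ler_wpM2l//.
    by rewrite ler_wpM2l// wb.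
by apply: (intg_indic mI); [exact: measurable_itv|exact: intgZ].
Qed.

(** The bound is required everywhere rather than almost everywhere: controls are represented by
    suitable functions, and null sets appear only in the inclusions. *)
Definition admissible (w : R -> E) := bmeas w /\ forall s, `|w s| <= control_bound s.

Lemma kern_adm t w : 0 <= t <= T -> admissible w ->
  forall s, I s -> `|kern t s (w s)| <= C * control_bound s.
Proof.
move=> /andP[_ tT] [_ wc] s _; apply: le_trans (kern_le _ _ tT) _.
by rewrite ler_wpM2l.
Qed.

Definition Phi w t : E := U t 0 x0 + kint t w.

Lemma adm_kintP t w : 0 <= t <= T -> admissible w ->
  wint I (fun s => kern t s (w s)) (kint t w).
Proof. by move=> tI [mw wc]; exact: (kintP tI mw (fun s _ => wc s) integrable_cM). Qed.

Lemma Phi0 w : admissible w -> Phi w 0 = x0.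
Proof.
move=> [mw wc]; have z0 : 0 <= (0 : R) <= T by rewrite lexx ltW.
rewrite /Phi Uid//; suff -> : kint 0 w = 0 by rewrite addr0.
apply/eqP; rewrite -normr_le0; apply/ler_addgt0Pr => e e0; rewrite add0r.
have [d d0 dP] := Rintegral_itv_small T0 (fun s => mulr_ge0 C0 (cM_ge0 s))
  (intgZ mI C integrable_cM) e0.
apply: le_trans (kint_le z0 mw (fun s _ => wc s) integrable_cM) _.
by apply: (dP 0 0) => //; rewrite subrr.
Qed.

Definition restr (A : set R) (w : R -> E) s : E := if s \in A then w s else 0.

Lemma adm_restr A w : measurable A -> admissible w -> admissible (restr A w).
Proof.
move=> mA [mw wc]; split; first exact: bmeas_patch.
by move=> s; rewrite /restr; case: ifP => // _; rewrite normr0 cM_ge0.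
Qed.

Lemma U_kint r t w : 0 <= r -> r <= t -> t <= T -> admissible w ->
  U t r (kint r w) = kint t (restr `]-oo, r]%classic w).
Proof.
move=> r0 rt tT aw; have rI : 0 <= r <= T by rewrite r0 (le_trans rt).
apply/esym/kint_eq.
have cU : continuous (U t r) by apply: (@bounded_linear_cts _ _ _ C) => v; exact: UC.
apply: eq_wint (wint_linear cU (adm_kintP rI aw)) => s _.
rewrite kern_U// /restr; case: ifP => sr.
  by rewrite mem_set//= in_itv.
by rewrite memNset ?kern0//= in_itv/= sr.
Qed.

Lemma kintD t w1 w2 : 0 <= t <= T -> admissible w1 -> admissible w2 ->
  kint t (fun s => w1 s + w2 s) = kint t w1 + kint t w2.
Proof.
move=> tI a1 a2; apply: kint_eq.
apply: eq_wint (wintD mI (adm_kintP tI a1) (adm_kintP tI a2) (bmeas_kern tI a1.1)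
  (bmeas_kern tI a2.1) (kern_adm tI a1) (kern_adm tI a2) (intgZ mI C integrable_cM)
  (intgZ mI C integrable_cM)) => s _.
by rewrite kernD.
Qed.

Lemma Phi_split r t w : 0 <= r -> r <= t -> t <= T -> admissible w ->
  Phi w t = U t r (Phi w r) + kint t (restr `]r, +oo[%classic w).
Proof.
move=> r0 rt tT aw; have tI : 0 <= t <= T by rewrite tT (le_trans r0).
rewrite /Phi linearD UU// U_kint// -addrA -kintD//; last 2 first.
- by apply: adm_restr.
- by apply: adm_restr.
congr (_ + kint t _); apply/funext => s; rewrite /restr.
have [sr|rs] := leP s r.
  rewrite mem_set/=; last by rewrite in_itv.
  by rewrite memNset ?addr0//= in_itv/= andbT ltNge sr.
rewrite memNset/=; last by rewrite in_itv/= leNgt rs.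
by rewrite mem_set ?add0r//= in_itv/= andbT.
Qed.

Lemma integrable_weight (h : R -> R) : (forall s, 0 <= h s) -> intg h ->
  intg (fun s => h s * weight s).
Proof.
move=> h0 ih; apply: (intg_le mI _ _ (intgZ mI (weight T) ih)).
  apply: measurable_funM; first exact: (intg_measurable ih).
  by apply: measurable_funTS; exact: measurable_cell.
move=> s /=; rewrite in_itv/= => /andP[_ sT].
by rewrite ger0_norm ?mulr_ge0// [X in _ <= X]mulrC ler_wpM2l// le_weight.
Qed.

Lemma integrable_bielecki : intg (fun s => C * (c s + 8 * eta s) * weight s).
Proof.
apply: integrable_weight => [s|]; first by rewrite mulr_ge0// addr_ge0// mulr_ge0.
by apply: (intgZ mI); apply: (intgD mI ic); exact: (intgZ mI).
Qed.

(** As the weight is at least 1, 1 + B * weight is at most (1 + B) * weight, which brings the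
    integrand below a multiple of that of [N_bielecki]. *)
Lemma weighted_bound (B : R) t : 0 <= B -> 0 <= t <= T ->
  \int[mu]_(s in I) (\1_`[0, t]%classic s * (C * (c s * (1 + B * weight s)))) <=
  (1 + B) * 4^-1 * weight t.
Proof.
move=> B0 tI; rewrite -mulrA.
have i1 : intg (fun s => \1_`[0, t]%classic s * (C * (c s + 8 * eta s) * weight s)).
  by apply: (intg_indic mI); [exact: measurable_itv|exact: integrable_bielecki].
apply: le_trans (ler_wpM2l (addr_ge0 ler01 B0) (N_bielecki tI)).
rewrite -RintegralZl//; apply: le_Rintegral => //; last 2 first.
- exact: (intgZ mI).
- move=> s _; rewrite [X in _ <= X]mulrCA ler_wpM2l//.
  have -> : (1 + B) * (C * (c s + 8 * eta s) * weight s) =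
    C * ((1 + B) * weight s * (c s + 8 * eta s)) by ring.
  rewrite ler_wpM2l// mulrC; apply: ler_pM => //.
  + by rewrite addr_ge0// mulr_ge0.
  + by rewrite mulrDl mul1r lerD2r; exact: weight_ge1.
  + by rewrite lerDl mulr_ge0.
apply: (intg_indic mI); first exact: measurable_itv.
by apply: (intgZ mI); exact: integrable_growth.
Qed.

Lemma Phi_bound w t : 0 <= t <= T -> admissible w -> `|Phi w t| <= path_bound * weight t.
Proof.
move=> tI [mw wc]; have /andP[t0 tT] := tI.
have := kint_le tI mw (fun s _ => wc s) integrable_cM.
have := weighted_bound (le_trans ler01 M1) tI.
have := UC x0 (lexx 0) t0 tT.
have := ler_normD (U t 0 x0) (kint t w); rewrite -/(Phi w t).
have := weight_ge1 t; have x00 : 0 <= C * `|x0| by rewrite mulr_ge0.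
move=> w1 h1 h2 h3 h4; apply: le_trans h1 _.
have := ler_wpM2l x00 w1; rewrite /control_bound in h4 *; rewrite mulr1.
have := le_trans h4 h3; rewrite /path_bound; move: h2.
move: (kint t w) (U t 0 x0) => k u.
have -> : (1 + (2 * C * `|x0| + 1)) * 4^-1 * weight t =
  2^-1 * weight t + 2^-1 * (C * `|x0| * weight t) by field.
have -> : (2 * C * `|x0| + 1) * weight t = 2 * (C * `|x0| * weight t) + weight t by ring.
have : 0 <= C * `|x0| * weight t by rewrite mulr_ge0.
move: (C * `|x0| * weight t) (C * `|x0|) => P Q; lra.
Qed.

Definition modulus r t : R :=
  a * (path_bound * weight T) * (t - r) +
  \int[mu]_(s in I) (\1_`[r, t]%classic s * (C * control_bound s)).

Lemma modulus_small (e : R) : 0 < e -> exists2 d : R, 0 < d &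
  forall r t, r <= t -> t - r < d -> modulus r t <= e.
Proof.
move=> e0; have e2 : 0 < e / 2 by rewrite divr_gt0.
have [d d0 dP] := Rintegral_itv_small T0 (fun s => mulr_ge0 C0 (cM_ge0 s))
  (intgZ mI C integrable_cM) e2.
have k0 : 0 <= a * (path_bound * weight T) by rewrite !mulr_ge0.
exists (Num.min d (e / 2 / (a * (path_bound * weight T) + 1))).
  by rewrite lt_min d0/= divr_gt0// ltr_pwDr.
move=> r t rt; rewrite lt_min => /andP[h1 h2].
have := dP r t rt h1; rewrite /modulus.
move: h2; rewrite ltr_pdivlMr ?ltr_pwDr// mulrDr mulr1.
rewrite [X in _ -> _ -> X + _ <= _]mulrC.
move: (_ * (a * _)) (\int[mu]_(s in I) _) => P Q.
by move: rt; rewrite -subr_ge0; lra.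
Qed.

(** By [Phi_split] the increment consists of U(t, r) minus the identity, applied to a bounded point,
    and of an integral over ]r, t]. *)
Lemma Phi_modulus w r t : 0 <= r -> r <= t -> t <= T -> admissible w ->
  `|Phi w t - Phi w r| <= modulus r t.
Proof.
move=> r0 rt tT aw; have tI : 0 <= t <= T by rewrite tT (le_trans r0).
have rI : 0 <= r <= T by rewrite r0 (le_trans rt).
rewrite (Phi_split r0 rt tT aw) addrAC; apply: le_trans (ler_normD _ _) _.
apply: lerD.
  apply: le_trans (Ulip _ r0 rt tT) _.
  have -> : a * (path_bound * weight T) * (t - r) = a * (t - r) * (path_bound * weight T) by ring.
  rewrite ler_wpM2l ?mulr_ge0 ?subr_ge0//.
  apply: le_trans (Phi_bound rI aw) _; by rewrite ler_wpM2l ?le_weight ?(andP rI).2.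
have [mw wc] := adm_restr (measurable_itv `]r, +oo[) aw.
pose b s := \1_`[r, t]%classic s * control_bound s.
apply: (wint_norm mI (adm_kintP tI (conj mw wc)) (bmeas_kern tI mw)); last first.
  by apply: (intg_indic mI); [exact: measurable_itv|apply: (intgZ mI); exact: integrable_cM].
move=> s _; apply: le_trans (kern_norm _ _ tT) _.
rewrite [X in _ <= X]mulrCA ler_wpM2l//; rewrite /restr !indicE.
have [/set_mem/=|_] := boolP (s \in `]r, +oo[%classic); last first.
  by rewrite normr0 mulr0 mulr_ge0 ?cM_ge0.
rewrite in_itv/= andbT => rs.
have -> : (s \in `[0, t]%classic) = (s \in `[r, t]%classic).
  apply/idP/idP => /set_mem/=; rewrite in_itv/= => /andP[h1 h2]; apply/mem_set => /=;
    by rewrite in_itv/= h2 ?(ltW rs)//= (le_trans r0)// ltW.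
by rewrite ler_wpM2l//; case: aw.
Qed.

(** * The compact family containing the solutions *)

Definition uniformly_close (e : R) (x y : R -> E) :=
  forall t : R, 0 <= t <= T -> `|x t - y t| <= e.

(** Closure for uniform convergence on [0, T]; it also absorbs arbitrary changes of the functions
    outside [0, T]. *)
Definition ucl (X : set (R -> E)) : set (R -> E) :=
  [set y | forall e : R, 0 < e -> exists2 x, X x & uniformly_close e x y].

Lemma ucl_sub X : X `<=` ucl X.
Proof. by move=> x Xx e e0; exists x => // t _; rewrite subrr normr0 ltW. Qed.

Lemma uclS X Y : X `<=` Y -> ucl X `<=` ucl Y.
Proof. by move=> XY x h e /h[y Xy yx]; exists y => //; exact: XY. Qed.

Lemma uniformly_close_trans e1 e2 x y z : uniformly_close e1 x y ->
  uniformly_close e2 y z -> uniformly_close (e1 + e2) x z.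
Proof.
move=> h1 h2 t tI; rewrite -(subrKA (y t)); apply: le_trans (ler_normD _ _) _.
by rewrite lerD ?h1 ?h2.
Qed.

Lemma ucl_idem X : ucl (ucl X) `<=` ucl X.
Proof.
move=> z h e e0; have e2 : 0 < e / 2 by rewrite divr_gt0.
have [y Xy yz] := h _ e2; have [x Xx xy] := Xy _ e2; exists x => //.
by rewrite [e]splitr; exact: uniformly_close_trans xy yz.
Qed.

Definition X0 (x : R -> E) :=
  (forall t : R, 0 <= t <= T -> `|x t| <= path_bound * weight t) /\
  (forall r t, 0 <= r -> r <= t -> t <= T -> `|x t - x r| <= modulus r t).

Lemma ucl_X0 : ucl X0 `<=` X0.
Proof.
move=> y h; split=> [t tI|r t r0 rt tT].
  apply/ler_addgt0Pr => e e0; have [x [xb _] xy] := h _ e0.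
  have := xb t tI; have := xy t tI; have := ler_normB (x t) (x t - y t).
  by rewrite subKr; lra.
have tI : 0 <= t <= T by rewrite tT (le_trans r0).
have rI : 0 <= r <= T by rewrite r0 (le_trans rt).
apply/ler_addgt0Pr => e e0; have e2 : 0 < e / 2 by rewrite divr_gt0.
have [x [_ xm] xy] := h _ e2.
have := xm r t r0 rt tT; have := xy t tI; have := xy r rI.
rewrite (_ : y t - y r = (x t - x r) - (x t - y t) + (x r - y r)); last first.
  by rewrite opprB (addrC (x t - x r)) !subrKA.
have := ler_normD (x t - x r - (x t - y t)) (x r - y r).
by have := ler_normB (x t - x r) (x t - y t); lra.
Qed.

Lemma Phi_X0 w : admissible w -> X0 (Phi w).
Proof.
by move=> aw; split=> [t tI|r t r0 rt tT]; [exact: Phi_bound|exact: Phi_modulus].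
Qed.

(* 0 is included so that controls may be extended by 0. *)
Definition Fh s (X : set (R -> E)) : set E :=
  clco ([set 0] `|` \bigcup_(x in X) F s (x s)).

Lemma FhS s X Y : X `<=` Y -> Fh s X `<=` Fh s Y.
Proof. by move=> XY; apply: clcoS; apply: setUS; apply: bigcup_subset. Qed.

Definition Nsel X : set (R -> E) :=
  [set w | admissible w /\ {ae mu, forall s : R, 0 <= s <= T -> Fh s X (w s)}].

Lemma NselS X Y : X `<=` Y -> Nsel X `<=` Nsel Y.
Proof.
move=> XY w [aw h]; split => //; apply: (ae_imp h) => s hs sI.
by apply: (FhS XY); exact: hs.
Qed.

(* Mild solutions, up to the values of [x] outside of [0, T] and those of the
   control [w] on a null set. *)
Definition solutions : set (R -> E) := [set x | exists w, [/\ admissible w,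
  {ae mu, forall s : R, 0 <= s <= T -> F s (x s) (w s)} &
  forall t : R, 0 <= t <= T -> x t = Phi w t]].

Definition invariant X := [/\ X `<=` X0, ucl X `<=` X, solutions `<=` X & Phi @` Nsel X `<=` X].

(* The least invariant family is the closure of its image under Phi (K_sub);
   this fixed point property makes its sections totally bounded (Bd_half). *)
Definition K : set (R -> E) := [set x | forall X, invariant X -> X x].

Lemma inv_X0 : invariant X0.
Proof.
split=> //; first exact: ucl_X0.
  move=> x [w [aw _ xw]]; have [h1 h2] := Phi_X0 aw; split=> [t tI|r t r0 rt tT].
    by rewrite xw// h1.
  by rewrite !xw ?h2//= ?tT ?r0/= ?(le_trans r0)// (le_trans rt).
by move=> _ [w [aw _] <-]; exact: Phi_X0.
Qed.

Lemma inv_K : invariant K.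
Proof.
split.
- by move=> x; apply; exact: inv_X0.
- move=> x Kx X iX; have [_ + _ _] := iX; apply.
  by apply: uclS Kx => y; exact.
- by move=> x Sx X [_ _ + _]; exact.
- move=> _ [w Kw <-] X iX; have [_ _ _ +] := iX; apply; exists w => //.
  by apply: NselS Kw => y; exact.
Qed.

(** The right-hand side lies in K and, by monotonicity of [Nsel], is itself invariant; hence it
    contains the least invariant family. *)
Lemma K_sub : K `<=` ucl (Phi @` Nsel K).
Proof.
have [KX0 Kcl KS KN] := inv_K.
have sub : ucl (Phi @` Nsel K) `<=` K by apply: subset_trans Kcl; exact: uclS.
move=> x; apply; split.
- exact: subset_trans sub KX0.
- exact: ucl_idem.
- move=> y Sy; have [w [aw wF yw]] := Sy => e e0; exists (Phi w).
    exists w => //; split => //; apply: (ae_imp wF) => s wFs sI.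
    apply: sub_clco; right; exists y; first exact: KS.
    exact: wFs.
  by move=> t tI; rewrite yw// subrr normr0 ltW.
- by apply: subset_trans (@ucl_sub _); apply: image_subset; exact: NselS.
Qed.

Lemma K_X0 : K `<=` X0. Proof. by have [] := inv_K. Qed.

Lemma ucl_K : ucl K `<=` K. Proof. by have [] := inv_K. Qed.

Lemma Sol_K : solutions `<=` K. Proof. by have [] := inv_K. Qed.

Lemma Phi_K w : Nsel K w -> K (Phi w).
Proof. by move=> Kw; have [_ _ _] := inv_K; apply; exists w. Qed.

Lemma modulus_ge0 r t : 0 <= r -> r <= t -> t <= T -> 0 <= modulus r t.
Proof.
move=> r0 rt tT; apply: le_trans (normr_ge0 _) (Phi_modulus (w := fun=> 0) r0 rt tT _).
by split=> [|s]; [exact: bmeas_cst|rewrite normr0 cM_ge0].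
Qed.

Lemma X0_close (e : R) : 0 < e -> exists2 d : R, 0 < d &
  forall x r t, X0 x -> 0 <= r <= T -> 0 <= t <= T -> `|t - r| < d -> `|x t - x r| <= e.
Proof.
move=> /modulus_small[d d0 dP]; exists d => // x r t [_ xm].
wlog rt : r t / r <= t.
  move=> h; have [|/ltW] := leP r t => rt rI tI; first exact: h.
  by rewrite distrC (distrC (x t)); exact: h.
move=> /andP[r0 rT] /andP[t0 tT]; rewrite ger0_norm ?subr_ge0// => td.
by apply: le_trans (xm r t r0 rt tT) _; exact: dP.
Qed.

(** The measure of noncompactness of each section of K is at most g in the weighted norm. *)
Definition Bd (g : R) := forall t r, 0 <= t <= T -> g * weight t < r ->
  fnet r [set x t | x in K].

Lemma Bd_M : Bd path_bound.
Proof.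
move=> t r tI r0; exists [:: 0] => _ [x Kx <-]; exists 0; first exact: mem_head.
by rewrite subr0; apply: le_lt_trans r0; have [+ _] := K_X0 Kx; apply.
Qed.

(** (F5) is applied to the countably many sets [Om k i j]. Each collects the values of K over one
    short time cell and is, by equicontinuity, within 1 / (k + 1) of a single section; so almost
    every s satisfies all the resulting bounds. *)
Lemma Fh_fnet g : 0 <= g -> Bd g ->
  {ae mu, forall s : R, 0 <= s <= T -> forall e : R, eta s * (g * weight s) < e -> fnet e (Fh s K)}.
Proof.
move=> g0 Bg.
have dk k : exists p : nat, forall x r t, X0 x -> 0 <= r <= T -> 0 <= t <= T ->
    `|t - r| < T / p.+1%:R -> `|x t - x r| <= k.+1%:R^-1.
  have [d d0 dP] := X0_close (ltac:(by rewrite invr_gt0) : 0 < k.+1%:R^-1 :> R).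
  have [p pd] := small_cells T0 d0; exists p => x r t x0' rI tI trp.
  by apply: dP => //; exact: lt_trans pd.
have [d dP] := choice dk.
(* The index i fixes the value 2^i of the weight, j a cell on which the paths oscillate by at most 1
   / (k + 1). *)
pose Om k i j : set E := [set z | exists x s,
  [/\ K x, 0 <= s <= T, cell T N s = i, cell T (d k) s = j & z = x s]].
pose rk k i : R := g * 2 ^+ i + k.+1%:R^-1.
have rk0 k i : 0 <= rk k i by rewrite addr_ge0 ?mulr_ge0// invr_ge0.
have Om_fnet k i j e : rk k i < e -> fnet e (Om k i j).
  move=> re; have [[s0 [s0I s0i s0j]]|no] := pselect (exists s0,
      [/\ 0 <= s0 <= T, cell T N s0 = i & cell T (d k) s0 = j]); last first.
    by exists [::] => z [x [s [Kx sI si sj _]]]; case: no; exists s.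
  have -> : e = (e - k.+1%:R^-1) + k.+1%:R^-1 by rewrite subrK.
  apply: fnet_shift (Bg s0 _ s0I _); last by rewrite s0i ltrBrDr.
  move=> z [x [s [Kx sI si sj ->]]]; exists (x s0); first by exists x.
  apply: (dP k) => //; first exact: K_X0.
  have /andP[s00 _] := s0I; have /andP[s00' _] := sI.
  by apply: cell_dist => //; rewrite sj.
have h k : {ae mu, forall s : R, forall i j, 0 <= s <= T -> forall e : R, eta s * rk k i < e ->
    fnet e (\bigcup_(x in Om k i j) F s x)}.
  apply: (ae_forall (P := fun i s => forall j, _)) => i.
  apply: (ae_forall (P := fun j s => _)) => j.
  by apply: F_fnet => // e; exact: Om_fnet.
apply: (ae_imp (ae_forall h)) => s {}h sI e.
move=> es; have es0 : 0 < e by apply: le_lt_trans es; rewrite !mulr_ge0.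
(* Half of the gap between e and the claimed bound absorbs eta / (k + 1), the other half is spent on
   the closed convex hull. *)
have [k kP] : exists k : nat, eta s * rk k (cell T N s) < (e + eta s * (g * weight s)) / 2.
  pose q := (e - eta s * (g * weight s)) / 2 / (eta s + 1).
  have q0 : 0 < q by rewrite !divr_gt0 ?subr_gt0// ltr_pwDr.
  have [k kq] := small_cells (ltr01 : 0 < 1 :> R) q0; exists k; rewrite /rk mulrDr -ltrBrDl.
  have p1 : 0 < eta s + 1 by rewrite ltr_pwDr.
  move: kq; rewrite mul1r /q (ltr_pdivlMr _ _ p1) mulrDr mulr1 (mulrC (eta s) (_^-1)).
  have : 0 < k.+1%:R^-1 :> R by rewrite invr_gt0.
  move: (k.+1%:R^-1) => p p0.
  by move: (p * eta s) (eta s * _) => P Q; lra.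
have e2 : 0 < (e - eta s * (g * weight s)) / 2 by rewrite divr_gt0// subr_gt0.
have -> : e = (e + eta s * (g * weight s)) / 2 + (e - eta s * (g * weight s)) / 2 by field.
apply: fnet_clco => //; apply: fnetU.
  by apply: fnet1; rewrite divr_gt0// ltr_pwDl// !mulr_ge0.
apply: fnetS (h k (cell T N s) (cell T (d k) s) sI _ kP).
by move=> z [x Kx Fz]; exists (x s) => //; exists x, s.
Qed.

Lemma kern_fnet g w t : 0 <= g -> Bd g -> 0 <= t <= T -> (forall n, Nsel K (w n)) ->
  {ae mu, forall s : R, 0 <= s <= T ->
    forall e, \1_`[0, t]%classic s * (C * (eta s * (g * weight s))) < e ->
    fnet e [set kern t s (w n s) | n in [set: nat]]}.
Proof.
move=> g0 Bg tI Kw.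
have hw := ae_forall (P := fun n s => 0 <= s <= T -> Fh s K (w n s)) (fun n => (Kw n).2).
apply: (ae_imp (ae_and hw (Fh_fnet g0 Bg))) => s [{}hw Fn] sI e.
have C0' : 0 < C by have := C1; lra.
rewrite indicE; have [h|h] := boolP (0 <= s <= t); last first.
  rewrite memNset ?mul0r => [e0|]; last by rewrite /= in_itv/=; exact/negP.
  exists [:: 0] => _ [n _ <-]; exists 0; first exact: mem_head.
  by rewrite /kern (negPf h) subr0 normr0.
rewrite mem_set ?mul1r/= ?in_itv// => he; have -> : e = C * (e / C).
  by rewrite mulrCA divff ?mulr1// gt_eqF.
have /andP[s0 st] := h; have /andP[_ tT] := tI.
apply: fnetS (fnet_image C0' (fun x => UC x s0 st tT) (Fn sI (e / C) _)).
  by move=> _ [n _ <-]; rewrite /kern h; exists (w n s) => //; exact: hw.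
by rewrite ltr_pdivlMr// mulrC.
Qed.

(** With G = g * weight t, half of G splits into G / 4 for the approximation of K by [Phi] and G / 4
    for a net of the image. The latter is twice the radius G / 8 needed for sequences, and
    [fnet_integrals] provides that radius because twice the integral of h is at most G / 16. *)
Lemma Bd_half g : 0 < g -> Bd g -> Bd (g / 2).
Proof.
move=> g0 Bg t r tI gr.
have gw : 0 < g * weight t by rewrite mulr_gt0// (lt_le_trans ltr01 (weight_ge1 _)).
have -> : r = (r - g * weight t / 4) + g * weight t / 4 by rewrite subrK.
suff Pn : fnet (g * weight t / 4) [set Phi w t | w in Nsel K].
  apply: fnet_shift (fnet_le _ Pn); last by lra.
  move=> _ [x Kx <-]; have e0 : 0 < g * weight t / 4 by rewrite divr_gt0.
  have [_ [w Kw <-] wx] := K_sub Kx e0; exists (Phi w t); first by exists w.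
  by rewrite distrC; exact: wx.
have -> : g * weight t / 4 = g * weight t / 8 + g * weight t / 8 by field.
apply: fnet_seq => z zP.
have [w wP] := @choice _ _ (fun n w => Nsel K w /\ Phi w t = z n)
  (fun n => let: ex_intro2 w h1 h2 := zP n in ex_intro _ w (conj h1 h2)).
have Kw n : Nsel K (w n) by case: (wP n).
suff [s sP] : fnet (g * weight t / 8) (range (fun n => kint t (w n))).
  exists [seq U t 0 x0 + y | y <- s] => _ [n _ <-].
  have [y ys yn] := sP _ (imageT (fun n => kint t (w n)) n).
  exists (U t 0 x0 + y); first exact: map_f.
  by case: (wP n) => _ <-; rewrite /Phi opprD addrACA subrr add0r.
pose h s := \1_`[0, t]%classic s * (C * (eta s * (g * weight s))).
have iw := integrable_weight eta_ge0 ieta.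
have ih : intg h.
  apply: (intg_indic mI); first exact: measurable_itv.
  rewrite (_ : (fun _ => _) = (fun s => C * g * (eta s * weight s))); first exact: (intgZ mI).
  by apply/funext => s; ring.
apply: (@fnet_integrals _ _ _ mI Ifin (fun n s => kern t s (w n s)) _
  (fun s => C * control_bound s) h).
- by move=> n; apply: bmeas_kern => //; case: (Kw n) => -[].
- move=> n s; apply: le_trans (kern_le _ _ (andP tI).2) _; rewrite ler_wpM2l//.
  by case: (Kw n) => -[].
- by apply: (intgZ mI); exact: integrable_cM.
- exact: ih.
- by move=> s _; rewrite /h mulr_ge0// !mulr_ge0// ltW.
- apply: (ae_imp (kern_fnet (ltW g0) Bg tI Kw)) => s h' /= sI e he.
  by apply: h' => //; move: sI; rewrite in_itv.
- by move=> n; apply: adm_kintP => //; case: (Kw n).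
have : \int[mu]_(s in I) h s <= g / 8 * (4^-1 * weight t).
  apply: le_trans (ler_wpM2l _ (N_bielecki tI)); last by rewrite divr_ge0// ltW.
  have i2 : intg (fun s => \1_`[0, t]%classic s * (C * (c s + 8 * eta s) * weight s)).
    by apply: (intg_indic mI); [exact: measurable_itv|exact: integrable_bielecki].
  rewrite -RintegralZl//; apply: le_Rintegral => //; first exact: (intgZ mI).
  move=> s _; rewrite /h [X in _ <= X]mulrCA ler_wpM2l//.
  have -> : g / 8 * (C * (c s + 8 * eta s) * weight s) =
    C * (eta s * (g * weight s)) + g / 8 * C * c s * weight s by field.
  by rewrite lerDl !mulr_ge0// ltW.
have -> : g / 8 * (4^-1 * weight t) = g * weight t / 32 by field.
by move: gw; lra.
Qed.

Lemma Bd_0 : Bd 0.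
Proof.
have Mpos : 0 < path_bound by have := M1; lra.
have Bk k : Bd (path_bound / 2 ^+ k).
  elim: k => [|k IH]; first by rewrite expr0 divr1; exact: Bd_M.
  rewrite exprS invfM mulrCA mulrC; apply: Bd_half => //.
  by rewrite divr_gt0// exprn_gt0.
move=> t r tI; rewrite mul0r => r0.
have wt : 0 < weight t by rewrite exprn_gt0.
have [k kP] : exists k : nat, path_bound * weight t / r < 2 ^+ k.
  have [k kr] := small_cells (mulr_gt0 Mpos wt) r0; exists k.
  rewrite ltr_pdivrMr//; move: kr; rewrite ltr_pdivrMr// => /lt_le_trans; apply.
  by rewrite mulrC ler_wpM2r ?(ltW r0)// -natrX ler_nat ltn_expl.
apply: (Bk k) => //; rewrite mulrAC ltr_pdivrMr ?exprn_gt0//.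
by rewrite [ltRHS]mulrC -ltr_pdivrMr.
Qed.

Lemma Fh_tb : {ae mu, forall s : R, 0 <= s <= T -> forall e : R, 0 < e -> fnet e (Fh s K)}.
Proof.
apply: (ae_imp (Fh_fnet (lexx 0) Bd_0)) => s h sI e e0.
by apply: h => //; rewrite mul0r mulr0.
Qed.

(** The Arzela-Ascoli argument: nets of the sections at finitely many times, and equicontinuity in
    between. The centres are taken in K because selections of F along them are needed. *)
Lemma K_net (e : R) : 0 < e -> exists m (y : 'I_m -> R -> E), (forall i, K (y i)) /\
  forall x, K x -> exists i, uniformly_close e x (y i).
Proof.
move=> e0; have e8 : 0 < e / 8 by rewrite divr_gt0.
have [d d0 dP] := X0_close e8; have [p pd] := small_cells T0 d0.
pose grid := [seq s <- [seq node T p j | j <- iota 0 p.+2] | 0 <= s <= T].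
have gridP t : 0 <= t <= T -> exists2 s, s \in grid & `|t - s| < d.
  move=> /(node_cell T0 p)[jp nI _ tn]; exists (node T p (cell T p t)).
    rewrite mem_filter nI andTb; apply/mapP; exists (cell T p t) => //.
    by rewrite mem_iota add0n.
  exact: lt_trans pd.
have part (ts : seq R) : all (fun s => 0 <= s <= T) ts -> exists zs : seq (R -> E),
    forall x, K x -> exists2 z, z \in zs & forall s, s \in ts -> `|x s - z s| <= e / 8.
  elim: ts => [_|t ts IH /= /andP[tI /IH[zs zsP]]].
    by exists [:: fun=> 0] => x Kx; exists (fun=> 0); rewrite ?mem_head.
  have [s sP] := Bd_0 tI (ltac:(by rewrite mul0r) : 0 * weight t < e / 8).
  exists [seq (fun r => if r == t then v else z r) | v <- s, z <- zs] => x Kx.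
  have [z zz xz] := zsP x Kx.
  have [v vs xv] := sP (x t) (ex_intro2 _ _ x Kx erefl).
  exists (fun r => if r == t then v else z r); first exact: allpairs_f.
  move=> r; case: eqVneq => [-> _|rt]; first exact: ltW.
  by rewrite in_cons (negPf rt)/=; exact: xz.
have [zs zsP] := part grid (filter_all _ _).
pose good z x := K x /\ forall s, s \in grid -> `|x s - z s| <= e / 8.
(* Each pattern on the grid that some path of K matches is replaced by such a path; the other
   patterns are discarded below. *)
have [f fP] := @choice _ _ (fun z x => (exists x', good z x') -> good z x)
  (fun z => match pselect (exists x', good z x') with
    | left h => let: ex_intro x hx := h in ex_intro _ x (fun=> hx)
    | right h => ex_intro _ (fun=> 0) (fun h' => False_ind _ (h h')) end).
pose ys := [seq z <- zs | `[< exists x', good z x' >]].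
exists (size ys), (fun i => f (nth (fun=> 0) ys i)).
have gP i : (i < size ys)%N -> good (nth (fun=> 0) ys i) (f (nth (fun=> 0) ys i)).
  by move=> /(mem_nth (fun=> 0)); rewrite mem_filter => /andP[/asboolP/fP].
split=> [i|x Kx]; first by have [] := gP i (ltn_ord i).
have [z zz xz] := zsP x Kx.
have zys : z \in ys by rewrite mem_filter zz andbT; apply/asboolP; exists x.
have iz : (index z ys < size ys)%N by rewrite index_mem.
exists (Ordinal iz) => t tI /=; rewrite nth_index//.
have [Kf fz] := fP z (ex_intro _ x (conj Kx xz)).
have [s sg ts] := gridP t tI.
have sI : 0 <= s <= T by move: sg; rewrite mem_filter => /andP[].
have h1 := dP x s t (K_X0 Kx) sI tI ts; have h2 := dP _ s t (K_X0 Kf) sI tI ts.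
have h3 := xz s sg; have h4 := fz s sg.
have -> : x t - f z t = (x t - x s) + (x s - z s) - (f z s - z s) - (f z t - f z s).
  by rewrite !opprB !subrKA.
have := ler_normB (x t - x s + (x s - z s) - (f z s - z s)) (f z t - f z s).
have := ler_normB (x t - x s + (x s - z s)) (f z s - z s).
have := ler_normD (x t - x s) (x s - z s); move: e0 h1 h2 h3 h4; lra.
Qed.

(** * Passing to the limit in the inclusion *)

Definition Fball s z (rho : R) : set E :=
  clco (\bigcup_(y in [set y | `|y - z| <= rho]) F s y).

(* If [v] were outside of [F s z], a functional separating them would still
   separate [v] from [F s y] for [y] close to [z]. *)
Lemma Fball_limit s z v : 0 <= s <= T -> upper_hemicontinuous (F s) ->
  (forall rho : R, 0 < rho -> Fball s z rho v) -> F s z v.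
Proof.
move=> sI uhc Fv; apply: contrapT => nFv; have [F0 Fcl Fcvx] := F_closed_cvx z sI.
have : nbhs v (~` F s z) by apply: open_nbhs_nbhs; split => //; exact: closed_openC.
move=> /nbhs_ballP[r /= r0 rv].
have rb b : F s z b -> r <= `|v - b|.
  by move=> Fb; rewrite leNgt; apply/negP => vb; apply: (rv b) Fb; rewrite -ball_normE.
have [f [f1 fb]] := convex_separation Fcvx F0 (ltW r0) rb.
have cf : continuous f := contractive_cts f1.
have sup_lt : (ereal_sup [set (f y : R)%:E | y in F s z] < (f v - r / 2 : R)%:E)%E.
  apply: (@le_lt_trans _ _ (f v - r : R)%:E); last by rewrite lte_fin; lra.
  by apply: ge_ereal_sup => _ [b Fb <-]; rewrite lee_fin lerBrDr fb.
have /nbhs_ballP[d /= d0 dz] := uhc f cf z (f v - r / 2) sup_lt.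
have [Ccl Ccvx] := closed_ge_functional (f v - r / 2) cf.
have d2 : 0 < d / 2 by rewrite divr_gt0.
suff h : Fball s z (d / 2) `<=` [set x | (f x : R) <= f v - r / 2].
  by have := h v (Fv _ d2); rewrite /= lerBrDr gerDl leNgt divr_gt0.
apply: clco_min => // b [y /= yz Fb].
have zy : ball z d y by rewrite -ball_normE/= distrC; apply: le_lt_trans yz _; lra.
rewrite -lee_fin; apply: le_trans (ltW (dz y zy)).
by apply: ereal_sup_ubound; exists b.
Qed.

Lemma adm_sum n (b : 'I_n -> R) (w : 'I_n -> R -> E) : (forall i, 0 <= b i) ->
  \sum_i b i <= 1 -> (forall i, admissible (w i)) -> admissible (fun s => \sum_i b i *: w i s).
Proof.
move=> b0 b1 aw; split=> [|s].
  apply: (@bmeas_sum _ _ n (fun i s => b i *: w i s)) => i.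
  apply: bmeas_scale; last by case: (aw i).
  exact: measurable_cst.
apply: le_trans (ler_norm_sum _ _ _) _.
apply: (@le_trans _ _ (\sum_i b i * control_bound s)); last first.
  by rewrite -mulr_suml ler_piMl ?cM_ge0.
by apply: ler_sum => i _; rewrite normrZ ger0_norm// ler_wpM2l//; case: (aw i).
Qed.

Lemma adm_mid f g : admissible f -> admissible g -> admissible (fun s => 2^-1 *: (f s + g s)).
Proof.
move=> [mf fc] [mg gc]; split=> [|s].
  apply: bmeas_scale; last exact: bmeasD.
  exact: measurable_cst.
rewrite normrZ ger0_norm ?invr_ge0//.
have := ler_normD (f s) (g s); have := fc s; have := gc s; lra.
Qed.

Let half (p : E) : 2^-1 *: (p + p) = p.
Proof. by rewrite -mulr2n -[p *+ 2]scaler_nat scalerA mulVf ?scale1r// pnatr_eq0. Qed.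

Lemma Phi_mid f g t : 0 <= t <= T -> admissible f -> admissible g ->
  Phi (fun s => 2^-1 *: (f s + g s)) t = 2^-1 *: (Phi f t + Phi g t).
Proof.
move=> tI af ag; rewrite /Phi (_ : kint t _ = 2^-1 *: (kint t f + kint t g)).
  by rewrite addrACA [RHS]scalerDr half.
apply: kint_eq.
apply: eq_wint (wintZ 2^-1 (wintD mI (adm_kintP tI af) (adm_kintP tI ag) (bmeas_kern tI af.1)
  (bmeas_kern tI ag.1) (kern_adm tI af) (kern_adm tI ag) (intgZ mI C integrable_cM)
  (intgZ mI C integrable_cM))) => s _.
by rewrite kernZ kernD.
Qed.

Lemma kint_cvg t (g : nat -> R -> E) u : 0 <= t <= T -> (forall n, admissible (g n)) -> admissible u ->
  {ae mu, forall s : R, I s -> g n s @[n --> \oo] --> u s} ->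
  kint t (g n) @[n --> \oo] --> kint t u.
Proof.
move=> tI ag au gu.
have mgu n : measurable_fun setT (fun s => `|g n s - u s|).
  by apply: bmeas_norm; apply: bmeasB; [case: (ag n)|case: au].
have gb n s : `|g n s - u s| <= 2 * control_bound s.
  have [_ h1] := ag n; have [_ h2] := au.
  by have := ler_normB (g n s) (u s); have := h1 s; have := h2 s; lra.
have i2 : intg (fun s => C * (2 * control_bound s)).
  by apply: (intgZ mI); apply: (intgZ mI); exact: integrable_cM.
have mC n : measurable_fun I (fun s => C * `|g n s - u s|).
  by apply: measurable_funTS; apply: measurable_funM; [exact: measurable_cst|exact: mgu].
have Cb n s : I s -> `|C * `|g n s - u s| | <= C * (2 * control_bound s).
  by move=> _; rewrite ger0_norm ?mulr_ge0// ler_wpM2l.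
have int0 : \int[mu]_(s in I) (C * `|g n s - u s|) @[n --> \oo] --> 0.
  apply: (Rintegral_dominated mI mC _ Cb i2).
  apply: (ae_imp gu) => s gus Is; rewrite -(mulr0 C).
  apply: cvgM; first exact: cvg_cst.
  rewrite -(normr0 E) -(subrr (u s)); apply: cvg_norm; apply: cvgB; first exact: gus.
  exact: cvg_cst.
apply/cvgrPdist_le => e e0; move/cvgrPdist_le: int0 => /(_ e e0).
apply: filterS => n; rewrite sub0r normrN => h; rewrite distrC.
apply: le_trans (le_trans (ler_norm _) h).
have ik := intgZ mI C integrable_cM.
apply: (wint_norm mI (wintB mI (adm_kintP tI (ag n)) (adm_kintP tI au)
  (bmeas_kern tI (ag n).1) (bmeas_kern tI au.1) (kern_adm tI (ag n)) (kern_adm tI au) ik ik)).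
- by apply: bmeasB; apply: bmeas_kern => //; [case: (ag n)|case: au].
- by move=> s _; rewrite -kernB; exact: (kern_le _ _ (andP tI).2).
- by apply: (intg_le mI (mC n) _ i2) => s Is; exact: Cb.
Qed.

(** Averages of tails converge almost everywhere to u. They stay in the closed convex sets [Fball],
    which gives the inclusion, and [Phi] respects midpoints, so the averages have the same limit
    under [Phi] as the sequence itself. *)
Lemma Phi_closure (w : nat -> R -> E) (x : R -> E) : (forall n, admissible (w n)) ->
  {ae mu, forall s : R, 0 <= s <= T -> forall e : R, 0 < e -> fnet e (range (w^~ s))} ->
  {ae mu, forall s : R, 0 <= s <= T -> forall rho : R, 0 < rho ->
    exists n0, forall n, (n0 <= n)%N -> Fball s (x s) rho (w n s)} ->
  exists u, [/\ admissible u, {ae mu, forall s : R, 0 <= s <= T -> F s (x s) (u s)} &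
    forall t y, 0 <= t <= T -> Phi (w n) t @[n --> \oo] --> y -> Phi u t = y].
Proof.
move=> aw wtb wF.
have [g [u [gw mu_ uc gu]]] := @mazur_ae _ _ _ mI Ifin w control_bound (fun n => (aw n).1)
  measurable_cM (fun n => (aw n).2)
  (ae_imp wtb (fun s h (sI : I s) => h (ltac:(by move: sI; rewrite /= in_itv) : 0 <= s <= T))).
have au : admissible u by [].
have ag i : admissible (g i).
  apply: gw => [f1 f2|_ [k _ <-]]; [exact: adm_mid|exact: aw].
exists u; split => //.
  apply: (ae_imp (ae_and gu (ae_and wF F_uhc))) => s [gus [ws uhc]] sI.
  have Is : I s by rewrite /= in_itv.
  apply: (Fball_limit sI (uhc sI)) => rho rho0; have [n0 n0P] := ws sI rho rho0.
  apply: (closed_cvg _ (@closed_clco _ _ _) _ _ (gus Is)); exists n0 => // i /= ni.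
  apply: (midhull_cvx (gw i) (@cvx_clco _ _ _)) => _ [k /= ik <-].
  by apply: n0P; exact: leq_trans ik.
move=> t y tI wy.
have gk : kint t (g n) @[n --> \oo] --> kint t u := kint_cvg tI ag au gu.
have gP : Phi (g n) t @[n --> \oo] --> Phi u t.
  by apply: cvgD gk; exact: cvg_cst.
suff gy : Phi (g n) t @[n --> \oo] --> y by exact: (cvg_unique _ gP gy).
apply/cvgrPdist_le => e e0; move/cvgrPdist_le: wy => /(_ e e0)[n0 _ n0P].
exists n0 => // i /= ni.
(* The controls f with [Phi f t] within e of y are closed under midpoints and contain a tail of w,
   hence the averages of that tail. *)
suff [] : [set f | admissible f /\ `|y - Phi f t| <= e] (g i) by [].
apply: gw => [f1 f2 [a1 h1] [a2 h2]|_ [k /= ik <-]]; last first.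
  by split; [exact: aw|exact: (n0P k (leq_trans ni ik))].
split; first exact: adm_mid.
rewrite Phi_mid// (_ : y - _ = 2^-1 *: ((y - Phi f1 t) + (y - Phi f2 t))); last first.
  by rewrite [in RHS]addrACA -opprD scalerBr half.
rewrite normrZ ger0_norm ?invr_ge0//.
by have := ler_normD (y - Phi f1 t) (y - Phi f2 t); lra.
Qed.

Lemma bmeas_trunc (v : R -> E) (b : R -> R) : bmeas v -> measurable_fun setT b ->
  bmeas (fun s => if `|v s| <= b s then v s else 0).
Proof.
move=> mv mb; pose A := [set s | `|v s| <= b s].
have mA : measurable A.
  have := measurable_funB mb (bmeas_norm mv).
  move=> /(_ measurableT _ (measurable_itv `[0, +oo[)); rewrite setTI; congr measurable.
  by apply/seteqP; split => s /=; rewrite in_itv/= andbT subr_ge0.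
have := bmeas_patch mA mv; congr bmeas; apply/funext => s.
by rewrite (_ : (s \in A) = (`|v s| <= b s))//; apply/idP/idP => [/set_mem|/mem_set].
Qed.

Lemma adm_trunc v : bmeas v -> admissible (fun s => if `|v s| <= control_bound s then v s else 0).
Proof.
move=> mv; split=> [|s]; first exact: (bmeas_trunc mv measurable_cM).
by case: ifP => // _; rewrite normr0 cM_ge0.
Qed.

(** The selections of (F2) are glued with y frozen at the nodes of ever finer grids, and
    [Phi_closure] yields a limit. The required total boundedness comes from (F5) applied to the
    range of y, which has finite nets of every radius. *)
Lemma selection y : X0 y -> exists g, admissible g /\
  {ae mu, forall s : R, 0 <= s <= T -> F s (y s) (g s)}.
Proof.
move=> y0.
have Fsel x : exists f : R -> E, bmeas f /\ {ae mu, forall s : R, 0 <= s <= T -> F s x (f s)}.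
  by have [f mf Ff] := F_selection x; exists f.
have [f fP] := choice Fsel.
pose node := node T; pose nodeP n s := @node_cell _ _ T0 n s.
pose cl n j : set R := `[node n j, node n j.+1[%classic.
pose v n s : E := \sum_(j < n.+2) restr (cl n j) (f (y (node n j))) s.
have vE n s : 0 <= s <= T -> v n s = f (y (node n (cell T n s))) s.
  move=> sI; have [jn _ _ _] := nodeP n s sI; have /andP[s0 _] := sI.
  rewrite /v (bigD1 (Ordinal jn))//= big1 ?addr0 => [|j /eqP jc].
    by rewrite /restr /cl mem_set//= in_itv/=; exact: cell_itv.
  rewrite /restr /cl memNset//= in_itv/= => /(@cell_eq _ _ T0) js; apply: jc.
  exact: val_inj.
(* The truncation ensures admissibility; on [0, T] it acts only on a null set, since the node lies
   to the left of s, where the weight is no larger. *)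
pose w n s : E := if `|v n s| <= control_bound s then v n s else 0.
have aw n : admissible (w n).
  apply: adm_trunc; apply: (@bmeas_sum _ _ n.+2 (fun j => restr (cl n j) (f (y (node n j))))).
  by move=> j; apply: bmeas_patch; [exact: measurable_itv|case: (fP (y (node n j)))].
have sel : {ae mu, forall s : R, forall n j, 0 <= s <= T -> F s (y (node n j)) (f (y (node n j)) s)}.
  apply: (ae_forall (P := fun n s => forall j, _)) => n.
  by apply: (ae_forall (P := fun j s => _)) => j; case: (fP (y (node n j))).
have wF : {ae mu, forall s : R, 0 <= s <= T -> forall n, F s (y (node n (cell T n s))) (w n s)}.
  apply: (ae_imp (ae_and sel F_growth)) => s [sl gr] sI n.
  have [_ nI ns _] := nodeP n s sI.
  rewrite /w vE// ifT; first exact: sl.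
  apply: le_trans (gr sI _ _ (sl n (cell T n s) sI)) _.
  rewrite ler_wpM2l// lerD2l; have [+ _] := y0 => /(_ (node n (cell T n s))).
  move=> /(_ nI)/le_trans; apply.
  by rewrite ler_wpM2l ?le_weight.
pose Om : set E := [set y s | s in [set s | 0 <= s <= T]].
have Om_fnet e : 0 < e -> fnet e Om.
  move=> e0; have e2 : 0 < e / 2 by rewrite divr_gt0.
  have [d d0 dP] := X0_close e2; have [n nd] := small_cells T0 d0.
  exists [seq y (node n j) | j <- iota 0 n.+2] => _ [s sI <-].
  have [jn nI _ sn] := nodeP n s sI.
  exists (y (node n (cell T n s))).
    by apply/mapP; exists (cell T n s) => //; rewrite mem_iota add0n.
  apply: (@le_lt_trans _ _ (e / 2)); last by lra.
  by apply: (dP y) => //; exact: lt_trans nd.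
have [||u [au Fu _]] := @Phi_closure w y aw; last by exists u.
  have := F_fnet (lexx 0) Om_fnet => Fn.
  apply: (ae_imp (ae_and Fn wF)) => s [{}Fn {}wF] sI e e0.
  apply: fnetS (Fn sI e _); last by rewrite mulr0.
  move=> _ [n _ <-]; exists (y (node n (cell T n s))); last exact: wF.
  by have [_ nI _ _] := nodeP n s sI; exists (node n (cell T n s)).
apply: (ae_imp wF) => s Fw sI rho rho0.
have [d d0 dP] := X0_close rho0; have [n0 nd] := small_cells T0 d0.
exists n0 => n n0n; apply: sub_clco; exists (y (node n (cell T n s))); last exact: Fw.
have [_ nI _ sn] := nodeP n s sI.
rewrite /= distrC; apply: (dP y) => //.
apply: lt_le_trans sn (le_trans _ (ltW nd)).
by rewrite ler_pM2l// lef_pV2 ?posrE// ler_nat.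
Qed.

(** * Approximate solutions and their contraction *)

(** Only values of paths in K are used as neighbours of z: this keeps the controls in the totally
    bounded sets [Fh s K], and a finite net of K can supply the selections. *)
Definition Geps (e : R) s z : set E :=
  clco (\bigcup_(y in [set y | K y /\ `|y s - z| <= e]) F s (y s)).

Definition Seps (e : R) : set (R -> E) := [set Phi w | w in [set w | admissible w /\
  {ae mu, forall s : R, 0 <= s <= T -> Geps e s (Phi w s) (w s)}]].

Lemma Geps_Fh e s z : Geps e s z `<=` Fh s K.
Proof. by apply: clcoS => v [y [Ky _] Fv]; right; exists y. Qed.

Lemma Seps_K e : Seps e `<=` K.
Proof.
move=> _ [w [aw wG] <-]; apply: Phi_K; split => //.
by apply: (ae_imp wG) => s wGs sI; apply: Geps_Fh; exact: wGs.
Qed.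

Lemma SepsS e e' : e <= e' -> Seps e `<=` Seps e'.
Proof.
move=> ee' _ [w [aw wG] <-]; exists w => //; split => //.
apply: (ae_imp wG) => s wGs sI; move: (wGs sI); apply: clcoS => v [y [Ky yz] Fv].
by exists y => //; split => //; exact: le_trans ee'.
Qed.

Lemma Sol_Seps e : 0 < e -> solutions `<=` ucl (Seps e).
Proof.
move=> e0 x Sx d d0; have [w [aw wF xw]] := Sx; exists (Phi w); last first.
  by move=> t tI; rewrite xw// subrr normr0 ltW.
exists w => //; split => //; apply: (ae_imp wF) => s wFs sI.
apply: sub_clco; exists x; last exact: wFs.
by split; [exact: Sol_K|rewrite xw// subrr normr0 ltW].
Qed.

(** The radius of [Geps] and the distance from [Phi (w n)] to x are both at most 1 / (n + 1), so the
    controls end up in every [Fball] around x and [Phi_closure] applies. *)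
Lemma Seps_limit x : (forall n, ucl (Seps n.+1%:R^-1) x) -> solutions x.
Proof.
move=> xS; have e0 n : 0 < n.+1%:R^-1 :> R by rewrite invr_gt0.
have hw n : exists w, [/\ admissible w,
    {ae mu, forall s : R, 0 <= s <= T -> Geps n.+1%:R^-1 s (Phi w s) (w s)} &
    uniformly_close n.+1%:R^-1 (Phi w) x].
  by have [_ [w [aw wG] <-] wx] := xS n _ (e0 n); exists w.
have [w wP] := choice hw.
have aw n : admissible (w n) by case: (wP n).
have wG := ae_forall (P := fun n s => 0 <= s <= T -> Geps n.+1%:R^-1 s (Phi (w n) s) (w n s))
  (fun n => let: And3 _ h _ := wP n in h).
have wx n : uniformly_close n.+1%:R^-1 (Phi (w n)) x by case: (wP n).
have [||u [au uF uP]] := @Phi_closure w x aw.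
- apply: (ae_imp (ae_and wG Fh_tb)) => s [wGs tb] sI e e0'.
  apply: fnetS (tb sI e e0') => _ [n _ <-]; apply: Geps_Fh; exact: wGs.
- apply: (ae_imp wG) => s wGs sI rho rho0.
  have rho2 : 0 < rho / 2 by rewrite divr_gt0.
  have [n0 n0P] := small_cells (ltr01 : 0 < 1 :> R) rho2.
  exists n0 => n n0n; move: (wGs n sI); apply: clcoS => v [y [Ky yz] Fv].
  exists (y s) => //=; rewrite -(subrKA (Phi (w n) s)).
  apply: le_trans (ler_normD _ _) _; have := wx n s sI; move: yz.
  have : n.+1%:R^-1 <= n0.+1%:R^-1 :> R by rewrite lef_pV2 ?posrE// ler_nat.
  move: n0P; rewrite mul1r; move: (n.+1%:R^-1) (n0.+1%:R^-1) => p q; lra.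
- exists u; split => // t tI; apply/esym/uP => //; apply/cvgrPdist_le => e e0'.
  have [n0 n0P] := small_cells (ltr01 : 0 < 1 :> R) e0'.
  exists n0 => // n /= n0n; rewrite distrC; apply: le_trans (wx n t tI) _.
  apply: le_trans (ltW n0P); rewrite mul1r.
  by rewrite lef_pV2 ?posrE// ler_nat.
Qed.

Lemma kint_local t w1 w2 : (forall s, 0 <= s <= t -> w1 s = w2 s) -> kint t w1 = kint t w2.
Proof.
move=> h; rewrite /kint (_ : (fun s => kern t s (w1 s)) = (fun s => kern t s (w2 s)))//.
by apply/funext => s; rewrite /kern; case: ifP => // /h ->.
Qed.

Lemma kint0 t : kint t (fun=> 0) = 0.
Proof.
by apply: kint_eq; apply: eq_wint (wint0 mI) => s _; rewrite kern0.
Qed.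

Lemma adm0 : admissible (fun=> 0).
Proof. by split=> [|s]; [exact: bmeas_cst|rewrite normr0 cM_ge0]. Qed.

Lemma kint_sum t n (b : 'I_n -> R) (w : 'I_n -> R -> E) : 0 <= t <= T ->
  (forall i, admissible (w i)) ->
  kint t (fun s => \sum_i b i *: w i s) = \sum_i b i *: kint t (w i).
Proof.
move=> tI aw; apply: kint_eq.
have := @wint_sum _ _ _ mI n (fun i s => b i *: kern t s (w i s)) (fun i => b i *: kint t (w i))
  (fun i s => `|b i| * (C * control_bound s)).
have h1 i := wintZ (b i) (adm_kintP tI (aw i)).
move=> /(_ h1) h; apply: eq_wint (h _ _ _) => [s _|i|i s _|i].
- rewrite /kern; case: ifP => _; last by rewrite big1// => i _; rewrite scaler0.
  by rewrite linear_sum; apply: eq_bigr => i _; rewrite linearZ.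
- apply: bmeas_scale; first exact: measurable_cst.
  by apply: bmeas_kern => //; case: (aw i).
- rewrite normrZ ler_wpM2l//; apply: le_trans (kern_le _ _ (andP tI).2) _.
  by rewrite ler_wpM2l//; case: (aw i).
- by do 2 apply: (intgZ mI); exact: integrable_cM.
Qed.

Lemma kint_bound t w : 0 <= t <= T -> admissible w -> `|kint t w| <= modulus 0 T.
Proof.
move=> tI aw; have /andP[t0 tT] := tI.
apply: le_trans (kint_le tI aw.1 (fun s _ => aw.2 s) integrable_cM) _.
rewrite /modulus subr0; apply: (@le_trans _ _ (\int[mu]_(s in I) (\1_`[0, T]%classic s * (C * control_bound s)))).
  have ik := intgZ mI C integrable_cM.
  apply: le_Rintegral => //.
  - by apply: (intg_indic mI); [exact: measurable_itv|exact: ik].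
  - by apply: (intg_indic mI); [exact: measurable_itv|exact: ik].
  - move=> s Is; rewrite ler_wpM2r//; first by rewrite mulr_ge0 ?cM_ge0.
    by rewrite !indicE [in leRHS]mem_set//; case: (s \in _).
by rewrite lerDr !mulr_ge0// ltW.
Qed.

Lemma kint_restr_close t w (a1 a2 b : R) : 0 <= t <= T -> admissible w -> a1 <= a2 ->
  `|kint t (restr `]a1, b]%classic w) - kint t (restr `]a2, b]%classic w)| <=
  \int[mu]_(s in I) (\1_`[a1, a2]%classic s * (C * control_bound s)).
Proof.
move=> tI aw a12.
have ar (r : R) : admissible (restr `]r, b]%classic w) by apply: adm_restr.
have ik := intgZ mI C integrable_cM.
apply: (wint_norm mI (wintB mI (adm_kintP tI (ar a1)) (adm_kintP tI (ar a2))
  (bmeas_kern tI (ar a1).1) (bmeas_kern tI (ar a2).1) (kern_adm tI (ar a1)) (kern_adm tI (ar a2)) ik ik)).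
- by apply: bmeasB; apply: bmeas_kern => //; [case: (ar a1)|case: (ar a2)].
- move=> s _; rewrite -kernB; apply: le_trans (kern_le _ _ (andP tI).2) _.
  rewrite [leRHS]mulrCA ler_wpM2l// /restr indicE.
  have [/set_mem/=|s1] := boolP (s \in `[a1, a2]%classic).
    move=> _; rewrite mul1r; have := aw.2 s.
    case: ifP; case: ifP => _ _ //; rewrite ?subrr ?subr0 ?sub0r ?normrN ?normr0 ?cM_ge0//.
  suff -> : (s \in `]a1, b]%classic) = (s \in `]a2, b]%classic).
    by rewrite subrr normr0 mul0r.
  apply/idP/idP => /set_mem/=; rewrite in_itv/= => /andP[h1 h2]; apply/mem_set; rewrite /= in_itv/= h2 andbT.
    rewrite ltNge; apply/negP => h3; move/negP: s1; apply; apply/mem_set.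
    by rewrite /= in_itv/= h3 ltW.
  exact: le_lt_trans h1.
- by apply: (intg_indic mI); [exact: measurable_itv|exact: ik].
Qed.

Section homotopy.
Variables (eps : R) (eps0 : 0 < eps) (m : nat) (node : nat -> R).
Hypotheses (node0 : node 0 = 0) .
Hypothesis node_I : forall j, (j <= m)%N -> 0 <= node j <= T.
Hypothesis node_close : forall x j s, X0 x -> (j < m)%N -> node j <= s <= node j.+1 ->
  `|x s - x (node j)| <= eps / 4.
Variables (p : nat) (y g : 'I_p -> R -> E).
Hypothesis yK : forall i, K (y i).
Hypothesis ynet : forall x, K x -> exists i, uniformly_close (eps / 4) x (y i).
Hypothesis gadm : forall i, admissible (g i).
Hypothesis gF : forall i, {ae mu, forall s : R, 0 <= s <= T -> F s (y i s) (g i s)}.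

(** A partition of unity on the values at the node j. On K the total is positive because some y i is
    within eps / 4, while a positive weight forces a distance at most eps / 2. Where the total
    vanishes all weights are 0, whence a sum at most 1 without any condition. *)
Definition bump j i z := Num.max 0 (eps / 2 - `|z - y i (node j)|).
Definition total j z := \sum_i bump j i z.
Definition theta j i z := bump j i z / total j z.

Let bump0 j i z : 0 <= bump j i z. Proof. by rewrite le_max lexx. Qed.

Let total0 j z : 0 <= total j z. Proof. by apply: sumr_ge0. Qed.

Lemma theta_ge0 j i z : 0 <= theta j i z.
Proof. by rewrite divr_ge0. Qed.

Lemma sum_theta j z : 0 < total j z -> \sum_i theta j i z = 1.
Proof. by move=> t0; rewrite -mulr_suml divff// gt_eqF. Qed.

Lemma sum_theta_le1 j z : \sum_i theta j i z <= 1.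
Proof.
rewrite -mulr_suml -/(total j z); have := total0 j z; rewrite le_eqVlt => /predU1P[<-|t0].
  by rewrite mul0r.
by rewrite divff// gt_eqF.
Qed.

Lemma theta_gt0 j i z : 0 < theta j i z -> `|z - y i (node j)| <= eps / 2.
Proof.
move=> h; rewrite leNgt; apply/negP => h'; move: h; rewrite /theta /bump max_l ?mul0r ?ltxx//.
by rewrite subr_le0 ltW.
Qed.

Lemma total_gt0 j x : (j <= m)%N -> K x -> 0 < total j (x (node j)).
Proof.
move=> jm Kx; have [i xi] := ynet Kx; rewrite /total (bigD1 i)//=.
rewrite ltr_pwDl ?sumr_ge0// lt_max; apply/orP; right.
by have := xi _ (node_I jm); move: eps0; lra.
Qed.

Lemma theta_cvg j z : 0 < total j z ->
  \sum_i `|theta j i z' - theta j i z| @[z' --> z] --> 0.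
Proof.
move=> t0.
have cb i : bump j i z' @[z' --> z] --> bump j i z.
  apply: (@continuous_max _ _ (fun=> 0) (fun z => eps / 2 - `|z - y i (node j)|)).
    exact: cvg_cst.
  apply: cvgB; first exact: cvg_cst.
  by apply: cvg_norm; apply: cvgB; [exact: cvg_id|exact: cvg_cst].
have ct : total j z' @[z' --> z] --> total j z.
  by apply: cvg_big => [|i _]; [exact: add_continuous|exact: cb].
have -> : nbhs (0 : R) = nbhs (\sum_(i < p) `|theta j i z - theta j i z|).
  by rewrite big1// => i _; rewrite subrr normr0.
apply: cvg_big => [|i _]; [exact: add_continuous|apply: cvg_norm]; apply: cvgB; last exact: cvg_cst.
by apply: cvgM => //; apply: cvgV => //; rewrite gt_eqF.
Qed.

(* Keeps x up to [max tau (node j)], then follows the selections frozen at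
   [node j] up to [node j.+1], then the control 0. *)
Definition step j (tau : R) (x : R -> E) t : E :=
  U t (Num.min (Num.max tau (node j)) t) (x (Num.min (Num.max tau (node j)) t)) +
  \sum_i theta j i (x (node j)) *:
    kint t (restr `]Num.max tau (node j), node j.+1]%classic (g i)).

(** The control that generates the path [step j tau (Phi w)]; see [step_Phi]. *)
Definition splice j (tau : R) (w : R -> E) s : E :=
  restr `]-oo, Num.max tau (node j)]%classic w s +
  \sum_i theta j i (Phi w (node j)) *: restr `]Num.max tau (node j), node j.+1]%classic (g i) s.

Let max_I j tau : (j <= m)%N -> 0 <= tau <= T -> 0 <= Num.max tau (node j) <= T.
Proof.
move=> /node_I/andP[n0 nT] /andP[t0 tT]; by rewrite le_max t0 ge_max tT.
Qed.

Let min_I (b t : R) : 0 <= b <= T -> 0 <= t <= T -> 0 <= Num.min b t <= t.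
Proof. by move=> /andP[b0 bT] /andP[t0 tT]; rewrite le_min b0 t0 ge_min lexx orbT. Qed.

Lemma step_ext j tau x x' : (j < m)%N -> 0 <= tau <= T ->
  (forall t, 0 <= t <= T -> x t = x' t) ->
  forall t, 0 <= t <= T -> step j tau x t = step j tau x' t.
Proof.
move=> jm tauI xx t tI; rewrite /step (xx (node j)) ?node_I ?(ltnW jm)//.
have /andP[h1 h2] := min_I (max_I (ltnW jm) tauI) tI.
by rewrite xx// h1 (le_trans h2)//; case/andP: tI.
Qed.

Lemma splice_le j tau w s : s <= Num.max tau (node j) -> splice j tau w s = w s.
Proof.
move=> sa; rewrite /splice /restr mem_set/= ?in_itv//= big1 ?addr0// => i _.
by rewrite memNset ?scaler0//= in_itv/= ltNge sa.
Qed.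

Lemma splice_gt j tau w s : Num.max tau (node j) < s -> s <= node j.+1 ->
  splice j tau w s = \sum_i theta j i (Phi w (node j)) *: g i s.
Proof.
move=> sa sn; rewrite /splice /restr memNset/= ?in_itv/= 1?leNgt ?sa// add0r.
by apply: eq_bigr => i _; rewrite mem_set//= in_itv/= sa.
Qed.

Lemma splice_out j tau w s : Num.max tau (node j) < s -> node j.+1 < s ->
  splice j tau w s = 0.
Proof.
move=> sa sn; rewrite /splice /restr memNset/= ?in_itv/= 1?leNgt ?sa// add0r.
by rewrite big1// => i _; rewrite memNset ?scaler0//= in_itv/= sa leNgt sn.
Qed.

Let adm_tail j tau w : admissible (fun s => \sum_i theta j i (Phi w (node j)) *:
  restr `]Num.max tau (node j), node j.+1]%classic (g i) s).
Proof.
apply: adm_sum => [i||i]; first exact: theta_ge0.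
  exact: sum_theta_le1.
by apply: adm_restr.
Qed.

Let adm_head j tau w : admissible w -> admissible (restr `]-oo, Num.max tau (node j)]%classic w).
Proof. by move=> aw; apply: adm_restr. Qed.

Lemma adm_splice j tau w : admissible w -> admissible (splice j tau w).
Proof.
move=> aw; split=> [|s].
  by apply: bmeasD; [case: (adm_head j tau aw)|case: (adm_tail j tau w)].
have [sa|sa] := leP s (Num.max tau (node j)).
  by rewrite splice_le//; case: aw.
rewrite /splice {1}/restr memNset/=; last by rewrite in_itv/= leNgt sa.
by rewrite add0r; case: (adm_tail j tau w).
Qed.

Lemma step_Phi j tau w t : (j < m)%N -> 0 <= tau <= T -> admissible w -> 0 <= t <= T ->
  step j tau (Phi w) t = Phi (splice j tau w) t.
Proof.
move=> jm tauI aw tI; rewrite {2}/Phi /splice kintD//; last exact: adm_head.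
rewrite kint_sum//; last by move=> i; apply: adm_restr.
rewrite /step addrA; congr (_ + _).
have /andP[b0 bt] := min_I (max_I (ltnW jm) tauI) tI; have /andP[t0 tT] := tI.
rewrite /Phi linearD (UU _ (lexx 0) b0 bt tT) (U_kint b0 bt tT aw); congr (_ + _).
apply: kint_local => s /andP[_ st]; rewrite /restr.
have -> : (s \in `]-oo, Num.min (Num.max tau (node j)) t]%classic) =
    (s \in `]-oo, Num.max tau (node j)]%classic) => //.
by apply/idP/idP => /set_mem/=; rewrite in_itv/= => h; apply/mem_set; rewrite /= in_itv/=;
  move: h; rewrite le_min st andbT.
Qed.

Lemma Nsel_splice j tau w : (j < m)%N -> Nsel K w -> Nsel K (splice j tau w).
Proof.
move=> jm Kw; have [aw wF] := Kw; split; first exact: adm_splice.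
have t0 : 0 < total j (Phi w (node j)) by apply: (total_gt0 (ltnW jm)); exact: Phi_K.
apply: (ae_imp (ae_and wF (ae_forall_ord gF))) => s [ws gs] sI.
have [sa|sa] := leP s (Num.max tau (node j)); first by rewrite splice_le//; exact: ws.
have [sn|sn] := leP s (node j.+1); last by rewrite splice_out//; apply: sub_clco; left.
rewrite splice_gt//; apply: cvx_sum (@cvx_clco _ _ _) _ _ _ => [i||i _].
- exact: theta_ge0.
- exact: sum_theta.
- by apply: sub_clco; right; exists (y i) => //; exact: gs.
Qed.

(** Five errors of e / 8. Three concern the kept part: x' against x, x at two close times, and U at
    two close initial times. Two concern the tail: the weights, continuous at x (node j), and the
    integrals, which depend continuously on the left end of their interval. *)
Lemma step_cont j tau x (e : R) : (j < m)%N -> 0 <= tau <= T -> K x -> 0 < e ->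
  exists2 d : R, 0 < d & forall tau' x', 0 <= tau' <= T -> `|tau' - tau| < d ->
    uniformly_close d x' x -> uniformly_close e (step j tau' x') (step j tau x).
Proof.
move=> jm tauI Kx e0; have Xx := K_X0 Kx.
have B0 := modulus_ge0 (lexx 0) (ltW T0) (lexx T); set B := modulus 0 T in B0.
have e1 : 0 < e / 8 / (B + 1) by rewrite !divr_gt0// ltr_pwDr.
have /nbhs_ballP[d1 /= d10 d1P] : \forall z' \near x (node j),
    \sum_i `|theta j i z' - theta j i (x (node j))| <= e / 8 / (B + 1).
  move/cvgrPdist_le: (theta_cvg (total_gt0 (ltnW jm) Kx)) => /(_ _ e1).
  by apply: filterS => z'; rewrite sub0r normrN; apply: le_trans; exact: ler_norm.
have C8 : 0 < e / 8 / C by rewrite !divr_gt0.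
have [d2 d20 d2P] := X0_close C8.
have e8 : 0 < e / 8 by rewrite divr_gt0.
have [d3 d30 d3P] := Rintegral_itv_small T0 (fun s => mulr_ge0 C0 (cM_ge0 s))
  (intgZ mI C integrable_cM) e8.
have k0 : 0 <= C * a * (path_bound * weight T) by rewrite !mulr_ge0.
have d40 : 0 < e / 8 / (C * a * (path_bound * weight T) + 1) by rewrite !divr_gt0// ltr_pwDr.
set d4 := e / 8 / (C * a * (path_bound * weight T) + 1) in d40.
have d5 : 0 < Num.min (Num.min (d1 / 2) (e / 8 / C)) (Num.min d2 (Num.min d3 d4)).
  by rewrite !lt_min C8 d20 d30 d40 divr_gt0.
exists (Num.min (Num.min (d1 / 2) (e / 8 / C)) (Num.min d2 (Num.min d3 d4))) => //.
move=> tau' x' tauI' ttau xx t tI; have /andP[t0 tT] := tI.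
move: ttau; rewrite !lt_min => /andP[_ /andP[td2 /andP[td3 td4]]].
have xx1 r : 0 <= r <= T -> `|x' r - x r| <= d1 / 2 /\ `|x' r - x r| <= e / 8 / C.
  by move=> /xx; rewrite !le_min => /andP[/andP[-> ->] _].
pose al := Num.max tau (node j); pose al' := Num.max tau' (node j).
have alI : 0 <= al <= T by apply: max_I => //; exact: ltnW.
have alI' : 0 <= al' <= T by apply: max_I => //; exact: ltnW.
have al_le : `|al' - al| <= `|tau' - tau| by exact: max_dist.
pose b := Num.min al t; pose b' := Num.min al' t.
have bI : 0 <= b <= t by exact: min_I.
have bI' : 0 <= b' <= t by exact: min_I.
have b_le : `|b' - b| <= `|al' - al| by exact: min_dist.
have bT : 0 <= b <= T by case/andP: bI => -> /le_trans ->.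
have bT' : 0 <= b' <= T by case/andP: bI' => -> /le_trans ->.
rewrite /step -/al -/al' -/b -/b'.
pose J (r : R) i := kint t (restr `]r, node j.+1]%classic (g i)).
pose th z i := theta j i z.
have JB r i : `|J r i| <= B by apply: kint_bound => //; apply: adm_restr.
have JJ i : `|J al' i - J al i| <= e / 8.
  have hsmall (r r' : R) : r <= r' -> `|r' - r| < d3 -> `|J r i - J r' i| <= e / 8.
    move=> rr' rd; apply: le_trans (kint_restr_close _ tI (gadm i) rr') _.
    by apply: d3P => //; move: rd; rewrite ger0_norm ?subr_ge0.
  have aad : `|al' - al| < d3 by exact: le_lt_trans td3.
  have [h|/ltW h] := leP al al'; first by rewrite distrC; exact: hsmall.
  by apply: hsmall => //; rewrite distrC.
have partA : `|U t b' (x' b') - U t b (x b)| <= e / 8 + e / 8 + e / 8.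
  have -> : U t b' (x' b') - U t b (x b) =
      U t b' (x' b' - x b') + U t b' (x b' - x b) + (U t b' (x b) - U t b (x b)).
    by rewrite !linearB/= !subrKA.
  have h1 : `|U t b' (x' b' - x b')| <= e / 8.
    case/andP: bI' => b0' bt'; apply: le_trans (UC _ b0' bt' tT) _.
    rewrite mulrC -ler_pdivlMr//.
    by have [] := xx1 _ bT'.
  have h2 : `|U t b' (x b' - x b)| <= e / 8.
    case/andP: bI' => b0' bt'; apply: le_trans (UC _ b0' bt' tT) _.
    rewrite mulrC -ler_pdivlMr//.
    apply: d2P => //; apply: le_lt_trans td2; exact: le_trans al_le.
  have h3 : `|U t b' (x b) - U t b (x b)| <= e / 8.
    apply: le_trans (U_lipschitz _ bI' bI tT) _.
    have xb : `|x b| <= path_bound * weight T.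
      have [xM _] := Xx; apply: le_trans (xM b bT) _.
      by rewrite ler_wpM2l ?le_weight//; case/andP: bT.
    have bd : `|b' - b| <= d4 by apply: ltW; apply: le_lt_trans td4; exact: le_trans al_le.
    apply: (@le_trans _ _ (d4 * (C * a * (path_bound * weight T)))).
      rewrite [leLHS](_ : _ = `|b' - b| * (C * a * `|x b|)); last by ring.
      by apply: ler_pM => //; rewrite ?mulr_ge0// ler_wpM2l// mulr_ge0.
    have p1 : 0 < C * a * (path_bound * weight T) + 1 by rewrite ltr_pwDr.
    rewrite /d4 mulrAC ler_pdivrMr// ler_wpM2l ?(ltW e8)//.
    by rewrite lerDl.
  apply: le_trans (ler_normD _ _) (lerD _ h3).
  exact: le_trans (ler_normD _ _) (lerD h1 h2).
have partB : `|\sum_i th (x' (node j)) i *: J al' i - \sum_i th (x (node j)) i *: J al i| <= e / 8 + e / 8.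
  have -> : \sum_i th (x' (node j)) i *: J al' i - \sum_i th (x (node j)) i *: J al i =
      \sum_i (th (x' (node j)) i - th (x (node j)) i) *: J al' i +
      \sum_i th (x (node j)) i *: (J al' i - J al i).
    rewrite -sumrB -big_split/=; apply: eq_bigr => i _.
    by rewrite scalerBl scalerBr subrKA.
  have h1 : `|\sum_i (th (x' (node j)) i - th (x (node j)) i) *: J al' i| <= e / 8.
    apply: le_trans (ler_norm_sum _ _ _) _.
    apply: (@le_trans _ _ ((\sum_i `|th (x' (node j)) i - th (x (node j)) i|) * B)).
      by rewrite mulr_suml; apply: ler_sum => i _; rewrite normrZ ler_wpM2l.
    have hb : ball (x (node j)) d1 (x' (node j)).
      rewrite -ball_normE/= distrC; have [h _] := xx1 _ (node_I (ltnW jm)).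
      by apply: le_lt_trans h _; rewrite ltr_pdivrMr// ltr_pMr// ltr1n.
    apply: le_trans (ler_wpM2r B0 (d1P _ hb)) _.
    have p1 : 0 < B + 1 by rewrite ltr_pwDr.
    by rewrite mulrAC ler_pdivrMr// ler_wpM2l ?(ltW e8)// lerDl.
  have h2 : `|\sum_i th (x (node j)) i *: (J al' i - J al i)| <= e / 8.
    apply: le_trans (ler_norm_sum _ _ _) _.
    apply: (@le_trans _ _ ((\sum_i th (x (node j)) i) * (e / 8))).
      rewrite mulr_suml; apply: ler_sum => i _; rewrite normrZ ger0_norm ?theta_ge0//.
      by rewrite ler_wpM2l// theta_ge0.
    by rewrite ler_piMl ?(ltW e8)// sum_theta_le1.
  exact: le_trans (ler_normD _ _) (lerD h1 h2).
rewrite opprD addrACA; apply: le_trans (ler_normD _ _) _.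
apply: le_trans (lerD partA partB) _; move: (ltW e0); lra.
Qed.

Lemma step_K j tau x : (j < m)%N -> 0 <= tau <= T -> K x -> K (step j tau x).
Proof.
move=> jm tauI Kx; apply: ucl_K => e e0.
have [d d0 dP] := step_cont jm tauI Kx e0.
have [_ [w Kw <-] wx] := K_sub Kx d0.
exists (Phi (splice j tau w)); first by apply: Phi_K; exact: Nsel_splice.
move=> t tI; rewrite -step_Phi//; last by case: Kw.
by apply: dP => //; rewrite subrr normr0.
Qed.

(** A step whose cell ends before tau merely cuts the control after tau, its tail being integrated
    over an empty interval; the step whose cell contains tau starts the selections at tau, and the
    later ones continue. For tau = T everything is kept; for tau = 0 the first step retains only x
    0. *)
Fixpoint deform k (tau : R) (x : R -> E) :=
  if k is k'.+1 then step k' tau (deform k' tau x) else x.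

Lemma deform_K k tau x : (k <= m)%N -> 0 <= tau <= T -> K x -> K (deform k tau x).
Proof.
by move=> + tauI Kx; elim: k => //= k IH km; apply: step_K => //; apply: IH; exact: ltnW.
Qed.

Lemma deform_cont k tau x (e : R) : (k <= m)%N -> 0 <= tau <= T -> K x -> 0 < e ->
  exists2 d : R, 0 < d & forall tau' x', 0 <= tau' <= T -> `|tau' - tau| < d ->
    uniformly_close d x' x -> uniformly_close e (deform k tau' x') (deform k tau x).
Proof.
move=> + tauI Kx; elim: k e => [|k IH] e km e0; first by exists e.
have [d d0 dP] := step_cont km tauI (deform_K (ltnW km) tauI Kx) e0.
have [d' d0' dP'] := IH d (ltnW km) d0.
exists (Num.min d d'); first by rewrite lt_min d0.
move=> tau' x' tauI'; rewrite lt_min => /andP[td td'] xx /=; apply: dP => //.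
by apply: dP' => // t tI; apply: le_trans (xx t tI) _; rewrite ge_min lexx orbT.
Qed.

(** Up to the time reached by the first k steps the control satisfies the approximate inclusion;
    afterwards it only stays in the hulls of K, which suffices to keep the path in K. *)
Let good k (tau : R) w := Nsel K w /\ {ae mu, forall s : R, 0 <= s <= T ->
  s <= Num.max tau (node k) -> Geps eps s (Phi w s) (w s)}.

(** On the new cell a selection g i with positive weight comes from a path y i within eps / 4 + eps
    / 2 + eps / 4 of the new path: the oscillation of y i, the distance at the node, and the
    oscillation of the new path. *)
Lemma step_good k tau w : (k < m)%N -> 0 <= tau <= T -> good k tau w ->
  good k.+1 tau (splice k tau w).
Proof.
move=> km tauI [Kw wG]; have [aw _] := Kw; split; first exact: Nsel_splice.
have t0 : 0 < total k (Phi w (node k)) by apply: (total_gt0 (ltnW km)); exact: Phi_K.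
have Phi_le s : s <= Num.max tau (node k) -> Phi (splice k tau w) s = Phi w s.
  move=> sa; rewrite /Phi; congr (_ + _); apply: kint_local => r /andP[_ rs].
  by rewrite splice_le// (le_trans rs).
apply: (ae_imp (ae_and wG (ae_forall_ord gF))) => s [ws gs] sI sk.
have [sa|sa] := leP s (Num.max tau (node k)).
  by rewrite splice_le// Phi_le//; exact: ws.
have sn : s <= node k.+1.
  by move: sk sa; rewrite le_max gt_max => /orP[|//] h /andP[/lt_le_trans/(_ h)]; rewrite ltxx.
rewrite splice_gt//; apply: cvx_sum (@cvx_clco _ _ _) _ _ _ => [i||i th0].
- exact: theta_ge0.
- exact: sum_theta.
- apply: sub_clco; exists (y i); last exact: gs.
  split=> //; have h1 := theta_gt0 th0.
  have ks : node k <= s <= node k.+1 by rewrite sn andbT ltW// (le_lt_trans _ sa)// le_max lexx orbT.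
  have h2 := node_close (K_X0 (yK i)) km ks.
  have h3 := node_close (Phi_X0 (adm_splice k tau aw)) km ks.
  rewrite (Phi_le (node k)) in h3; last by rewrite le_max lexx orbT.
  have -> : y i s - Phi (splice k tau w) s = (y i s - y i (node k)) -
      (Phi w (node k) - y i (node k)) - (Phi (splice k tau w) s - Phi w (node k)).
    by rewrite !opprB !subrKA.
  have := ler_normB (y i s - y i (node k) - (Phi w (node k) - y i (node k)))
    (Phi (splice k tau w) s - Phi w (node k)).
  have := ler_normB (y i s - y i (node k)) (Phi w (node k) - y i (node k)).
  by move: h1 h2 h3; lra.
Qed.

Lemma deform_good k tau w : (k <= m)%N -> 0 <= tau <= T -> good 0 tau w ->
  exists2 w', good k tau w' & forall t, 0 <= t <= T -> deform k tau (Phi w) t = Phi w' t.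
Proof.
move=> + tauI gw; elim: k => [|k IH] km; first by exists w.
have [w' gw' ww'] := IH (ltnW km); exists (splice k tau w'); first exact: step_good.
move=> t tI /=; rewrite (step_ext km tauI ww') ?step_Phi//.
by case: gw' => -[].
Qed.

Hypothesis nodem : node m = T.

Lemma deform_Seps tau x : 0 <= tau <= T -> ucl (Seps eps) x -> ucl (Seps eps) (deform m tau x).
Proof.
move=> tauI Sx e e0; have Kx : K x by apply: ucl_K; apply: uclS Sx; exact: Seps_K.
have [d d0 dP] := deform_cont (leqnn m) tauI Kx e0.
have [_ [w [aw wG] <-] wx] := Sx d d0.
have gw : good 0 tau w.
  split; last by apply: (ae_imp wG) => s ws sI _; exact: ws.
  by split => //; apply: (ae_imp wG) => s ws sI; apply: Geps_Fh; exact: ws.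
have [w' [[aw' _] wG'] ww'] := deform_good (leqnn m) tauI gw.
exists (Phi w').
  exists w'; [split; first exact: aw'|by []].
  apply: (ae_imp wG') => s ws sI; apply: ws => //.
  by rewrite nodem le_max; case/andP: sI => _ ->; rewrite orbT.
by move=> t tI; rewrite -ww'//; apply: dP => //; rewrite subrr normr0.
Qed.

Lemma deform_T k x t : (k <= m)%N -> 0 <= t <= T -> deform k T x t = x t.
Proof.
have TI : 0 <= T <= T by rewrite lexx ltW.
move=> + tI; elim: k => //= k IH km; have /andP[t0 tT] := tI.
have /andP[_ nT] := node_I (ltnW km).
rewrite /step max_l// min_r// Uid// IH ?(ltnW km)// big1 ?addr0// => i _.
rewrite (@kint_local _ _ (fun=> 0)) ?kint0 ?scaler0// => s /andP[_ st].
by rewrite /restr memNset//= in_itv/= ltNge (le_trans st).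
Qed.

Lemma deform_0 k x x' : (0 < k <= m)%N -> x 0 = x' 0 ->
  forall t, 0 <= t <= T -> deform k 0 x t = deform k 0 x' t.
Proof.
have zI : 0 <= (0 : R) <= T by rewrite lexx ltW.
move=> /andP[]; case: k => // k _; elim: k => [|k IH] km xx t tI.
  by rewrite /= /step node0 maxxx min_l ?xx//; case/andP: tI.
by rewrite [LHS]/= [RHS]/=; apply: step_ext => // s sI; apply: IH => //; exact: ltnW.
Qed.

(** The deformation at tau = 0 starts from the control 0, for which the inclusion is required only
    on the null set {0}. *)
Lemma Seps_nonempty : (0 < m)%N -> Seps eps !=set0.
Proof.
move=> m0; have zI : 0 <= (0 : R) <= T by rewrite lexx ltW.
have g0 : good 0 0 (fun=> 0).
  split; first by split; [exact: adm0|apply: ae_all => s _; apply: sub_clco; left].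
  have : {ae mu, forall s : R, s != 0}.
    exists [set 0]; split => //; first exact: lebesgue_measure_set1.
    by move=> s /= /negP; rewrite negbK => /eqP.
  move=> h; apply: (ae_imp h) => s /eqP s0 /andP[s0' _]; rewrite node0 maxxx => s0''.
  by case: s0; apply/eqP; rewrite eq_le s0'' s0'.
have [w' [[aw' _] wG'] _] := deform_good (leqnn m) zI g0.
exists (Phi w'), w'; [split; first exact: aw'|by []].
apply: (ae_imp wG') => s ws sI; apply: ws => //.
by rewrite nodem le_max; case/andP: sI => _ ->; rewrite orbT.
Qed.

End homotopy.

Lemma Seps_contractible (eps : R) : 0 < eps -> Seps eps !=set0 /\
  exists H : R -> (R -> E) -> R -> E, [/\
    forall tau x (e : R), 0 <= tau <= T -> K x -> 0 < e ->
      exists2 d : R, 0 < d & forall tau' x', 0 <= tau' <= T -> `|tau' - tau| < d ->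
        uniformly_close d x' x -> uniformly_close e (H tau' x') (H tau x),
    forall tau x, 0 <= tau <= T -> ucl (Seps eps) x -> ucl (Seps eps) (H tau x),
    forall x t, 0 <= t <= T -> H T x t = x t &
    forall x x' t, x 0 = x' 0 -> 0 <= t <= T -> H 0 x t = H 0 x' t].
Proof.
move=> eps0; have e4 : 0 < eps / 4 by rewrite divr_gt0.
have [d d0 dP] := X0_close e4; have [m md] := small_cells T0 d0.
pose node j : R := j%:R * T / m.+1%:R.
have node0 : node 0 = 0 by rewrite /node !mul0r.
have node_I j : (j <= m.+1)%N -> 0 <= node j <= T.
  move=> jm; rewrite divr_ge0 ?mulr_ge0 ?(ltW T0)//= ler_pdivrMr// mulrC.
  by rewrite ler_wpM2l ?(ltW T0)// ler_nat.
have node_close x j s : X0 x -> (j < m.+1)%N -> node j <= s <= node j.+1 ->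
    `|x s - x (node j)| <= eps / 4.
  move=> Xx jm /andP[h1 h2]; have /andP[n0 nT] := node_I j (ltnW jm).
  have /andP[_ nT'] := node_I j.+1 jm.
  apply: dP => //; rewrite ?n0 ?nT ?(le_trans n0 h1) ?(le_trans h2 nT')//.
  rewrite ger0_norm ?subr_ge0//; apply: le_lt_trans md; rewrite lerBlDr.
  by apply: le_trans h2 _; rewrite /node -natr1 !mulrDl mul1r addrC.
have nodem : node m.+1 = T by rewrite /node mulrAC divff ?mul1r// pnatr_eq0.
have [p [y [yK ynet]]] := K_net e4.
have [g gP] := choice (fun i => selection (K_X0 (yK i))).
have gadm i : admissible (g i) by case: (gP i).
have gF i : {ae mu, forall s : R, 0 <= s <= T -> F s (y i s) (g i s)} by case: (gP i).
split; first by eapply Seps_nonempty; eauto.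
exists (deform eps node y g m.+1); split.
- by move=> tau x e tauI Kx e0; eapply deform_cont; eauto.
- by move=> tau x tauI Sx; eapply deform_Seps; eauto.
- by move=> x t tI; eapply deform_T; eauto.
- by move=> x x' t xx tI; eapply deform_0; try solve [eauto]; rewrite ltnS leq0n leqnn.
Qed.

Lemma ucl_Seps_0 e x : ucl (Seps e) x -> x 0 = x0.
Proof.
have zI : 0 <= (0 : R) <= T by rewrite lexx ltW.
move=> Sx; apply/eqP; rewrite -subr_eq0 -normr_le0; apply/ler_addgt0Pr => r r0.
have [_ [w [aw _] <-] wx] := Sx r r0; rewrite add0r distrC -(Phi0 aw); exact: wx.
Qed.

(** * Mild solutions *)

Lemma eq_bochner (D : set R) (f g : R -> E) v : (forall t, D t -> f t = g t) ->
  is_bochner_integral D f v -> is_bochner_integral D g v.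
Proof.
move=> fg [[s ss sf] [s' [ss' s'f s'v]]]; split.
  by exists s => //; apply: (ae_imp sf) => t h Dt; rewrite -fg//; exact: h.
exists s'; split => //.
have <- // : (fun n => \int[mu]_(t in D) `|s' n t - f t|%:E)%E =
    (fun n => \int[mu]_(t in D) `|s' n t - g t|%:E)%E.
by apply/funext => n; apply: eq_integral => t /set_mem Dt; rewrite fg.
Qed.

Lemma wint_extend t w v : 0 <= t <= T ->
  wint `[0, t]%classic (fun s => kern t s (w s)) v <-> wint I (fun s => kern t s (w s)) v.
Proof.
move=> /andP[t0 tT].
have eqi (e : {linear E -> R^o}) : \int[mu]_(s in `[0, t]) (e (kern t s (w s)) : R) =
    \int[mu]_(s in I) (e (kern t s (w s)) : R).
  rewrite /Rintegral integral_mkcond [in RHS]integral_mkcond; congr fine.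
  apply: eq_integral => s _; rewrite !patchE.
  have [/set_mem/=|h] := boolP (s \in `[0, t]%classic).
    rewrite in_itv/= => /andP[s0 st]; rewrite mem_set//= in_itv/= s0.
    exact: le_trans tT.
  case: ifP => // _; rewrite /kern; case: ifP => [st|_]; last by rewrite linear0.
  by case/negP: h; apply/mem_set; rewrite /= in_itv.
by split=> h e ce; rewrite (h e ce) eqi.
Qed.

Definition mild (x : R -> E) := exists w, [/\ bochner_integrable I w,
  {ae mu, forall s : R, 0 <= s <= T -> F s (x s) (w s)} &
  forall t : R, 0 <= t <= T -> exists2 v,
    is_bochner_integral `[0, t]%classic (fun s => U t s (w s)) v & x t = U t 0 x0 + v].

Lemma Sol_mild x : solutions x -> mild x.
Proof.
move=> [w [aw wF xw]]; exists w; split => //.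
  have [v [vw _]] := @wint_bochner _ _ _ mI Ifin w control_bound aw.1 (fun s _ => aw.2 s) integrable_cM.
  by exists v.
move=> t tI; have /andP[t0 tT] := tI.
have mt : measurable (`[0, t]%classic : set (measurableTypeR R)) by exact: measurable_itv.
have tfin : (mu `[0%R, t]%classic < +oo)%E by rewrite lebesgue_measure_itv/=; case: ifP; rewrite ltry.
have ib : mu.-integrable `[0, t]%classic (EFin \o (fun s => C * control_bound s)).
  apply: integrableS (intgZ mI C integrable_cM) => //.
  by move=> s /=; rewrite !in_itv/= => /andP[-> /le_trans->].
have [v [vb vw]] := @wint_bochner _ _ _ mt tfin _ _ (bmeas_kern tI aw.1)
  (fun s _ => le_trans (kern_le s (w s) tT) (ler_wpM2l C0 (aw.2 s))) ib.
exists v; last by rewrite xw// /Phi; congr (_ + _); apply: kint_eq; apply/wint_extend.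
apply: eq_bochner vb => s /=; rewrite in_itv/= => st; by rewrite /kern st.
Qed.

(** The control agrees almost everywhere on [0, T] with a function satisfying [bmeas], and by the
    growth condition truncating the latter at c (1 + B * weight) changes it there only on a null
    set. *)
Lemma mild_rep (x : R -> E) (B : R) : mild x -> 0 <= B ->
  (forall t : R, 0 <= t <= T -> `|x t| <= B * weight t) ->
  exists w, [/\ bmeas w, forall s, `|w s| <= c s * (1 + B * weight s),
    {ae mu, forall s : R, 0 <= s <= T -> F s (x s) (w s)} &
    forall t : R, 0 <= t <= T -> x t = Phi w t].
Proof.
move=> [w [[v [ws _]] wF xw]] B0 xB.
have [w1 [mw1 ww1]] := strongly_measurable_bmeas mI ws.
pose b s := c s * (1 + B * weight s).
have mw2 := bmeas_trunc mw1 (measurable_growth B).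
set w2 := fun s => if _ then w1 s else 0 in mw2.
have ww2 : {ae mu, forall s : R, 0 <= s <= T -> w s = w2 s}.
  apply: (ae_imp (ae_and ww1 (ae_and wF F_growth))) => s [h1 [h2 h3]] sI.
  have Is : I s by rewrite /= in_itv.
  rewrite /w2 -h1// ifT//; apply: le_trans (h3 sI _ _ (h2 sI)) _.
  by rewrite ler_wpM2l// lerD2l xB.
exists w2; split => //.
- move=> s; rewrite /w2; case: ifP => // _.
  by rewrite normr0 mulr_ge0// addr_ge0// mulr_ge0.
- by apply: (ae_imp (ae_and ww2 wF)) => s [h1 h2] sI; rewrite -h1//; exact: h2.
move=> t tI; have [u ub ->] := xw t tI; rewrite /Phi; congr (_ + _); apply/esym/kint_eq.
apply/wint_extend => //; have /andP[t0 tT] := tI.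
have mt : measurable (`[0, t]%classic : set (measurableTypeR R)) by exact: measurable_itv.
have tfin : (mu `[0%R, t]%classic < +oo)%E by rewrite lebesgue_measure_itv/=; case: ifP; rewrite ltry.
have [|_ //] := bochner_wint mt tfin ub (bmeas_kern tI mw2).
apply: (ae_imp ww2) => s h /=; rewrite in_itv/= => st; rewrite /kern st h//.
by case/andP: st => -> /le_trans ->.
Qed.

(* The best constant [b] in [`|x t| <= b * weight t] satisfies
   [b <= C * `|x0| + (1 + b) / 4]. *)
Lemma mild_Sol x (B : R) : (forall t : R, 0 <= t <= T -> `|x t| <= B) -> mild x -> solutions x.
Proof.
move=> xB mx; pose S := [set b | 0 <= b /\ forall t : R, 0 <= t <= T -> `|x t| <= b * weight t].
have S0 : S !=set0.
  exists `|B|; split => // t tI; apply: le_trans (xB t tI) _.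
  by apply: le_trans (ler_norm B) _; rewrite ler_peMr// weight_ge1.
have lbS : has_lbound S by exists 0 => b [].
have wpos t : 0 < weight t by rewrite exprn_gt0.
have [b0 xb] : S (inf S).
  split; first by apply: lb_le_inf => // b [].
  move=> t tI; rewrite -ler_pdivrMr//; apply: lb_le_inf => // b [_ bP].
  by rewrite ler_pdivrMr//; exact: bP.
have : S (C * `|x0| + (1 + inf S) * 4^-1).
  have C00 : 0 <= C * `|x0| by rewrite mulr_ge0.
  split; first by rewrite addr_ge0// mulr_ge0// addr_ge0.
  move=> t tI; have [w [mw wb wF xw]] := mild_rep mx b0 xb.
  have /andP[t0 tT] := tI; rewrite xw// mulrDl.
  apply: le_trans (ler_normD _ _) _; apply: lerD.
    by apply: le_trans (UC x0 (lexx 0) t0 tT) _; rewrite ler_peMr// weight_ge1.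
  apply: le_trans (kint_le tI mw (fun s _ => wb s) (integrable_growth b0)) _.
  exact: weighted_bound.
move=> /(inf_lbound lbS) bM.
have {}bM : inf S <= path_bound.
  have : 0 <= C * `|x0| by rewrite mulr_ge0.
  by rewrite /path_bound -mulrA; move: bM; move: (inf S) (C * `|x0|) => p q; lra.
have [||w [mw wb wF xw]] := @mild_rep x path_bound mx; first exact: M0.
  by move=> t tI; apply: le_trans (xb t tI) _; rewrite ler_wpM2r.
by exists w.
Qed.

(** The analytic half of the proof, phrased with functions on R and uniform closeness on [0, T]
    only; the topological half uses nothing else about the inclusion. *)
Theorem mild_solution_paths : exists KS : nat -> set (R -> E), [/\
  (forall n, KS n.+1 `<=` KS n) /\ (forall n, ucl (KS n) `<=` KS n),
  forall e : R, 0 < e -> exists2 d : R, 0 < d & forall n x r t, KS n x ->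
    0 <= r <= T -> 0 <= t <= T -> `|t - r| < d -> `|x t - x r| <= e,
  forall e : R, 0 < e -> exists m (y : 'I_m -> R -> E),
    forall n x, KS n x -> exists i, uniformly_close e x (y i),
  forall n, KS n !=set0 /\ exists H : R -> (R -> E) -> R -> E, [/\
    forall tau x (e : R), 0 <= tau <= T -> KS n x -> 0 < e ->
      exists2 d : R, 0 < d & forall tau' x', 0 <= tau' <= T -> `|tau' - tau| < d ->
        uniformly_close d x' x -> uniformly_close e (H tau' x') (H tau x),
    forall tau x, 0 <= tau <= T -> KS n x -> KS n (H tau x),
    forall x t, 0 <= t <= T -> H T x t = x t &
    forall x x' t, KS n x -> KS n x' -> 0 <= t <= T -> H 0 x t = H 0 x' t] &
  (forall x, (forall n, KS n x) -> mild x) /\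
  (forall x (B : R), (forall t : R, 0 <= t <= T -> `|x t| <= B) -> mild x -> forall n, KS n x)].
Proof.
have e0 n : 0 < n.+1%:R^-1 :> R by rewrite invr_gt0.
have KSK n : ucl (Seps n.+1%:R^-1) `<=` K.
  by move=> x Sx; apply: ucl_K; apply: uclS Sx; exact: Seps_K.
exists (fun n => ucl (Seps n.+1%:R^-1)); split.
- split=> n; last exact: ucl_idem.
  by apply: uclS; apply: SepsS; rewrite lef_pV2 ?posrE// ler_nat.
- move=> e /X0_close[d d0 dP]; exists d => // n x r t /KSK/K_X0; exact: dP.
- move=> e /K_net[m [y [_ yP]]]; exists m, y => n x /KSK; exact: yP.
- move=> n; have [[x Sx] [H [H1 H2 H3 H4]]] := Seps_contractible (e0 n); split.
    by exists x; exact: ucl_sub.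
  exists H; split => //.
    by move=> tau y e tI /KSK; exact: H1.
  by move=> y y' t /ucl_Seps_0 y0 /ucl_Seps_0 y0' tI; apply: H4; rewrite ?y0.
- split=> [x xS|x B xB mx n]; first exact/Sol_mild/Seps_limit.
  exact/(Sol_Seps (e0 n))/(mild_Sol xB).
Qed.

End differential_inclusion.

(** * The space of continuous functions *)

Section metric_continuity.
Context {R : realType} {X Y : pseudoMetricType R}.

Lemma ball_within_continuous (A : set X) (f : X -> Y) :
  (forall x (e : R), A x -> 0 < e -> exists2 d : R, 0 < d &
    forall y, A y -> ball x d y -> ball (f x) e (f y)) -> {within A, continuous f}.
Proof.
move=> h; apply/subspace_continuousP => x Ax B /nbhs_ballP[e e0 eB].
have [d d0 dP] := h x e Ax e0; apply/nbhs_ballP; exists d => // y xy Ay.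
exact/eB/dP.
Qed.

Lemma ball_continuous (f : X -> Y) : (forall x (e : R), 0 < e -> exists2 d : R, 0 < d &
    forall y, ball x d y -> ball (f x) e (f y)) -> continuous f.
Proof.
move=> h x B /nbhs_ballP[e e0 eB]; have [d d0 dP] := h x e e0.
by apply/nbhs_ballP; exists d => // y xy; exact/eB/dP.
Qed.

End metric_continuity.

(* The ambient space of the compacta: distances are truncated at 1 because the
   paths need not be bounded. *)
Definition path_space (R : realType) (E : normedModType R) : Type := R -> E.

Section path_space.
Context {R : realType} {E : normedModType R}.
Local Notation Y := (path_space E).
Implicit Types x y z : Y.

Definition path_dist x y : R := sup [set Num.min 1 `|x t - y t| | t in [set: R]].

Lemma path_dist_le x y e : (forall t, `|x t - y t| <= e) -> path_dist x y <= e.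
Proof.
move=> xy; apply: ge_sup => [|_ [t _ <-]]; first by exists (Num.min 1 `|x 0 - y 0|), 0.
by rewrite ge_min xy orbT.
Qed.

Lemma min_path_dist x y t : Num.min 1 `|x t - y t| <= path_dist x y.
Proof.
apply: ub_le_sup; last by exists t.
by exists 1 => _ [s _ <-]; rewrite ge_min lexx.
Qed.

Lemma path_dist_lt x y e : e <= 1 -> path_dist x y < e -> forall t, `|x t - y t| < e.
Proof.
move=> e1 xy t; have := le_lt_trans (min_path_dist x y t) xy.
by rewrite gt_min ltNge e1.
Qed.

Lemma path_distxx x : path_dist x x = 0.
Proof.
apply/eqP; rewrite eq_le; apply/andP; split.
  by apply: path_dist_le => t; rewrite subrr normr0.
apply: le_trans (min_path_dist x x 0); by rewrite subrr normr0 le_min ler01 lexx.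
Qed.

Lemma path_dist_eq0 x y : path_dist x y = 0 -> x = y.
Proof.
move=> xy0; apply/funext => t; apply/eqP; rewrite -subr_eq0 -normr_le0 leNgt.
apply/negP => xyt; have := min_path_dist x y t; rewrite xy0 leNgt => /negP; apply.
by rewrite lt_min ltr01.
Qed.

Lemma path_dist_sym x y : path_dist x y = path_dist y x.
Proof.
by rewrite /path_dist; congr sup; apply: eq_imagel => t _; rewrite distrC.
Qed.

Lemma path_dist_triangle y x z : path_dist x z <= path_dist x y + path_dist y z.
Proof.
apply: ge_sup => [|_ [t _ <-]]; first by exists (Num.min 1 `|x 0 - z 0|), 0.
apply: le_trans (lerD (min_path_dist x y t) (min_path_dist y z t)).
have := ler_normD (x t - y t) (y t - z t); rewrite subrKA.
have := normr_ge0 (x t - y t); have := normr_ge0 (y t - z t).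
move: (`|x t - y t|) (`|y t - z t|) (`|x t - z t|) => p q r.
by have [] := leP 1 p; have [] := leP 1 q; have [] := leP 1 r; lra.
Qed.

HB.instance Definition _ := Choice.copy Y (arrow_uniform_type R E).
HB.instance Definition _ := isMetric.Build R Y path_distxx path_dist_eq0
  path_dist_sym path_dist_triangle.

Lemma path_ballE x e : ball x e = [set y | path_dist x y < e].
Proof. exact: ballEmdist. Qed.

End path_space.

(** * Compact sets of paths and their intersection *)

Section solution_sets.
Context {R : realType} {E : completeNormedModType R}.
Variables (T : R) (T0 : 0 < T).
Local Notation I := (`[0, T]%classic : set R).
Local Notation Z := (cont_space T E).
Local Notation Y := (path_space E).

Definition clamp (t : R) : R := Num.max 0 (Num.min t T).

Lemma clamp_itv t : 0 <= clamp t <= T.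
Proof. by rewrite /clamp le_max lexx ge_max (ltW T0) ge_min lexx orbT. Qed.

Lemma clamp_id t : 0 <= t <= T -> clamp t = t.
Proof. by move=> /andP[t0 tT]; rewrite /clamp min_l// max_r. Qed.

Lemma clamp_dist s t : `|clamp s - clamp t| <= `|s - t|.
Proof.
rewrite /clamp ![Num.max 0 _]maxC; apply: le_trans (max_dist _ _ _) _.
exact: min_dist.
Qed.

Definition point t (tI : 0 <= t <= T) : I :=
  exist _ t (mem_set (ltac:(by rewrite /= in_itv) : I t)).

Definition ev (z : Z) : Y := fun t => z (point (clamp_itv t)).

Lemma ev_clamp z t : ev z (clamp t) = ev z t.
Proof. by rewrite /ev; congr (z _); apply: val_inj; rewrite /= clamp_id// clamp_itv. Qed.

Lemma evE z t (It : t \in I) : ev z t = z (exist _ t It).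
Proof.
rewrite /ev; congr (z _); apply: val_inj => /=; apply: clamp_id.
by have /set_mem := It; rewrite /= in_itv.
Qed.

Lemma ball_cont_space (z z' : Z) e : (forall t : I, `|z t - z' t| < e) -> ball z e z'.
Proof.
move=> h; suff : forall t, ball (z t) e (z' t) by [].
by move=> t; rewrite -ball_normE/=.
Qed.

Lemma ball_cont_spaceE (z z' : Z) e : ball z e z' -> forall t : I, `|z t - z' t| < e.
Proof.
move=> h t; have : ball (z t) e (z' t) by exact: h.
by rewrite -ball_normE.
Qed.

Lemma ev_continuous z : continuous (ev z).
Proof.
move=> t; apply: (@continuous_comp _ _ _ (fun t => point (clamp_itv t)) z); last exact: cts_fun.
apply: continuous_comp_initial; apply: ball_continuous => {}t e e0; exists e => // s.
by rewrite -!ball_normE; apply: le_lt_trans; exact: clamp_dist.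
Qed.

Lemma ev_bounded z : exists B : R, forall t, `|ev z t| <= B.
Proof.
have : compact (ev z @` I).
  apply: continuous_compact; last exact: segment_compact.
  by apply: continuous_subspaceT; exact: ev_continuous.
move=> /compact_bounded[B [_ Bz]]; exists (B + 1) => t.
rewrite -ev_clamp; apply: Bz; first by rewrite ltrDl.
by exists (clamp t) => //=; rewrite in_itv/= clamp_itv.
Qed.

(** The value for discontinuous x is a default; all paths in the sets [KS n] are continuous on I. *)
Definition of_path (x : Y) : Z :=
  match pselect (continuous (fun t : I => x (val t))) with
  | left cx => mkcts cx
  | right _ => mkcts (@cst_continuous I E 0)
  end.

Lemma of_pathE (x : Y) : continuous (fun t : I => x (val t)) ->
  forall t : I, of_path x t = x (val t).
Proof. by move=> cx t; rewrite /of_path; case: pselect. Qed.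

Variable KS : nat -> set (R -> E).
Hypothesis KS_decreasing : forall n, KS n.+1 `<=` KS n.
Hypothesis KS_closed : forall n, ucl T (KS n) `<=` KS n.
Hypothesis KS_close : forall e : R, 0 < e -> exists2 d : R, 0 < d & forall n x r t, KS n x ->
  0 <= r <= T -> 0 <= t <= T -> `|t - r| < d -> `|x t - x r| <= e.
Hypothesis KS_net : forall e : R, 0 < e -> exists m (y : 'I_m -> R -> E),
  forall n x, KS n x -> exists i, uniformly_close T e x (y i).
Hypothesis KS_homotopy : forall n, KS n !=set0 /\ exists H : R -> (R -> E) -> R -> E, [/\
  forall tau x (e : R), 0 <= tau <= T -> KS n x -> 0 < e ->
    exists2 d : R, 0 < d & forall tau' x', 0 <= tau' <= T -> `|tau' - tau| < d ->
      uniformly_close T d x' x -> uniformly_close T e (H tau' x') (H tau x),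
  forall tau x, 0 <= tau <= T -> KS n x -> KS n (H tau x),
  forall x t, 0 <= t <= T -> H T x t = x t &
  forall x x' t, KS n x -> KS n x' -> 0 <= t <= T -> H 0 x t = H 0 x' t].

(** Invariance under [clamp] selects one representative of each path on [0, T], so that distances
    over all of R reduce to distances over [0, T]. *)
Definition KY n : set Y := [set x | (forall t, x (clamp t) = x t) /\ KS n x].

Lemma KS_ext n x y : (forall t, 0 <= t <= T -> x t = y t) -> KS n x -> KS n y.
Proof.
move=> xy Kx; apply: KS_closed => e e0; exists x => // t tI.
by rewrite xy// subrr normr0 ltW.
Qed.

Lemma KY_clamp n x : KS n x -> KY n (x \o clamp).
Proof.
move=> Kx; split=> [t /=|]; first by rewrite (clamp_id (clamp_itv t)).
by apply: KS_ext Kx => t tI /=; rewrite clamp_id.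
Qed.

Lemma KY_decreasing n : KY n.+1 `<=` KY n.
Proof. by move=> x [xc Kx]; split => //; exact: KS_decreasing. Qed.

Lemma KY_0 n : KY n `<=` KY 0.
Proof. by elim: n => // n IH; exact: subset_trans (@KY_decreasing n) IH. Qed.

(** Compactness is proved for the uniform structure on functions, whose completeness follows from
    that of E, and is carried over by the identity, which is continuous towards [path_dist]. *)
Lemma KY_compact n : compact (KY n).
Proof.
have cid : continuous (id : arrow_uniform_type R E -> Y).
  apply: ball_continuous => x e e0; exists (e / 2); first by rewrite divr_gt0.
  move=> y xy; rewrite path_ballE/=.
  apply: (@le_lt_trans _ _ (e / 2)); last by move: e0; lra.
  by apply: path_dist_le => t; have := xy t; rewrite -ball_normE => /ltW.
have := @continuous_compact (arrow_uniform_type R E) Y id (KY n).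
rewrite image_id; apply; first by apply: continuous_subspaceT.
apply: totally_bounded_compact => [F FF Fc|x clx|e e0].
- by exists (lim F); exact: fun_complete.
- have near_x (e : R) : 0 < e -> exists2 y, KY n y & forall t, `|x t - y t| < e.
    move=> e0; have [|y [Ky xy]] := clx (ball x e); first exact: nbhsx_ballx.
    by exists y => // t; have := xy t; rewrite -ball_normE.
  split=> [t|].
    apply/eqP; rewrite -subr_eq0 -normr_le0; apply/ler_addgt0Pr => e e0.
    have e2 : 0 < e / 2 by rewrite divr_gt0.
    have [y [yc _] xy] := near_x _ e2; rewrite add0r.
    rewrite -(subrKA (y t)) -{1}yc; apply: le_trans (ler_normD _ _) _.
    by have := xy t; have := xy (clamp t); rewrite (distrC (y t)); lra.
  apply: KS_closed => e /near_x[y [_ Ky] xy]; exists y => // t _.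
  by rewrite distrC; exact: ltW.
- have e2 : 0 < e / 2 by rewrite divr_gt0.
  have [m [y yP]] := KS_net e2.
  exists [seq (y i \o clamp : arrow_uniform_type R E) | i <- enum 'I_m].
  move=> x [xc Kx]; have [i xi] := yP n x Kx.
  exists (y i \o clamp); first by apply/mapP; exists i => //; rewrite mem_enum.
  move=> t; rewrite -ball_normE/= -xc distrC.
  by apply: le_lt_trans (xi _ (clamp_itv t)) _; rewrite ltr_pdivrMr// ltr_pMr// ltr1n.
Qed.

Lemma KY_closed n : closed (KY n).
Proof. by apply: compact_closed; [exact: metric_hausdorff|exact: KY_compact]. Qed.

Lemma KY_contractible n : contractible R (KY n).
Proof.
have [[x1 Kx1] [H [Hc HK HT H0]]] := KS_homotopy n.
have TI : 0 <= T <= T by rewrite lexx ltW.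
have zI : 0 <= (0 : R) <= T by rewrite lexx ltW.
have tauI (l : R) : 0 <= l <= 1 -> 0 <= (1 - l) * T <= T.
  move=> /andP[l0 l1]; rewrite mulr_ge0 ?subr_ge0 ?(ltW T0)//=.
  by rewrite ler_piMl ?(ltW T0)// gerBl.
exists (H 0 x1 \o clamp); first by apply: KY_clamp; exact: HK.
(* The homotopy parameter l corresponds to the time tau = (1 - l) T, which runs backwards from T to
   0. *)
exists (fun p : R * Y => (H ((1 - p.1) * T) p.2 \o clamp : Y)); split.
- apply: ball_within_continuous => -[l x] e [/= lI [xc Kx]] e0; rewrite in_itv/= in lI.
  have e2 : 0 < e / 2 by rewrite divr_gt0.
  have [d d0 dP] := Hc _ _ _ (tauI _ lI) Kx e2.
  (* The time tau moves T times as fast as l, and the truncated distance controls the paths only for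
     radii at most 1. *)
  exists (Num.min (d / T) (Num.min d 1)); first by rewrite !lt_min ltr01 d0 divr_gt0.
  move=> [l' x'] /= [l'I _] [/= ll xx]; rewrite in_itv/= in l'I; rewrite path_ballE/=.
  apply: (@le_lt_trans _ _ (e / 2)); last by move: e0; lra.
  apply: path_dist_le => t /=; rewrite distrC; apply: dP (clamp_itv t); first exact: tauI.
    rewrite -mulrBl opprB addrC subrKA normrM (gtr0_norm T0) -ltr_pdivlMr//.
    by move: ll; rewrite -ball_normE/= lt_min => /andP[].
  move=> s sI; rewrite distrC; move: xx; rewrite path_ballE/= => xx.
  have := path_dist_lt _ xx s; rewrite !ge_min lexx !orbT => /(_ isT).
  by rewrite !lt_min => /andP[_ /andP[/ltW]].
- move=> l x /=; rewrite in_itv/= => lI [_ Kx]; apply: KY_clamp; apply: HK => //.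
  exact: tauI.
- move=> x [xc Kx]; apply/funext => t /=; rewrite subr0 mul1r HT ?clamp_itv//.
- move=> x [xc Kx]; apply/funext => t /=; rewrite subrr mul0r; apply: H0 => //.
  exact: clamp_itv.
Qed.

(** Points chosen in the successive sets cluster in the compact [KY 0], and each closed [KY n]
    contains all but finitely many of them. *)
Lemma bigcap_KY_nonempty : \bigcap_n KY n !=set0.
Proof.
have [x xP] : exists x : nat -> Y, forall n, KY n (x n).
  have h n : exists x : Y, KY n x.
    by have [[x Kx] _] := KS_homotopy n; exists (x \o clamp); exact: KY_clamp.
  by have [x xP] := choice h; exists x.
have le_KY n m : (n <= m)%N -> KY m `<=` KY n.
  elim: m => [|m IH]; first by rewrite leqn0 => /eqP ->.
  rewrite leq_eqVlt => /predU1P[->//|nm].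
  by apply: subset_trans (@KY_decreasing m) _; exact: IH.
have [|p [_ px]] := @KY_compact 0 (x @ \oo) _.
  by exists 0%N => // n _; apply: KY_0; exact: xP.
exists p => n _; apply: KY_closed => B pB.
have [|y [Ky By]] := px (KY n) B _ pB; last by exists y.
by exists n => // m /= nm; apply: (le_KY n m).
Qed.

Lemma bigcap_KY_compact : compact (\bigcap_n KY n).
Proof.
apply: (subclosed_compact _ (@KY_compact 0)); last by move=> x; apply.
by apply: closed_bigI => n _; exact: KY_closed.
Qed.

Lemma KS_continuous n x : KS n x -> continuous (fun t : I => x (val t)).
Proof.
move=> Kx; have cx : continuous (fun s => x (clamp s)).
  apply: ball_continuous => s e e0; have e2 : 0 < e / 2 by rewrite divr_gt0.
  have [d d0 dP] := KS_close e2; exists d => // r.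
  rewrite -!ball_normE/= => sr; apply: (@le_lt_trans _ _ (e / 2)).
    by apply: dP Kx (clamp_itv _) (clamp_itv _) _; exact: le_lt_trans (clamp_dist _ _) sr.
  by move: e0; lra.
rewrite (_ : (fun t : I => _) = (fun s => x (clamp s)) \o (val : I -> R)).
  by move=> t; apply: continuous_comp; [exact: initial_continuous|exact: cx].
apply/funext => -[t It] /=; rewrite clamp_id//.
by have /set_mem := It; rewrite /= in_itv.
Qed.

Lemma ev_cont : continuous (ev : Z -> Y).
Proof.
apply: ball_continuous => z e e0; exists (e / 2); first by rewrite divr_gt0.
move=> z' zz'; rewrite path_ballE/=.
apply: (@le_lt_trans _ _ (e / 2)); last by move: e0; lra.
by apply: path_dist_le => t; apply: ltW; exact: ball_cont_spaceE.
Qed.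

Lemma of_path_ev (z : Z) n : KS n (ev z) -> of_path (ev z) = z.
Proof.
move=> Kz; apply/continuousEP => t; rewrite (of_pathE (KS_continuous Kz)).
by case: t => t It; exact: evE.
Qed.

Lemma ev_of_path n x : KY n x -> ev (of_path x) = x.
Proof.
move=> [xc Kx]; apply/funext => t; rewrite -[RHS]xc /ev.
by rewrite (of_pathE (KS_continuous Kx)).
Qed.

Lemma of_path_cont n : {within KY n, continuous of_path}.
Proof.
apply: ball_within_continuous => x e [xc Kx] e0.
exists (Num.min e 1); first by rewrite lt_min e0 ltr01.
move=> y [yc Ky] xy; apply: ball_cont_space => t.
rewrite (of_pathE (KS_continuous Kx)) (of_pathE (KS_continuous Ky)).
move: xy; rewrite path_ballE/= => xy.
have := path_dist_lt _ xy (val t); rewrite ge_min lexx orbT => /(_ isT).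
by rewrite lt_min => /andP[].
Qed.

Theorem Rdelta_paths (S : set Z) : (forall z, S z <-> forall n, KS n (ev z)) -> Rdelta R S.
Proof.
move=> SP; have SKY z : S z -> (\bigcap_n KY n) (ev z).
  by move=> /SP Kz n _; split => // t; exact: ev_clamp.
have KYS x : (\bigcap_n KY n) x -> S (of_path x).
  by move=> Kx; apply/SP => n; rewrite (ev_of_path (Kx n Logic.I)); case: (Kx n Logic.I).
have SE : S = of_path @` (\bigcap_n KY n).
  apply/seteqP; split=> [z Sz|_ [x Kx <-]]; last exact: KYS.
  by exists (ev z); [exact: SKY|apply: (@of_path_ev z 0); have /SP := Sz; exact].
have cont : {within \bigcap_n KY n, continuous of_path}.
  by apply: continuous_subspaceW (@of_path_cont 0) => x; apply.
split.
- by have [x Kx] := bigcap_KY_nonempty; exists (of_path x); exact: KYS.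
- by rewrite SE; apply: continuous_compact => //; exact: bigcap_KY_compact.
exists Y, KY; split; first exact: KY_decreasing.
  by move=> n; split; [exact: KY_compact|exact: KY_contractible].
exists ev, of_path; split => //.
- by apply: continuous_subspaceT; exact: ev_cont.
- by move=> z Sz; split; [exact: SKY|apply: (@of_path_ev z 0); have /SP := Sz; exact].
- by move=> x Kx; split; [exact: KYS|apply: (@ev_of_path 0); exact: Kx].
Qed.

End solution_sets.

(** * From the stated hypotheses to nets and nonnegative measurable bounds *)

Section hypotheses.
Context {R : realType} {E : completeNormedModType R}.
Notation mu := (@lebesgue_measure R).
Variables (T : R) (T0 : 0 < T).
Local Notation I := (`[0, T]%classic : set R).

Lemma mild_ev (U : R -> R -> {linear E -> E}) (F : R -> E -> set E) (x0 : E)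
    (z : cont_space T E) :
  mild_solutions U F x0 z <-> mild T x0 U F (ev T0 z).
Proof.
split=> -[w [wb wF zw]]; exists w; split=> //.
- apply: (ae_imp wF) => t h tI; have It : t \in I by apply/mem_set; rewrite /= in_itv.
  by rewrite (evE T0 z It).
- move=> t tI; have It : t \in I by apply/mem_set; rewrite /= in_itv.
  by rewrite (evE T0 z It); exact: zw.
- apply: (ae_imp wF) => t h It; rewrite -(evE T0 z It); apply: h.
  by have /set_mem := It; rewrite /= in_itv.
- move=> t It; rewrite -(evE T0 z It); apply: zw.
  by have /set_mem := It; rewrite /= in_itv.
Qed.

(** The bounds of (F4) and (F5) may be negative, and nothing is known of them outside I; the
    absolute value on I, extended by 0, still bounds and is measurable and nonnegative
    everywhere. *)
Lemma integrable_extension (c : R -> R) : mu.-integrable I (EFin \o c) ->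
  exists c' : R -> R, [/\ measurable_fun setT c', forall t, 0 <= c' t,
    mu.-integrable I (EFin \o c') & forall t, 0 <= t <= T -> c' t = `|c t|].
Proof.
move=> ic; have mI : measurable (I : set (measurableTypeR R)) by exact: measurable_itv.
have c'E t : 0 <= t <= T -> ((fun t => `|c t|) \_ I) t = `|c t|.
  by move=> tI; rewrite patchE mem_set//= in_itv.
exists ((fun t => `|c t|) \_ I); split=> //.
- have mc : measurable_fun I c by apply/measurable_EFinP; case/integrableP: ic.
  apply/(measurable_restrictT _ mI).
  by apply: measurableT_comp mc; exact: normr_measurable.
- by move=> t; rewrite patchE; case: ifP => //= _; exact: normr_ge0.
- have := integrable_norm ic; apply: eq_integrable => // t /set_mem /=.
  by rewrite in_itv/= => tI; rewrite c'E.
Qed.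

Lemma hausdorff_mnc_le (Omega : set E) (r : R) : 0 <= r ->
  (forall e, r < e -> fnet e Omega) -> (hausdorff_mnc Omega <= r%:E)%E.
Proof.
move=> r0 fO; apply/lee_addgt0Pr => e e0; apply: ereal_inf_lbound.
exists (r + e); last by rewrite EFinD.
split; first by rewrite ltr_wpDl.
have [|s sP] := fO (r + e); first by rewrite ltrDl.
by exists s => x /sP[c cs xc]; exists c; rewrite // -ball_normE/= distrC.
Qed.

Lemma hausdorff_mnc_ge0 (Omega : set E) : (0 <= hausdorff_mnc Omega)%E.
Proof. by apply: le_ereal_inf_tmp => _ [e [e0 _] <-]; rewrite lee_fin ltW. Qed.

Lemma hausdorff_mnc_fnet (Omega : set E) (e : R) : (hausdorff_mnc Omega < e%:E)%E ->
  fnet e Omega.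
Proof.
move=> /ereal_inf_lt[_ [r [r0 [s sP]] <-]]; rewrite lte_fin => re; exists s => x /sP[c /= cs].
by rewrite -ball_normE/= => cx; exists c => //; rewrite distrC (lt_trans cx).
Qed.

Lemma fnet_bounded (Omega : set E) (r : R) : fnet r Omega -> bounded_set Omega.
Proof.
move=> [s sP]; exists (\sum_(c <- s) `|c| + r); split; first exact: num_real.
move=> B sB x /sP[c cs xc]; apply: ltW; apply: le_lt_trans sB.
have : `|c| <= \sum_(c <- s) `|c|.
  by rewrite (big_rem c)//= lerDl sumr_ge0.
by have := ler_normD (x - c) c; rewrite subrK; lra.
Qed.

End hypotheses.

Theorem theorem3 (R : realType) (E : completeNormedModType R) (T : R)
  (T_gt0 : 0 < T) (x0 : E)
  (D : set E) (A : R -> linop E)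
  (P1 : dense D /\ forall t : R, t \in `[0, T] -> dom (A t) = D)
  (P2 : exists M : R, forall (t : R) (lambda : R[i]), t \in `[0, T] ->
     complex.Re lambda <= 0 ->
     exists2 Q : E * E -> E * E, is_resolvent (A t) lambda Q &
       (opnorm_wrt (@cplx_norm R E) Q <= (M / (Normc.normc lambda + 1))%:E)%E)
  (P3 : exists L alpha : R, 0 < alpha <= 1 /\
     forall s t tau : R, s \in `[0, T] -> t \in `[0, T] -> tau \in `[0, T] ->
       (opnorm (fun x : E => A t (opinv (A tau) x) - A s (opinv (A tau) x))%R
          <= (L * `|t - s| `^ alpha)%:E)%E)
  (Hi : forall t : R, t \in `[0, T] -> dom (A t) = [set: E])
  (Hii : forall x : E, {within `[0, T], continuous (fun t => opinv (A t) x)})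
  (U : R -> R -> {linear E -> E}) (U_evol : evolution_system T D A U)
  (Hiii : forall t s : R, t \in `[0, T] -> s \in `[0, t] ->
     opnorm (U t r \- U t s) @[r --> within `[0, t] (nbhs s)] --> 0%E)
  (F : R -> E -> set E)
  (F1 : forall (t : R) (x : E), t \in `[0, T] ->
     [/\ F t x !=set0, closed (F t x) & convex_set (F t x)])
  (F2 : forall x : E, exists2 f : R -> E, strongly_measurable `[0, T] f &
     forall t : R, t \in `[0, T] -> F t x (f t))
  (F3 : {ae (@lebesgue_measure R), forall t : R, t \in `[0, T] ->
     upper_hemicontinuous (F t)})
  (F4 : exists2 c : R -> R,
     (@lebesgue_measure R).-integrable `[0, T] (EFin \o c) &
     {ae (@lebesgue_measure R), forall t : R, t \in `[0, T] -> forall x : E,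
       (ereal_sup [set `|y|%:E | y in F t x] <= (c t * (1 + `|x|))%:E)%E})
  (F5 : exists2 eta : R -> R,
     (@lebesgue_measure R).-integrable `[0, T] (EFin \o eta) &
     forall Omega : set E, bounded_set Omega ->
       {ae (@lebesgue_measure R), forall t : R, t \in `[0, T] ->
         (hausdorff_mnc (\bigcup_(x in Omega) F t x)
            <= (eta t)%:E * hausdorff_mnc Omega)%E}) :
  Rdelta R (mild_solutions U F x0 : set (cont_space T E)).
Proof.
have Iin (t : R) : 0 <= t <= T -> t \in `[0, T] by rewrite in_itv.
have [C [a HU]] := evolution_is_bounded T_gt0 P2 P3 Hi U_evol Hiii.
have [c [ic Fc]] := F4; have [c' [mc' c'0 ic' c'E]] := integrable_extension ic.
have [eta [ieta Feta]] := F5; have [eta' [meta' eta'0 ieta' eta'E]] := integrable_extension ieta.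
have C0 : 0 <= C by have [[/(le_trans ler01)]] := HU.
have h0 t : 0 <= C * (c' t + 8 * eta' t) by rewrite mulr_ge0// addr_ge0// mulr_ge0.
have mI := measurable_I T.
have ih : (@lebesgue_measure R).-integrable `[0, T] (EFin \o (fun t => C * (c' t + 8 * eta' t))).
  by apply: (intgZ mI); apply: (intgD mI ic'); exact: (intgZ mI).
have [N NP] := bielecki T_gt0 h0 ih (ltac:(by rewrite invr_gt0) : 0 < 4^-1 :> R).
have [|||||KS [[KS1 KS2] KS3 KS4 KS5 [KS6 KS7]]] :=
  @mild_solution_paths R E T T_gt0 x0 U C a HU F c' eta' N _ _ _ mc' c'0 ic' _ eta'0 ieta' _ NP.
- by move=> t x /Iin tI; have [F0 Fcl /convex_set_cvx] := F1 t x tI.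
- move=> x; have [f mf Ff] := F2 x.
  have [g [mg fg]] := strongly_measurable_bmeas mI mf; exists g => //.
  apply: (ae_imp fg) => t h tI.
  have <- : f t = g t by apply: h; rewrite /= in_itv.
  by apply: Ff; exact: Iin.
- by apply: (ae_imp F3) => t h /Iin; exact: h.
- apply: (ae_imp Fc) => t h tI x y Fxy; rewrite c'E//.
  have yc : (`|y|%:E <= (c t * (1 + `|x|))%:E)%E.
    by apply: le_trans (h (Iin t tI) x); apply: ereal_sup_ubound; exists y.
  rewrite lee_fin in yc; apply: le_trans yc _.
  by rewrite ler_wpM2r ?addr_ge0// ler_norm.
- move=> Omega r r0 fO; have bO : bounded_set Omega.
    by apply: (@fnet_bounded _ _ _ (r + 1)); apply: fO; rewrite ltrDl.
  apply: (ae_imp (Feta Omega bO)) => t h tI e; rewrite eta'E// => re.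
  apply: hausdorff_mnc_fnet; apply: le_lt_trans (h (Iin t tI)) _.
  apply: (@le_lt_trans _ _ (`|eta t|%:E * hausdorff_mnc Omega)%E).
    by rewrite lee_wpmul2r ?hausdorff_mnc_ge0// lee_fin ler_norm.
  apply: (@le_lt_trans _ _ (`|eta t|%:E * r%:E)%E); last by rewrite -EFinM lte_fin.
  by rewrite lee_wpmul2l ?lee_fin// hausdorff_mnc_le.
apply: (Rdelta_paths KS1 KS2 KS3 KS4 KS5) => z; rewrite (mild_ev T_gt0); split.
  have [B Bz] := ev_bounded T_gt0 z.
  by move=> mz; apply: (KS7 _ B) => // t _; exact: Bz.
exact: KS6.
Qed.
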